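(* Let $\mathcal{X} = (U_1 \otimes \dots \otimes U_D)\mathcal{S}$ be an orthogonal Tucker decomposition of a tensor $\mathcal{X} \in \mathbb{R}^{n_1 \times \dots \times n_D}$, i.e. $U_i \in \mathrm{St}(n_i,k_i)$ for $i = 1,\dots,D$, such that $\mathcal{S} \in \mathbb{R}^{k_1 \times \dots \times k_D}_\star$ and $k_i < n_i$ for at least one $i$. Let $\sigma := \min_{i:\, k_i < n_i} \sigma_{k_i}(\mathcal{S}_{(i)})$. Then: 1. $\kappa_{\star}^{inv}[G_{\mathcal{T}}](U_1,\dots,U_D,\mathcal{S}) = \max\left\{\frac{1}{\sigma}, 1\right\}$ for the absolute metric, and 2. $\kappa_{\star}^{inv}[G_{\mathcal{T}}](U_1,\dots,U_D,\mathcal{S}) = \frac{\|\mathcal{X}\|_F}{\sigma}$ for the relative metric. (Here $\mathcal{X}$ and $\mathcal{S}$ are tensors.)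
   Context: Tensors and flattenings. For a tensor $\mathcal{S}=\sum_{i=1}^R s_{i,1}\otimes\dots\otimes s_{i,D}\in\mathbb{R}^{k_1\times\dots\times k_D}$ (with $s_{i,j}\in\mathbb{R}^{k_j}$) and matrices $U_j\in\mathbb{R}^{n_j\times k_j}$, define $(U_1\otimes\dots\otimes U_D)\mathcal{S}:=\sum_{i=1}^R(U_1s_{i,1})\otimes\dots\otimes(U_Ds_{i,D})\in\mathbb{R}^{n_1\times\dots\times n_D}$. The $j$th flattening is the matrix $\mathcal{S}_{(j)}=\sum_{i=1}^R s_{i,j}\cdot\mathrm{vec}(s_{i,1}\otimes\dots\otimes s_{i,j-1}\otimes s_{i,j+1}\otimes\dots\otimes s_{i,D})^T$, where $\mathrm{vec}$ of a tensor product of vectors is their Kronecker product. $\mathbb{R}^{k_1\times\dots\times k_D}_\star$ is the set of tensors of full multilinear rank, i.e. with $\operatorname{rank}\mathcal{S}_{(j)}=k_j$ for all $j$. $\mathrm{St}(n,k)=\{U\in\mathbb{R}^{n\times k}: U^TU=I_k\}$; $\sigma_k(A)$ is the $k$th largest singular value of $A$; $\|\cdot\|_F$ is the Euclidean (Frobenius) norm. The map. With $\mathcal{Y}:=\mathrm{St}(n_1,k_1)\times\dots\times\mathrm{St}(n_D,k_D)\times\mathbb{R}^{k_1\times\dots\times k_D}_\star$, $G_{\mathcal{T}}:\mathcal{Y}\to\mathbb{R}^{n_1\times\dots\times n_D}$ is $(U_1,\dots,U_D,\mathcal{S})\mapsto(U_1\otimes\dots\otimes U_D)\mathcal{S}$.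 Its differential has constant rank. Metrics. Absolute metric: the Frobenius inner product on $\mathbb{R}^{n_1\times\dots\times n_D}$, on $\mathbb{R}^{k_1\times\dots\times k_D}_\star$ and on (tangent spaces of) each $\mathrm{St}(n_i,k_i)\subset\mathbb{R}^{n_i\times k_i}$, and the product metric on $\mathcal{Y}$. Relative metric: on a punctured Euclidean space $\mathbb{E}\setminus\{0\}$ the relative metric at $p$ is $\frac{\langle\xi,\eta\rangle}{\langle p,p\rangle}$; $\mathbb{R}^{n_1\times\dots\times n_D}\setminus\{0\}$ and $\mathbb{R}^{k_1\times\dots\times k_D}_\star$ carry the relative metric, each $\mathrm{St}(n_i,k_i)$ carries the Frobenius inner product, and $\mathcal{Y}$ carries the product metric. Feasible constant-rank equation (FCRE). For smooth manifolds $\mathcal{A},\mathcal{B},\mathcal{Z}$, $c\in\mathcal{Z}$ and a smooth map $F:\mathcal{A}\times\mathcal{B}\to\mathcal{Z}$, the equation $F(x,y)=c$ is an FCRE if for all $x\in\mathcal{A}$ there is $y\in\mathcal{B}$ with $F(x,y)=c$, and there is $r\in\mathbb{N}$ with $\operatorname{rank}\frac{\partial}{\partial y}F(x,y)=\operatorname{rank}DF(x,y)=r$ for all $(x,y)$. Latent condition number. If $F(x,y)=c$ is an FCRE, $\mathcal{A},\mathcal{B}$ are Riemannian, and $F(x_0,y_0)=c$, then for $x$ near $x_0$ the map $H_{y_0}(x):=\arg\min\{d_{\mathcal{B}}(y_0,y): y\in\mathcal{B},\ F(x,y)=c\}$ is well defined and smooth ($d$ denoting geodesic distance), and $\kappa_\star[F^{-1}(c)](x_0,y_0):=\limsup_{x\to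 x_0}\frac{d_{\mathcal{B}}(H_{y_0}(x_0),H_{y_0}(x))}{d_{\mathcal{A}}(x,x_0)}=\left\|\left(\frac{\partial}{\partial y}F(x_0,y_0)\right)^\dagger\frac{\partial}{\partial x}F(x_0,y_0)\right\|$ (operator norm, Moore--Penrose inverse, with respect to the Riemannian metrics). Inverse problems. If $G:\mathcal{Y}\to\mathbb{R}^N$ is smooth with $DG$ of constant rank, then every $y_0\in\mathcal{Y}$ has a neighbourhood $\widehat{\mathcal{Y}}$ such that $\mathcal{A}:=G(\widehat{\mathcal{Y}})$ is an embedded submanifold (given the metric induced from the chosen metric on the codomain) and $F(x,y):=G(y)-x=0$ on $\mathcal{A}\times\widehat{\mathcal{Y}}$ is an FCRE. One sets $\kappa_\star^{inv}[G](y_0):=\kappa_\star[F^{-1}(0)](G(y_0),y_0)$, which equals $\|DG(y_0)^\dagger\|$ with respect to the chosen metrics. *)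

(* Defs.v *)
From HB Require Import structures.
From mathcomp Require Import all_boot all_order all_algebra.
From mathcomp Require Import all_classical all_reals all_analysis.

Set Implicit Arguments.
Unset Strict Implicit.
Unset Printing Implicit Defensive.

Import Order.TTheory GRing.Theory Num.Theory.
Import numFieldNormedType.Exports.

Local Open Scope classical_set_scope.
Local Open Scope ring_scope.

(** * Geodesic distance on a submanifold of a normed space

    A Riemannian submanifold of [V] is given by its set of points [M] and by a
    metric [g : V -> V -> V -> R], where [g p xi eta] is the inner product of
    the tangent vectors [xi] and [eta] at [p]. *)

Section Riemannian.
Context {R : realType} {V : normedModType R}.
Implicit Types (M : set V) (g : V -> V -> V -> R) (c : R -> V).

(** C^1 curves of [M] from [p] to [q].  A curve that is C^1 on [0, 1] extends
    to a C^1 curve on all of [R] in the ambient space; only the part over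
    [0, 1] is required to lie in [M].  Restricting to C^1 rather than piecewise
    C^1 curves does not change the infimum of the lengths. *)
Definition C1_curves M (p q : V) : set (R -> V) :=
  [set c : R -> V | [/\ forall t, derivable c t 1, continuous (derive1 c),
               c 0 = p, c 1 = q & forall t, t \in `[0, 1] -> M (c t)]].

Definition curve_length g c : \bar R :=
  (\int[lebesgue_measure]_(t in `[0%R, 1%R])
     (Num.sqrt (g (c t) (derive1 c t) (derive1 c t)))%:E)%E.

Definition geodist g M (p q : V) : \bar R :=
  ereal_inf [set curve_length g c | c in C1_curves M p q].

End Riemannian.

(** * Latent condition number of the equation [F x y = c] on [A * B] *)

Section LatentConditionNumber.
Context {R : realType} {V W Z : normedModType R}.
Variables (gA : V -> V -> V -> R) (gB : W -> W -> W -> R).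
Variables (A : set V) (B : set W) (F : V -> W -> Z) (c : Z).

Definition nearest_solutions (y0 : W) (x : V) : set W :=
  [set y | [/\ B y, F x y = c &
    forall y', B y' -> F x y' = c ->
      (geodist gB B y0 y <= geodist gB B y0 y')%E]].

(** [H_{y0}(x) = argmin { d_B(y0, y) : y \in B, F(x, y) = c }].  The value [y0]
    used when there is no minimiser is irrelevant for the condition number,
    since the argmin is attained for all [x \in A] close to [x0]. *)
Definition nearest_solution (y0 : W) (x : V) : W :=
  xget y0 (nearest_solutions y0 x).

Definition latent_cond (x0 : V) (y0 : W) : \bar R :=
  limf_esup
    (fun x => geodist gB B (nearest_solution y0 x0) (nearest_solution y0 x)
              / geodist gA A x x0)%E
    (within A x0^').

End LatentConditionNumber.

(** * Latent condition number of the inverse problem [G y = x]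

    [is_latent_cond_inv gX gY Y G y0 v] states that [v] is the latent condition
    number at [y0] of inverting [G : Y -> V].  It is that of [G y - x = 0] on
    [G(Yhat) * Yhat] for a neighbourhood [Yhat] of [y0] in [Y]; the value has to
    be [v] whichever relatively open neighbourhood is used. *)
Definition is_latent_cond_inv {R : realType} {V W : normedModType R}
    (gX : V -> V -> V -> R) (gY : W -> W -> W -> R)
    (Y : set W) (G : W -> V) (y0 : W) (v : \bar R) : Prop :=
  forall O : set W, open O -> O y0 ->
    let Yhat := Y `&` O in
    latent_cond gX gY (G @` Yhat) Yhat (fun x y => G y - x) 0 (G y0) y0 = v.

(** * Metrics *)

Section Metrics.
Context {R : realType}.

Definition frob_dot {m : nat} (u v : 'rV[R]_m) : R := \sum_j u 0 j * v 0 j.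

Definition frob_norm {m : nat} (u : 'rV[R]_m) : R := Num.sqrt (frob_dot u u).

Definition abs_metric {m : nat} (p u v : 'rV[R]_m) : R := frob_dot u v.

Definition rel_metric {m : nat} (p u v : 'rV[R]_m) : R :=
  frob_dot u v / frob_dot p p.

Definition prod_metric {V W : Type}
    (g : V -> V -> V -> R) (h : W -> W -> W -> R) (p u v : V * W) : R :=
  g p.1 u.1 v.1 + h p.2 u.2 v.2.

End Metrics.

(** * Singular values

    [singval k A] is the [k]-th largest singular value of [A], [k >= 1]: the
    square root of the [k]-th largest eigenvalue, with multiplicity, of
    [A *m A^T] (whose characteristic polynomial splits over [R]). *)
Section SingularValues.
Context {R : realType} {m p : nat}.

Definition gram_spectrum (A : 'M[R]_(m, p)) : seq R :=
  xget [::] [set s | sorted >=%R s /\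
                     char_poly (A *m A^T) = \prod_(x <- s) ('X - x%:P)].

Definition singval (k : nat) (A : 'M[R]_(m, p)) : R :=
  Num.sqrt (nth 0 (gram_spectrum A) k.-1).

End SingularValues.

(** * Tensors *)

Section Tensors.
Context {R : realType} {D : nat}.
Implicit Types n k : 'I_D -> nat.

Definition multi_index n : finType := {dffun forall i : 'I_D, 'I_(n i)}.

(** [R^{n_1 x ... x n_D}], stored as the row vector of the entries listed along
    [enum (multi_index n)], so as to inherit the normed space structure. *)
Definition tensor n : Type := 'rV[R]_#|multi_index n|.

Definition entry n (T : tensor n) (J : multi_index n) : R := T 0 (enum_rank J).

Definition mk_tensor n (f : multi_index n -> R) : tensor n :=
  \row_j f (enum_val j).

Definition rank1 n (s : forall i, 'cV[R]_(n i)) : tensor n :=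
  mk_tensor (fun J => \prod_i s i (J i) 0).

(** [(U_1 (x) ... (x) U_D) T] in coordinates; see [tucker_rank1_sum]. *)
Definition tucker n k (U : forall i, 'M[R]_(n i, k i)) (T : tensor k) :
    tensor n :=
  mk_tensor (fun J => \sum_(I : multi_index k) (\prod_i U i (J i) (I i)) * entry T I).

Lemma entry_mk_tensor n (f : multi_index n -> R) J : entry (mk_tensor f) J = f J.
Proof. by rewrite /entry mxE enum_rankK. Qed.

Lemma entry_sum n (I : Type) (r : seq I) (P : pred I) (T : I -> tensor n) J :
  entry (\sum_(i <- r | P i) T i) J = \sum_(i <- r | P i) entry (T i) J.
Proof. by rewrite /entry summxE. Qed.

Lemma tensorP n (S T : tensor n) : (forall J, entry S J = entry T J) -> S = T.
Proof.
by move=> ST; apply/rowP => j; have := ST (enum_val j); rewrite /entry enum_valK.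
Qed.

Lemma prod_sum_multi_index k (F : forall i : 'I_D, 'I_(k i) -> R) :
  \prod_i \sum_(a < k i) F i a = \sum_(I : multi_index k) \prod_i F i (I i).
Proof.
rewrite (reindex (@dffun_of_fprod _ _)) /=; last exact/onW_bij/dffun_of_fprod_bij.
pose T_ i : finType := 'I_(k i).
pose G i : {ffun 'I_(k i) -> R} := [ffun a => F i a].
transitivity (\prod_i \sum_(j in tagged_with T_ i)
                untag 0 (G i) j).
  apply: eq_bigr => i _; rewrite -(@big_tag _ 0 +%R _ T_ (fun i => G i) i).
  by apply: eq_bigr => a _; rewrite ffunE.
etransitivity.
  exact: (bigA_distr_big_dep (fun i j => j \in tagged_with T_ i)
            (fun i => untag 0 (G i))).
transitivity (\sum_(t : fprod T_) \prod_i G i (t i)).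
  by rewrite big_fprod.
by apply: eq_bigr => t _; apply: eq_bigr => i _; rewrite !ffunE.
Qed.

(** The defining property of [tucker] on sums of rank one tensors. *)
Lemma tucker_rank1_sum n k (U : forall i, 'M[R]_(n i, k i)) (r : nat)
    (s : 'I_r -> forall i, 'cV[R]_(k i)) :
  tucker U (\sum_(l < r) rank1 (s l)) =
  \sum_(l < r) rank1 (fun i => U i *m s l i).
Proof.
apply: tensorP => J; rewrite entry_sum entry_mk_tensor.
under eq_bigr do rewrite entry_sum mulr_sumr.
rewrite exchange_big /=; apply: eq_bigr => l _; rewrite entry_mk_tensor.
under [RHS]eq_bigr do rewrite mxE.
rewrite prod_sum_multi_index; apply: eq_bigr => I _.
by rewrite entry_mk_tensor -big_split.
Qed.

(** Multi-indices with the [j]-th component removed. *)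
Definition co_index k (j : 'I_D) : finType :=
  {dffun forall i : {i : 'I_D | i != j}, 'I_(k (val i))}.

(** The [j]-th flattening; its rows are indexed by the [j]-th component and its
    columns by the others.  The sum has exactly one term, that of the
    multi-index made of [a] and [enum_val b].  The order of the columns is that
    of [enum (co_index k j)]. *)
Definition flattening k (j : 'I_D) (T : tensor k) :
    'M[R]_(k j, #|co_index k j|) :=
  \matrix_(a, b)
    \sum_(J : multi_index k |
            (J j == a) && [forall i, J (val i) == (enum_val b : co_index k j) i]) entry T J.

Lemma multi_index_glue k j (a : 'I_(k j)) (c : co_index k j) :
  exists J0 : multi_index k, forall J : multi_index k,
    (J j == a) && [forall i, J (val i) == c i] = (J == J0).
Proof.
have [f [fj fc]] : exists f : forall i, 'I_(k i),
    f j = a /\ forall i : {i | i != j}, f (val i) = c i.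
  have F i : {x : 'I_(k i) | (forall e : j = i, x = ecast i 'I_(k i) e a) /\
                             forall ij : i != j, x = c (exist _ i ij)}.
    have [->|/eqP ij] := pselect (i = j).
      by exists a; split=> [e|]; [rewrite eq_axiomK | case/eqP].
    exists (c (exist _ i ij)); split=> [e|ij']; first by case/eqP: (ij).
    by congr (c (exist _ _ _)); exact: bool_irrelevance.
  exists (fun i => sval (F i)); split=> [|[i ij]].
    by have [/(_ erefl)] := svalP (F j).
  by have [_ /(_ ij)] := svalP (F i).
exists [ffun i => f i] => J; apply/andP/eqP => [[/eqP Ja /forallP Jc]|->].
  apply/ffunP => i; rewrite ffunE.
  case: (eqVneq i j) => [->|ij]; first by rewrite Ja fj.
  by have /eqP := Jc (exist _ i ij); rewrite -fc.
rewrite ffunE fj; split => //; apply/forallP => i.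
by rewrite ffunE fc.
Qed.

(** [flattening j] maps [sum_l s_{l,1} (x) ... (x) s_{l,D}] to
    [sum_l s_{l,j} vec((x)_{i <> j} s_{l,i})^T]. *)
Lemma flattening_rank1_sum k j (r : nat)
    (s : 'I_r -> forall i, 'cV[R]_(k i)) :
  flattening j (\sum_(l < r) rank1 (s l)) =
  \sum_(l < r) s l j *m
    (\row_b \prod_(i : {i | i != j}) s l (val i) ((enum_val b : co_index k j) i) 0).
Proof.
apply/matrixP => a b; rewrite mxE summxE.
have [J0 J0E] := multi_index_glue a (enum_val b).
rewrite (eq_bigl _ _ J0E) big_pred1_eq entry_sum; apply: eq_bigr => l _.
rewrite entry_mk_tensor mxE big_ord1 !mxE (bigD1 j) //=.
have := J0E J0; rewrite eqxx => /andP[/eqP -> /forallP J0b].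
congr (_ * _).
rewrite (reindex_omap (val : {i | i != j} -> 'I_D) insub) /=; last first.
  by move=> i ij; rewrite insubT.
apply: eq_big => [[i ij]|i _]; first by rewrite /= ij insubT /= eqxx.
by rewrite (eqP (J0b i)).
Qed.

Definition full_multilinear_rank k (T : tensor k) : Prop :=
  forall j, \rank (flattening j T) = k j.

Definition stiefel (n k : nat) : set 'M[R]_(n, k) :=
  [set U | U^T *m U = 1%:M].

(** ** The map [G_T]

    The factors [(U_1, ..., U_D)] are stored together as one row vector, again
    to inherit the normed space structure of a product of matrix spaces. *)
Definition factor_index n k : finType :=
  {i : 'I_D & ('I_(n i) * 'I_(k i))%type}.

Definition factors n k : Type := 'rV[R]_#|factor_index n k|.

Definition mk_factors n k (U : forall i, 'M[R]_(n i, k i)) : factors n k :=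
  \row_j (let t := enum_val j in U (tag t) (tagged t).1 (tagged t).2).

Definition factor n k (u : factors n k) (i : 'I_D) : 'M[R]_(n i, k i) :=
  \matrix_(a, b)
    u 0 (enum_rank (Tagged (fun i => ('I_(n i) * 'I_(k i))%type) (a, b))).

Lemma mk_factorsK n k (U : forall i, 'M[R]_(n i, k i)) i :
  factor (mk_factors U) i = U i.
Proof. by apply/matrixP => a b; rewrite !mxE enum_rankK. Qed.

Definition tucker_domain n k : set (factors n k * tensor k) :=
  [set p | (forall i, stiefel (factor p.1 i)) /\ full_multilinear_rank p.2].

Definition tucker_map n k (p : factors n k * tensor k) : tensor n :=
  tucker (factor p.1) p.2.

(** [min_{i : k_i < n_i} sigma_{k_i}(T_(i))], the infimum of a finite set. *)
Definition tucker_sigma n k (T : tensor k) : R :=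
  inf [set singval (k i) (flattening i T) | i in [set i | (k i < n i)%N]].

End Tensors.
Arguments tensor R {D} n.
Arguments factors R {D} n k.
Arguments tucker_domain R {D} n k.
Arguments tucker_sigma {R D} n {k} T.

(* Main.v *)
Require Import Defs.
From HB Require Import structures.
From mathcomp Require Import all_boot all_order all_algebra.
From mathcomp Require Import all_classical all_reals all_analysis.
From mathcomp Require Import ring lra.
Set Implicit Arguments.
Unset Strict Implicit.
Unset Printing Implicit Defensive.
Import Order.TTheory GRing.Theory Num.Theory.
Import numFieldNormedType.Exports.
Local Open Scope ring_scope.

(** In both metrics an equation [G y = x] is solved near the decomposition
    [(U, S)] of [x0 = tucker U S], and the condition number compares how far the
    nearest solution moves with how far [x] moves.

    To first order a change of [x0] consists of a change of the core inside the
    product of the ranges of the [U i] and, for each mode [i], of a component that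
    leaves the range of [U i]; these components are mutually orthogonal.  Turning
    the range of [U i] by principal angles with sines [s_a] produces a component
    of norm at least [sigma_i * sqrt (sum of the s_a ^+ 2)], where [sigma_i] is
    the smallest singular value of the [i]-th flattening of [S].  Hence an
    angle is at most [1 / sigma] times the component that it causes, while changes
    of the core and of the tensor correspond isometrically.  In the relative
    metric the changes of [x0] and of the core are both divided by the norm of
    [S], which multiplies the first ratio by this norm and keeps the second.

    The upper bound makes this quantitative without differentiating [G].  Let [x]
    be a nearby tensor with factors [V].  The spectral theorem for
    [(U i)^T (V i) (V i)^T (U i)] yields principal angles and aligned frames
    ([principal_rotation]); rotating the principal vectors is an explicit curve in
    the domain whose length is computed by [frame_geodist]; the orthogonal
    components of [x - x0] are separated by [tucker_pythagoras]; and
    [upper_section] concludes that the squared length is at most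
    [ka * d ^+ 2 + O(d ^+ 3)] for [d] the norm of [x - x0].  Together with a lower
    bound for the geodesic distance from [x] to [x0] this gives [latent_cond_le].

    The lower bound exhibits two curves of tensors along which a nearest solution
    is known exactly.  Rotating the left singular direction of [sigma] out of the
    range of [U i] moves [x] at speed [sigma], and every solution for the angle
    [t] is at distance at least [t]: a fixed combination of the columns of the
    [i]-th factor moves on the unit sphere from the equator to height [t]
    ([geodist_ge_angle], [latent_cond_ge_rotation]).  In the absolute metric,
    scaling [x0] forces the norm of the core to change by the same amount
    ([latent_cond_ge_scaling]).

    Lower bounds for geodesic distances all come from functions of slope at most
    one along curves: the component along the chord ([length_ge_chord]), the
    stereographic projection for the relative metric ([length_ge_relative]), and
    the height over an equator of the sphere ([length_ge_sphere]). *)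

(** * Lengths of curves and geodesic distances *)

Section CurveLength.
Local Open Scope classical_set_scope.
Local Open Scope ring_scope.
Context {R : realType}.
Local Notation mu := (@lebesgue_measure R).

(** The integral of a nonnegative function is a supremum over the simple
    functions below it, so monotonicity holds without measurability. *)
Lemma ge0_integral_mono (A : set R) (f g : R -> \bar R) :
  (forall t, A t -> 0 <= f t)%E -> (forall t, A t -> f t <= g t)%E ->
  (\int[mu]_(t in A) f t <= \int[mu]_(t in A) g t)%E.
Proof.
move=> f0 fg.
rewrite !ge0_integralE //; last by move=> t At; exact: le_trans (f0 _ At) (fg _ At).
apply: ereal_sup_le => _ [h /= hf <-]; exists h => // x.
apply: le_trans (hf x) _; rewrite /patch; case: ifPn => // /[!inE].
exact: fg.
Qed.

(** The fundamental theorem of calculus for [df], followed by monotonicity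
    applied to the positive part of [df]. *)
Lemma derive_le_integral (f df h : R -> R) :
  (forall t : R, t \in `[0, 1] -> is_derive t 1 f (df t)) ->
  (forall t : R, t \in `[0, 1] -> {for t, continuous df}) ->
  (forall t : R, t \in `[0, 1] -> 0 <= h t /\ df t <= h t) ->
  ((f 1 - f 0)%:E <= \int[mu]_(t in `[0%R, 1%R]) (h t)%:E)%E.
Proof.
move=> fd dc dh.
have I0 : (0 : R) \in `[0, 1] by rewrite in_itv /= lexx ler01.
have I1 : (1 : R) \in `[0, 1] by rewrite in_itv /= lexx ler01.
have cf t : t \in `[0, 1] -> {for t, continuous f}.
  by move=> /fd [df1 _]; apply: differentiable_continuous; apply/derivable1_diffP.
have -> : (f 1 - f 0)%:E = (\int[mu]_(t in `[0%R, 1%R]) (df t)%:E)%E.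
  rewrite (@continuous_FTC2 _ df f) ?EFinB //.
  - by apply: continuous_in_subspaceT => t /[!inE] /dc.
  - split; first by move=> t t01; have [] := fd t (subset_itv_oo_cc t01).
    + by apply: cvg_at_right_filter; exact: cf.
    + by apply: cvg_at_left_filter; exact: cf.
  - move=> t t01; rewrite derive1E.
    by have [_ ->] := fd t (subset_itv_oo_cc t01).
rewrite integralE.
apply: (@le_trans _ _ (\int[mu]_(t in `[0%R, 1%R]) ((fun t => (df t)%:E)^\+ t))%E).
  rewrite -[leRHS]sube0 leeB //; apply: integral_ge0 => t _.
  exact: funeneg_ge0.
apply: ge0_integral_mono => t t01; first exact: funepos_ge0.
have [h0 dfh] := dh t t01.
by rewrite funeposE ge_max !lee_fin dfh h0.
Qed.

Section Geodist.
Context {V : normedModType R}.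
Implicit Types (M : set V) (g : V -> V -> V -> R) (c : R -> V).

Lemma curve_length_le g c (K : R) :
  (forall t : R, t \in `[0, 1] -> Num.sqrt (g (c t) (derive1 c t) (derive1 c t)) <= K) ->
  (curve_length g c <= K%:E)%E.
Proof.
move=> cK; apply: (@le_trans _ _ (\int[mu]_(t in `[0%R, 1%R]) K%:E)%E).
  apply: ge0_integral_mono => t t01; rewrite lee_fin ?sqrtr_ge0 //.
  exact: cK.
by rewrite integral_cst //= lebesgue_measure_itv /= lte_fin ltr01 oppr0 adde0 mule1.
Qed.

Lemma geodist_le g M p q c K : C1_curves M p q c ->
  (curve_length g c <= K)%E -> (geodist g M p q <= K)%E.
Proof.
by move=> cM; apply: le_trans; apply: ereal_inf_lbound; exists c.
Qed.

Lemma geodist_ge g M p q K :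
  (forall c, C1_curves M p q c -> (K <= curve_length g c)%E) ->
  (K <= geodist g M p q)%E.
Proof. by move=> KL; apply: le_ereal_inf_tmp => _ [c cM <-]; exact: KL. Qed.

Lemma geodist_ge0 g M p q : (0 <= geodist g M p q)%E.
Proof.
apply: geodist_ge => c _; apply: integral_ge0 => t _.
by rewrite lee_fin sqrtr_ge0.
Qed.

(** The length of a curve bounds the increment of any function whose rate of
    change along the curve is dominated by the speed: this is how all lower
    bounds on geodesic distances are obtained. *)
Lemma curve_length_ge g c (f df : R -> R) :
  (forall t : R, t \in `[0, 1] -> is_derive t 1 f (df t)) ->
  (forall t : R, t \in `[0, 1] -> {for t, continuous df}) ->
  (forall t : R, t \in `[0, 1] ->
     df t <= Num.sqrt (g (c t) (derive1 c t) (derive1 c t))) ->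
  ((f 1 - f 0)%:E <= curve_length g c)%E.
Proof.
move=> fd dc dh.
apply: (@derive_le_integral f df
  (fun t => Num.sqrt (g (c t) (derive1 c t) (derive1 c t))) fd dc) => t t01.
by rewrite sqrtr_ge0; split => //; exact: dh.
Qed.

End Geodist.

(** * Calculus of C^1 curves *)

(** The derivative is carried along as an explicit function, so that the rules
    below compute it; [derive1_C1] recovers [derive1]. *)
Definition C1_with {V : normedModType R} (c dc : R -> V) :=
  (forall t : R, is_derive t 1 c (dc t)) /\ continuous dc.

Lemma C1_curvesP (V : normedModType R) (M : set V) (p q : V) c :
  C1_curves M p q c ->
  [/\ C1_with c (derive1 c), c 0 = p, c 1 = q & forall t, t \in `[0, 1] -> M (c t)].
Proof.
move=> [d cd c0 c1 cM]; split=> //; split=> // t.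
by rewrite derive1E; exact: derivableP.
Qed.

Lemma derive1_C1 (V : normedModType R) (c dc : R -> V) :
  C1_with c dc -> derive1 c = dc.
Proof. by move=> [d _]; apply/funext => t; rewrite derive1E; have [] := d t. Qed.

Lemma C1_curves_with (V : normedModType R) (M : set V) (c dc : R -> V) :
  C1_with c dc -> (forall t : R, t \in `[0, 1] -> M (c t)) ->
  C1_curves M (c 0) (c 1) c.
Proof.
move=> C cM; split=> //; last by rewrite (derive1_C1 C); case: C.
by move=> t; case: C => d _; have [] := d t.
Qed.

Lemma C1_linear (V W : normedModType R) (L : V -> W) (c dc : R -> V) :
  (forall a u v, L (a *: u + v) = a *: L u + L v) -> continuous L ->
  C1_with c dc -> C1_with (L \o c) (L \o dc).
Proof.
move=> linL contL [d cd]; split=> [t|t]; last first.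
  by apply: continuous_comp; [exact: cd|exact: contL].
have LB u v : L (u - v) = L u - L v.
  by rewrite addrC -scaleN1r linL scaleN1r addrC.
have L0 : L 0 = 0 by rewrite -(subrr 0) LB subrr.
have LZ a u : L (a *: u) = a *: L u by rewrite -[a *: u]addr0 linL L0 addr0.
have [dt dE] := d t.
have lim : (h^-1 *: ((L \o c) (h *: 1 + t) - (L \o c) t)) @[h --> 0^'] --> L (dc t).
  under eq_fun do rewrite /= -LB -LZ.
  rewrite -dE.
  exact: (@cvg_comp _ _ _ (fun h : R => h^-1 *: (c (h *: 1 + t) - c t)) L _ _ _
            dt (contL _)).
split; first by apply/cvg_ex; exists (L (dc t)).
exact: cvg_lim lim.
Qed.

Lemma C1_pair (V W : normedModType R) (c dc : R -> V) (e de : R -> W) :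
  C1_with c dc -> C1_with e de ->
  C1_with (fun t => (c t, e t)) (fun t => (dc t, de t)).
Proof.
move=> [dc' cc] [de' ce]; split=> [t|t]; last exact: (cvg_pair (cc t) (ce t)).
have [dt dE] := dc' t; have [et eE] := de' t.
have lim : (h^-1 *: ((c (h *: 1 + t), e (h *: 1 + t)) - (c t, e t))) @[h --> 0^']
     --> (dc t, de t).
  by rewrite -dE -eE; exact: (cvg_pair dt et).
split; first by apply/cvg_ex; exists (dc t, de t).
exact: cvg_lim lim.
Qed.

Lemma continuous_rV (T : topologicalType) N (f : T -> 'rV[R]_N) :
  (forall j, continuous (fun x => f x 0 j)) -> continuous f.
Proof.
move=> fj t; apply/cvgrPdist_le => /= e e0; near=> x.
rewrite /Num.Def.normr/= mx_normrE (bigmax_le _ (ltW e0))//= => -[i j] _.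
rewrite !mxE/= (ord1 i).
move: j; near: x; apply: filter_forall => /= j.
exact: ((cvgrPdist_le _ _).1 (fj j t)).
Unshelve. all: by end_near. Qed.

Lemma C1_rV N (c dc : R -> 'rV[R]_N) :
  (forall j, C1_with (fun t => c t 0 j) (fun t => dc t 0 j)) -> C1_with c dc.
Proof.
move=> C; split; last by apply: continuous_rV => j; exact: (C j).2.
move=> t; have dt : derivable c t 1.
  by apply/derivable_mxP => i j; rewrite (ord1 i); have [d _] := C j; have [] := d t.
split=> //; rewrite derive_mx //; apply/rowP => j; rewrite mxE.
by have [d _] := C j; have [] := d t.
Qed.

Lemma C1_coord N (c dc : R -> 'rV[R]_N) j :
  C1_with c dc -> C1_with (fun t => c t 0 j) (fun t => dc t 0 j).
Proof.
move=> C; apply: (@C1_linear _ _ (fun v : 'rV[R]_N => v 0 j) c dc) => //.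
  by move=> a u v; rewrite !mxE.
exact: coord_continuous.
Qed.

Lemma C1_fst (V W : normedModType R) (c dc : R -> V * W) :
  C1_with c dc -> C1_with (fun t => (c t).1) (fun t => (dc t).1).
Proof. by apply: (@C1_linear _ _ fst) => // x; exact: cvg_fst. Qed.

Lemma C1_snd (V W : normedModType R) (c dc : R -> V * W) :
  C1_with c dc -> C1_with (fun t => (c t).2) (fun t => (dc t).2).
Proof. by apply: (@C1_linear _ _ snd) => // x; exact: cvg_snd. Qed.

Lemma C1_continuous (V : normedModType R) (c dc : R -> V) :
  C1_with c dc -> continuous c.
Proof.
move=> [d _] t; apply: differentiable_continuous; apply/derivable1_diffP.
by have [] := d t.
Qed.

Lemma C1_cst (V : normedModType R) (v : V) : C1_with (cst v) (cst 0).
Proof. by split=> t; [exact: is_derive_cst|exact: cvg_cst]. Qed.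

Lemma C1_add (V : normedModType R) (c dc e de : R -> V) :
  C1_with c dc -> C1_with e de ->
  C1_with (fun t => c t + e t) (fun t => dc t + de t).
Proof.
move=> [d cd] [d' cd']; split=> t; first exact: is_deriveD.
by apply: cvgD; [exact: cd|exact: cd'].
Qed.

Lemma C1_mul (c dc e de : R -> R) :
  C1_with c dc -> C1_with e de ->
  C1_with (fun t => c t * e t) (fun t => dc t * e t + c t * de t).
Proof.
move=> C1 C2; have [d cd] := C1; have [d' cd'] := C2; split=> t.
  have := is_deriveM (f := c) (g := e) (d t) (d' t).
  by rewrite addrC; congr (is_derive _ _ _ (_ + _)); rewrite mulrC.
apply: cvgD; apply: cvgM; (exact: cd || exact: cd' || idtac).
  exact: (C1_continuous C2).
exact: (C1_continuous C1).
Qed.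

Lemma C1_sum (I : finType) (c dc : I -> R -> R) :
  (forall i, C1_with (c i) (dc i)) ->
  C1_with (fun t => \sum_i c i t) (fun t => \sum_i dc i t).
Proof.
move=> C.
have H (r : seq I) : C1_with (fun t => \sum_(i <- r) c i t)
                             (fun t => \sum_(i <- r) dc i t).
  elim: r => [|i r IH].
    under eq_fun do rewrite big_nil.
    under [X in C1_with _ X]eq_fun do rewrite big_nil.
    exact: C1_cst.
  under eq_fun do rewrite big_cons.
  under [X in C1_with _ X]eq_fun do rewrite big_cons.
  exact: C1_add.
exact: H.
Qed.

Lemma C1_id : C1_with (@id R) (cst 1).
Proof. by split=> t; [exact: is_derive_id|exact: cvg_cst]. Qed.

Lemma C1_cos (a : R) : C1_with (fun t => cos (t * a)) (fun t => - a * sin (t * a)).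
Proof.
split=> t.
  have Hl : is_derive t 1 (fun t : R => t * a) a.
    have := (C1_mul C1_id (C1_cst a)).1 t.
    by rewrite /= mulr0 addr0 mul1r.
  have := @is_derive1_comp _ cos (fun t : R => t * a) t _ _ (is_derive_cos (t * a)) Hl.
  by rewrite mulrC mulNr mulrN.
apply: cvgM; first exact: cvg_cst.
apply: (@continuous_comp _ _ _ (fun t : R => t * a) sin); last exact: continuous_sin.
exact: mulrr_continuous.
Qed.

Lemma C1_sin (a : R) : C1_with (fun t => sin (t * a)) (fun t => a * cos (t * a)).
Proof.
split=> t.
  have Hl : is_derive t 1 (fun t : R => t * a) a.
    have := (C1_mul C1_id (C1_cst a)).1 t.
    by rewrite /= mulr0 addr0 mul1r.
  have := @is_derive1_comp _ sin (fun t : R => t * a) t _ _ (is_derive_sin (t * a)) Hl.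
  by rewrite mulrC.
apply: cvgM; first exact: cvg_cst.
apply: (@continuous_comp _ _ _ (fun t : R => t * a) cos); last exact: continuous_cos.
exact: mulrr_continuous.
Qed.

End CurveLength.

(** * The Frobenius inner product *)

Section FrobDot.
Local Open Scope classical_set_scope.
Local Open Scope ring_scope.
Context {R : realType}.

Section Algebra.
Context {N : nat}.
Implicit Types u v w : 'rV[R]_N.

Lemma frob_dotC u v : frob_dot u v = frob_dot v u.
Proof. by apply: eq_bigr => j _; rewrite mulrC. Qed.

Lemma frob_dotDl u v w : frob_dot (u + v) w = frob_dot u w + frob_dot v w.
Proof. by rewrite /frob_dot -big_split; apply: eq_bigr => j _; rewrite mxE mulrDl. Qed.

Lemma frob_dotZl a u w : frob_dot (a *: u) w = a * frob_dot u w.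
Proof. by rewrite /frob_dot mulr_sumr; apply: eq_bigr => j _; rewrite mxE mulrA. Qed.

Lemma frob_dotNl u w : frob_dot (- u) w = - frob_dot u w.
Proof. by rewrite -scaleN1r frob_dotZl mulN1r. Qed.

Lemma frob_dotDr u v w : frob_dot w (u + v) = frob_dot w u + frob_dot w v.
Proof. by rewrite frob_dotC frob_dotDl !(frob_dotC w). Qed.

Lemma frob_dotZr a u w : frob_dot w (a *: u) = a * frob_dot w u.
Proof. by rewrite frob_dotC frob_dotZl frob_dotC. Qed.

Lemma frob_dotNr u w : frob_dot w (- u) = - frob_dot w u.
Proof. by rewrite frob_dotC frob_dotNl frob_dotC. Qed.

Lemma frob_dot0l u : frob_dot 0 u = 0.
Proof. by rewrite /frob_dot big1 // => j _; rewrite mxE mul0r. Qed.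

Lemma frob_dot0r u : frob_dot u 0 = 0.
Proof. by rewrite frob_dotC frob_dot0l. Qed.

Definition frob_dotE :=
  (frob_dotDl, frob_dotDr, frob_dotNl, frob_dotNr, frob_dotZl, frob_dotZr).

Lemma frob_dot_ge0 u : 0 <= frob_dot u u.
Proof. by apply: sumr_ge0 => j _; exact: sqr_ge0. Qed.

Lemma frob_dot_eq0 u : (frob_dot u u == 0) = (u == 0).
Proof.
apply/eqP/eqP => [|->]; last by rewrite /frob_dot big1 // => j _; rewrite mxE mul0r.
move/eqP; rewrite psumr_eq0 => [|j _]; last exact: sqr_ge0.
move=> /allP u0; apply/rowP => j; rewrite mxE.
by have := u0 j (mem_index_enum _); rewrite mulf_eq0 orbb => /eqP.
Qed.

Lemma frob_dot_gt0 u : (0 < frob_dot u u) = (u != 0).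
Proof. by rewrite lt_def frob_dot_eq0 frob_dot_ge0 andbT. Qed.

Lemma frob_norm_ge0 u : 0 <= frob_norm u.
Proof. exact: sqrtr_ge0. Qed.

Lemma frob_norm_sqr u : frob_norm u ^+ 2 = frob_dot u u.
Proof. by rewrite sqr_sqrtr // frob_dot_ge0. Qed.

Lemma frob_norm_gt0 u : (0 < frob_norm u) = (u != 0).
Proof. by rewrite sqrtr_gt0 frob_dot_gt0. Qed.

Lemma frob_norm_eq0 u : (frob_norm u == 0) = (u == 0).
Proof. by rewrite -frob_dot_eq0 -frob_norm_sqr sqrf_eq0. Qed.

Lemma frob_norm0 : frob_norm (0 : 'rV[R]_N) = 0.
Proof. by apply/eqP; rewrite frob_norm_eq0. Qed.

Lemma Cauchy_Schwarz_sqr u v :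
  frob_dot u v ^+ 2 <= frob_dot u u * frob_dot v v.
Proof.
have [->|v0] := eqVneq v 0.
  by rewrite !frob_dot0r mulr0 expr0n.
have vv : 0 < frob_dot v v by rewrite frob_dot_gt0.
have := frob_dot_ge0 (frob_dot v v *: u - frob_dot u v *: v).
rewrite !frob_dotE (frob_dotC v u).
set a := frob_dot u u; set b := frob_dot u v; set c := frob_dot v v in vv * => H.
have {}H : 0 <= c * (a * c - b ^+ 2) by apply: le_trans H _; lra.
by rewrite pmulr_rge0 // subr_ge0 in H.
Qed.

Lemma Cauchy_Schwarz u v : `|frob_dot u v| <= frob_norm u * frob_norm v.
Proof.
rewrite -ler_sqr ?nnegrE ?normr_ge0 ?mulr_ge0 ?frob_norm_ge0 //.
by rewrite real_normK ?num_real // exprMn !frob_norm_sqr Cauchy_Schwarz_sqr.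
Qed.

Lemma frob_norm_triangle u v : frob_norm (u + v) <= frob_norm u + frob_norm v.
Proof.
rewrite -ler_sqr ?nnegrE ?addr_ge0 ?frob_norm_ge0 //.
rewrite frob_norm_sqr !frob_dotE (frob_dotC v u) -!frob_norm_sqr.
have := le_trans (ler_norm _) (Cauchy_Schwarz u v); lra.
Qed.

Lemma frob_normZ a u : frob_norm (a *: u) = `|a| * frob_norm u.
Proof.
by rewrite /frob_norm frob_dotZl frob_dotZr mulrA -expr2 sqrtrM ?sqr_ge0 // sqrtr_sqr.
Qed.

Lemma frob_normN u : frob_norm (- u) = frob_norm u.
Proof. by rewrite -scaleN1r frob_normZ normrN1 mul1r. Qed.

Lemma frob_norm_distC u v : frob_norm (u - v) = frob_norm (v - u).
Proof. by rewrite -frob_normN opprB. Qed.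

Lemma frob_norm_reverse u v : frob_norm u - frob_norm v <= frob_norm (u - v).
Proof.
rewrite lerBlDr; apply: le_trans (frob_norm_triangle _ _).
by rewrite subrK.
Qed.

Lemma coord_le_frob_norm u j : `|u 0 j| <= frob_norm u.
Proof.
rewrite -sqrtr_sqr ler_sqrt ?frob_dot_ge0 // /frob_dot (bigD1 j) //= expr2 lerDl.
by apply: sumr_ge0 => i _; exact: sqr_ge0.
Qed.

Lemma mx_norm_le_frob u : `|u| <= frob_norm u.
Proof.
rewrite /Num.Def.normr/= mx_normrE (bigmax_le _ (frob_norm_ge0 u))//= => -[i j] _.
by rewrite (ord1 i) coord_le_frob_norm.
Qed.

Lemma frob_norm_le_mx u : frob_norm u <= N%:R * `|u|.
Proof.
have cu j : `|u 0 j| <= `|u|.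
  rewrite [leRHS]/Num.Def.normr/= mx_normrE.
  exact: (le_bigmax _ (fun i => `|u i.1 i.2|) (0, j)).
rewrite -ler_sqr ?nnegrE ?mulr_ge0 ?frob_norm_ge0 //.
rewrite frob_norm_sqr exprMn.
have le1 : frob_dot u u <= N%:R * `|u| ^+ 2.
  apply: le_trans (_ : \sum_(j < N) `|u| ^+ 2 <= _).
    apply: ler_sum => j _; rewrite -expr2 -(real_normK (num_real (u 0 j))).
    by rewrite ler_sqr ?nnegrE.
  by rewrite sumr_const card_ord mulr_natl.
apply: le_trans le1 _; apply: ler_wpM2r; first exact: sqr_ge0.
by rewrite -natrX ler_nat; case: (N) => // m; rewrite leq_pmulr.
Qed.

End Algebra.

Lemma frob_dot_row_mx {N M : nat} (a c : 'rV[R]_N) (b d : 'rV[R]_M) :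
  frob_dot (row_mx a b) (row_mx c d) = frob_dot a c + frob_dot b d.
Proof.
rewrite /frob_dot big_split_ord /=; congr (_ + _); apply: eq_bigr => j _.
  by rewrite !row_mxEl.
by rewrite !row_mxEr.
Qed.

(** * Lower bounds for the length of a curve *)

Lemma C1_dot {N : nat} (c dc e de : R -> 'rV[R]_N) :
  C1_with c dc -> C1_with e de ->
  C1_with (fun t => frob_dot (c t) (e t))
          (fun t => frob_dot (dc t) (e t) + frob_dot (c t) (de t)).
Proof.
move=> C E; under [X in C1_with _ X]eq_fun do rewrite /frob_dot -big_split.
by apply: C1_sum => j; apply: C1_mul; exact: C1_coord.
Qed.

Lemma C1_dotr {N : nat} (a : 'rV[R]_N) (e de : R -> 'rV[R]_N) :
  C1_with e de ->
  C1_with (fun t => frob_dot a (e t)) (fun t => frob_dot a (de t)).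
Proof.
move=> E; have := C1_dot (C1_cst a) E.
congr C1_with; apply/funext => t /=.
by rewrite frob_dot0l add0r.
Qed.

Lemma C1_scale {N : nat} (f df : R -> R) (e de : R -> 'rV[R]_N) :
  C1_with f df -> C1_with e de ->
  C1_with (fun t => f t *: e t) (fun t => df t *: e t + f t *: de t).
Proof.
move=> F E; apply: C1_rV => j; under eq_fun do rewrite mxE.
under [X in C1_with _ X]eq_fun do rewrite !mxE.
by apply: C1_mul => //; exact: C1_coord.
Qed.

Lemma C1_inv (f df : R -> R) : (forall t, f t != 0) -> C1_with f df ->
  C1_with (fun t => (f t)^-1) (fun t => - (f t) ^- 2 * df t).
Proof.
move=> f0 F; have [d cd] := F; have cf := C1_continuous F.
split=> t; first exact: is_deriveV.
apply: cvgM; last exact: cd.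
by apply: cvgN; apply: cvgV; rewrite ?expf_neq0 //; apply: cvgM; exact: cf.
Qed.

(** At an end point of the interval one-sided difference quotients determine
    the derivative. *)
Lemma derive_locally_cst (f : R -> R) (t d a : R) : is_derive t 1 f d ->
  (forall s, s \in `[0, 1] -> f s = a) -> t \in `[0, 1] -> d = 0.
Proof.
move=> [fd <-] fa t01; have fta := fa t t01.
have fl : h^-1 *: (f (h *: 1 + t) - f t) @[h --> 0^'] --> 'D_1 f t by exact: fd.
have zero (F : set_system R) : ProperFilter F -> F `=>` 0^' ->
    (\forall h \near F, h + t \in `[0, 1]) -> 'D_1 f t = 0.
  move=> PF F0 Fh; have flF := cvg_trans (cvg_app _ F0) fl.
  refine (cvg_unique (@Rhausdorff R) flF _).
  apply: cvg_near_cst; apply: filterS Fh => h h01.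
  by rewrite /GRing.scale /= mulr1 fta fa // subrr mulr0.
move: t01; rewrite in_itv /= => /andP[t0]; rewrite le_eqVlt => /predU1P[t1|t1].
  apply: (zero 0^'-) => //.
    by apply: within_subset => x /= x0; rewrite lt_eqF.
  near=> h; rewrite in_itv /= t1; apply/andP; split.
    by rewrite -lerBlDr sub0r; near: h; exact: nbhs_left_ge.
  by rewrite gerDr; near: h; exact: nbhs_left_le.
apply: (zero 0^'+) => //.
  by apply: within_subset => x /= x0; rewrite gt_eqF.
near=> h; rewrite in_itv /=; apply/andP; split.
  by apply: addr_ge0 => //; near: h; exact: nbhs_right_ge.
by rewrite -lerBrDr; near: h; apply: nbhs_right_le; rewrite subr_gt0.
Unshelve. all: by end_near. Qed.

Section LengthBounds.
Context {V : normedModType R}.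
Variables (g : V -> V -> V -> R) (c : R -> V).
Let speed t := Num.sqrt (g (c t) (derive1 c t) (derive1 c t)).

Lemma curve_length_ge0 : (0 <= curve_length g c)%E.
Proof. by apply: integral_ge0 => t _; rewrite lee_fin sqrtr_ge0. Qed.

(** The component of the curve along its chord grows no faster than the speed. *)
Lemma length_ge_chord {N : nat} (e de : R -> 'rV[R]_N) : C1_with e de ->
  (forall t, t \in `[0, 1] -> frob_norm (de t) <= speed t) ->
  ((frob_norm (e 1 - e 0))%:E <= curve_length g c)%E.
Proof.
move=> E des; have [->|ne] := eqVneq (e 1 - e 0) 0.
  by rewrite frob_norm0 curve_length_ge0.
set a := (frob_norm (e 1 - e 0))^-1 *: (e 1 - e 0).
have a1 : frob_norm a = 1.
  by rewrite frob_normZ ger0_norm ?invr_ge0 ?frob_norm_ge0 // mulVf // frob_norm_eq0.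
have [d cd] := C1_dotr a E.
have -> : frob_norm (e 1 - e 0) = frob_dot a (e 1) - frob_dot a (e 0).
  rewrite -frob_dotNr -frob_dotDr frob_dotZl -frob_norm_sqr expr2 mulrA mulVf ?mul1r //.
  by rewrite frob_norm_eq0.
apply: (curve_length_ge (fun t _ => d t) (fun t _ => cd t)) => t t01.
apply: le_trans (ler_norm _) _; apply: le_trans (Cauchy_Schwarz _ _) _.
by rewrite a1 mul1r; exact: des.
Qed.

(** The stereographic projection of the punctured space onto a sphere does not
    increase lengths when the punctured space carries the relative metric, so
    the chordal distance of the sphere is a lower bound for the length.  The
    pole and scale are chosen so that the start of the curve lies on the
    equator. *)
Lemma length_ge_relative {N : nat} (e de : R -> 'rV[R]_N) : C1_with e de ->
  (forall t, t \in `[0, 1] -> e t != 0) ->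
  (forall t, t \in `[0, 1] -> frob_norm (de t) / frob_norm (e t) <= speed t) ->
  ((Num.sqrt 2 * frob_norm (e 1 - e 0) /
    Num.sqrt (frob_dot (e 1) (e 1) + frob_dot (e 0) (e 0)))%:E
    <= curve_length g c)%E.
Proof.
move=> E ne des.
have I0 : (0 : R) \in `[0, 1] by rewrite in_itv /= lexx ler01.
pose q := frob_dot (e 0) (e 0); pose m := frob_norm (e 0).
have q0 : 0 < q by rewrite frob_dot_gt0 ne.
have m2 : m ^+ 2 = q by exact: frob_norm_sqr.
pose H t := frob_dot (e t) (e t) + q.
have H0 t : 0 < H t by apply: ltr_wpDl; rewrite // frob_dot_ge0.
pose dH t := frob_dot (de t) (e t) + frob_dot (e t) (de t) + 0.
have HC : C1_with H dH by apply: C1_add; [exact: C1_dot|exact: (C1_cst q)].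
pose b : 'rV[R]_1 := const_mx (- q).
have bb : frob_dot b b = q ^+ 2 by rewrite /frob_dot big_ord1 !mxE mulrNN.
pose Q t := row_mx (m *: e t) b.
pose dQ t := row_mx (m *: de t) (0 : 'rV[R]_1).
have QC : C1_with Q dQ.
  apply: C1_rV => j; case: (split_ordP j) => i ->.
    under eq_fun do rewrite row_mxEl mxE.
    under [X in C1_with _ X]eq_fun do rewrite row_mxEl mxE.
    have := C1_mul (C1_cst m) (C1_coord i E).
    by congr C1_with; apply/funext => t /=; rewrite mul0r add0r.
  under eq_fun do rewrite row_mxEr.
  under [X in C1_with _ X]eq_fun do rewrite row_mxEr mxE.
  exact: C1_cst.
have H_neq0 t : H t != 0 by rewrite gt_eqF.
have PC := C1_scale (C1_inv H_neq0 HC) QC.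
have two : C1_with (cst (2 : R)) (cst 0) by exact: C1_cst.
(* up to a translation, [2 *: Q t / H t] is the stereographic image of
   [e t / m] on the unit sphere *)
have {}PC := C1_scale two PC.
set P := fun t => cst 2 t *: _ in PC.
have PdotE s t : frob_dot (P s) (P t) =
    4 * (q * frob_dot (e s) (e t) + q ^+ 2) / (H s * H t).
  rewrite /P /Q /cst !frob_dotE frob_dot_row_mx !frob_dotE bb -m2.
  by field; rewrite !H_neq0.
have -> : Num.sqrt 2 * frob_norm (e 1 - e 0) /
    Num.sqrt (frob_dot (e 1) (e 1) + frob_dot (e 0) (e 0)) = frob_norm (P 1 - P 0).
  rewrite -sqrtrM ?ler0n // -sqrtrV ?ltW ?H0 // -sqrtrM ?mulr_ge0 ?frob_dot_ge0 ?ler0n //.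
  congr Num.sqrt; rewrite !(frob_dotDl, frob_dotDr, frob_dotNl, frob_dotNr) !PdotE /H -/q.
  rewrite (frob_dotC (e 0) (e 1)).
  have := H_neq0 1; rewrite /H => Hn; field.
  by rewrite -mulr2n mulrn_eq0 /= (gt_eqF q0) Hn.
apply: (@length_ge_chord _ P _ PC) => t t01.
apply: le_trans (des _ t01).
rewrite /cst scale0r add0r frob_normZ.
have et : 0 < frob_norm (e t) by rewrite frob_norm_gt0 ne.
rewrite -ler_sqr ?nnegrE ?mulr_ge0 ?frob_norm_ge0 ?invr_ge0 ?divr_ge0 ?frob_norm_ge0 //.
rewrite exprMn expr_div_n !frob_norm_sqr real_normK ?num_real //.
rewrite /Q /dQ !frob_dotE !frob_dot_row_mx !frob_dotE bb.
rewrite !frob_dot0r !frob_dot0l.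
rewrite /dH (frob_dotC (de t) (e t)).
have := frob_norm_sqr (e t).
have := H_neq0 t; have := H0 t; rewrite /H.
have := frob_dot_ge0 (de t).
set x := frob_dot (e t) (e t); set y := frob_dot (e t) (de t); set z := frob_dot (de t) (de t).
move=> z0 h0 hn0 etE.
have x0 : 0 < x by rewrite -etE exprn_gt0.
match goal with |- is_true (?l <= _) => have -> : l = 4 * m ^+ 2 * z / (x + q) ^+ 2 end.
  rewrite -m2; field; by rewrite m2.
rewrite m2 ler_pdivrMr ?exprn_gt0 // [leRHS]mulrAC ler_pdivlMr //.
have := mulr_ge0 z0 (sqr_ge0 (x - q)).
nra.
Qed.

(** The height over the equator perpendicular to [w] of a point of the unit
    sphere is the arcsine of its component along [w], and the gradient of this
    height has norm one.  Scaling by [l < 1] keeps the arcsine away from its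
    singularities at the poles. *)
Lemma length_ge_sphere {N : nat} (p dp : R -> 'rV[R]_N) (w : 'rV[R]_N) (th : R) :
  C1_with p dp ->
  (forall t, t \in `[0, 1] -> frob_dot (p t) (p t) = 1) ->
  frob_dot w w = 1 -> frob_dot w (p 0) = 0 -> frob_dot w (p 1) = sin th ->
  0 < th < pi / 2 ->
  (forall t, t \in `[0, 1] -> frob_norm (dp t) <= speed t) ->
  (th%:E <= curve_length g c)%E.
Proof.
move=> P p1 w1 wp0 wp1 /andP[th0 thpi] dps.
have pdp t : t \in `[0, 1] -> frob_dot (p t) (dp t) = 0.
  move=> t01; have := derive_locally_cst ((C1_dot P P).1 t) p1 t01.
  by rewrite (frob_dotC (dp t)); lra.
pose G t := frob_dot w (p t); pose dG t := frob_dot w (dp t).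
have GC : C1_with G dG by exact: C1_dotr.
have G1 t : t \in `[0, 1] -> G t ^+ 2 <= 1.
  by move=> t01; have := Cauchy_Schwarz_sqr w (p t); rewrite w1 p1 // mul1r.
have dG2 t : t \in `[0, 1] -> dG t ^+ 2 <= (1 - G t ^+ 2) * frob_dot (dp t) (dp t).
  move=> t01; have := Cauchy_Schwarz_sqr (w - G t *: p t) (dp t).
  rewrite !frob_dotE pdp // p1 // w1 (frob_dotC (p t) w) -/(G t) -/(dG t); nra.
have sth : 0 < sin th < 1.
  rewrite sin_gt0_pihalf ?th0 //= -(sin_pihalf R) ltr_sin // in_itv /=.
    by rewrite (ltW thpi) andbT; apply: le_trans (ltW th0); lra.
  by rewrite lexx andbT; lra.
have asin0 : asin 0 = 0 :> R.
  by rewrite -[X in asin X]sin0 sinK // in_itv /=; apply/andP; split; lra.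
have key l : 0 < l < 1 -> ((asin (l * sin th))%:E <= curve_length g c)%E.
  move=> /andP[l0 l1].
  have lG t : t \in `[0, 1] -> (l * G t) ^+ 2 < 1.
    move=> t01; have := G1 t t01; rewrite exprMn => G1t.
    apply: (@le_lt_trans _ _ (l ^+ 2)); first by rewrite -[leRHS]mulr1 ler_wpM2l ?sqr_ge0.
    by rewrite expr_lt1 // ltW.
  pose f t := asin (l * G t).
  pose df t := (Num.sqrt (1 - (l * G t) ^+ 2))^-1 * (l * dG t).
  have lGC : C1_with (fun t => l * G t) (fun t => l * dG t).
    have := C1_mul (C1_cst l) GC.
    by congr C1_with; apply/funext => t /=; rewrite mul0r add0r.
  have -> : asin (l * sin th) = f 1 - f 0.
    by rewrite /f /G wp0 wp1 mulr0 asin0 subr0.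
  apply: (@curve_length_ge _ _ _ _ f df) => t t01.
  - apply: (@is_derive1_comp _ asin (fun t => l * G t)); last exact: lGC.1.
    by apply: is_derive1_asin; have := lG t t01; set x := l * G t => x2; apply/andP; split; nra.
  - apply: cvgM; last exact: lGC.2.
    have s0 : Num.sqrt (1 - (l * G t) ^+ 2) != 0.
      by rewrite sqrtr_eq0 -ltNge subr_gt0 lG.
    apply: cvgV => //.
    apply: (@continuous_comp _ _ _ (fun t => 1 - (l * G t) ^+ 2) Num.sqrt);
      last exact: sqrt_continuous.
    apply: cvgB; first exact: cvg_cst.
    by apply: cvgM; exact: (C1_continuous lGC).
  - apply: le_trans (dps _ t01).
    have h0 : 0 < Num.sqrt (1 - (l * G t) ^+ 2) by rewrite sqrtr_gt0 subr_gt0 lG.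
    rewrite /df mulrC ler_pdivrMr //; apply: le_trans (ler_norm _) _.
    rewrite -ler_sqr ?nnegrE ?mulr_ge0 ?frob_norm_ge0 ?sqrtr_ge0 // real_normK ?num_real //.
    rewrite [leLHS]exprMn [leRHS]exprMn frob_norm_sqr sqr_sqrtr; last first.
      by rewrite subr_ge0; apply/ltW/lG.
    have := dG2 t t01; have := frob_dot_ge0 (dp t); have := G1 t t01.
    have l2 : 0 <= l ^+ 2 <= 1 by rewrite sqr_ge0 expr_le1 // ltW.
    set z := frob_dot _ _; rewrite exprMn; move: l2.
    set y := l ^+ 2; set x := dG t ^+ 2; set u := G t ^+ 2; nra.
move: curve_length_ge0 key; case: curve_length => [L||] //= L0 key; rewrite ?leey //.
rewrite lee_fin in L0; rewrite lee_fin leNgt; apply/negP => Lth.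
have sLth : sin L < sin th by rewrite ltr_sin // in_itv /=; apply/andP; split; lra.
have sL0 : 0 <= sin L by apply: sin_ge0_pi; apply/andP; split; lra.
pose l := (sin L + sin th) / (2 * sin th).
have lE : l * sin th = (sin L + sin th) / 2.
  by rewrite /l; field; case/andP: sth => /gt_eqF ->.
have l01 : 0 < l < 1.
  by rewrite /l divr_gt0 ?ltr_pdivrMr ?mul1r /=; lra.
have := key l l01; rewrite lee_fin lE leNgt => /negP; apply.
have sB : -1 <= (sin L + sin th) / 2 <= 1 by apply/andP; split; lra.
have [/andP[a1 a2] aE] := asin_def sB.
rewrite -ltr_sin ?aE ?in_itv /= ?a1 ?a2 //; last by apply/andP; split; lra.
by lra.
Qed.

End LengthBounds.
End FrobDot.

(** * The real spectral theorem and the smallest singular value *)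

Section Spectral.
Local Open Scope classical_set_scope.
Local Open Scope ring_scope.
Context {R : realType}.

Lemma frob_dot_mx {N : nat} (u v : 'rV[R]_N) : frob_dot u v = (u *m v^T) 0 0.
Proof. by rewrite mxE; apply: eq_bigr => j _; rewrite mxE. Qed.

Lemma frob_dot_mulmx {N M : nat} (A : 'M[R]_(N, M)) u v :
  frob_dot (u *m A) v = frob_dot u (v *m A^T).
Proof. by rewrite !frob_dot_mx trmx_mul trmxK mulmxA. Qed.

Lemma continuous_sum (T : topologicalType) (I : finType) (f : I -> T -> R) :
  (forall i, continuous (f i)) -> continuous (fun x => \sum_i f i x).
Proof.
move=> cf.
have H (r : seq I) : continuous (fun x => \sum_(i <- r) f i x).
  elim: r => [|i r IH] x.
    under eq_fun do rewrite big_nil.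
    exact: cvg_cst.
  under eq_fun do rewrite big_cons.
  by apply: cvgD; [exact: cf|exact: IH].
exact: H.
Qed.

Lemma continuous_frob_dot (T : topologicalType) {N : nat} (f g : T -> 'rV[R]_N) :
  continuous f -> continuous g -> continuous (fun x => frob_dot (f x) (g x)).
Proof.
move=> cf cg; apply: continuous_sum => j x; apply: cvgM.
  apply: (@continuous_comp _ _ _ f (fun u : 'rV[R]_N => u 0 j)); first exact: cf.
  exact: coord_continuous.
apply: (@continuous_comp _ _ _ g (fun u : 'rV[R]_N => u 0 j)); first exact: cg.
exact: coord_continuous.
Qed.

Lemma continuous_mulmxr {N M : nat} (A : 'M[R]_(N, M)) :
  continuous (fun x : 'rV[R]_N => x *m A).
Proof.
apply: continuous_rV => j.
have -> : (fun x : 'rV[R]_N => (x *m A) 0 j) = (fun x => frob_dot x (col j A)^T).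
  by apply/funext => y; rewrite mxE /frob_dot; apply: eq_bigr => i _; rewrite !mxE.
apply: (@continuous_frob_dot _ _ id (fun=> (col j A)^T)); first by move=> x; exact: cvg_id.
by apply: cst_continuous.
Qed.

(** A minimiser of the quadratic form of [A] on the unit sphere is an
    eigenvector: the form of [A - l] is nonnegative and vanishes there. *)
Lemma symmetric_eigenvector {n : nat} (A : 'M[R]_n.+1) : A^T = A ->
  exists v l, frob_dot v v = 1 /\ v *m A = l *: v.
Proof.
move=> symA; pose S : set 'rV[R]_n.+1 := [set x | frob_dot x x = 1].
pose q (x : 'rV[R]_n.+1) := frob_dot (x *m A) x.
have cq : continuous q.
  apply: (@continuous_frob_dot _ _ (fun x : 'rV[R]_n.+1 => x *m A) id).
    exact: continuous_mulmxr.
  by move=> x; exact: cvg_id.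
have Scompact : compact S.
  apply: bounded_closed_compact.
    exists 1; split; first exact: num_real.
    move=> M M1 x Sx; apply: le_trans (mx_norm_le_frob x) _.
    by rewrite /frob_norm Sx sqrtr1 ltW.
  apply: (@closed_comp _ _ (fun x : 'rV[R]_n.+1 => frob_dot x x) [set 1]).
    by move=> x _; apply: (@continuous_frob_dot _ _ id id) => y; exact: cvg_id.
  exact: closed_eq.
have S0 : S !=set0.
  by exists (delta_mx 0 0); rewrite /S /= frob_dot_mx trmx_delta mul_delta_mx mxE !eqxx.
have [|v vS vmin] := EVT_min_rV S0 Scompact (f := q).
  exact: continuous_subspaceT.
rewrite inE /S /= in vS; exists v, (q v); split => //.
set l := q v.
pose b x := frob_dot (x *m A - l *: x) x.
have b0 x : 0 <= b x.
  rewrite /b !frob_dotE; have [->|x0] := eqVneq x 0.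
    by rewrite !frob_dot0r mulr0 subr0.
  have xx : 0 < frob_dot x x by rewrite frob_dot_gt0.
  have nx : 0 < frob_norm x by rewrite frob_norm_gt0.
  have xxE : frob_dot x x = frob_norm x ^+ 2 by rewrite frob_norm_sqr.
  have un : frob_dot ((frob_norm x)^-1 *: x) ((frob_norm x)^-1 *: x) = 1.
    by rewrite !frob_dotE xxE; field; rewrite gt_eqF.
  have := vmin ((frob_norm x)^-1 *: x); rewrite inE => /(_ un).
  rewrite /q -scalemxAl !frob_dotE -/(q v) -/l mulrA -expr2 exprVn.
  by rewrite mulrC ler_pdivlMr ?exprn_gt0 // -xxE subr_ge0.
apply/eqP; rewrite -subr_eq0 -frob_dot_eq0; apply/eqP.
have [w wdef] : exists w, w = v *m A - l *: v by eexists.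
rewrite -wdef.
set c := frob_dot w w.
have bv : frob_dot w v = 0 by rewrite wdef !frob_dotE vS mulr1 subrr.
have wE : v *m A = w + l *: v by rewrite wdef subrK.
have key t : 0 <= 2 * t * c + t ^+ 2 * b w.
  have := b0 (v + t *: w).
  suff -> : b (v + t *: w) = 2 * t * c + t ^+ 2 * b w by [].
  have -> : b (v + t *: w) = frob_dot (w + t *: (w *m A - l *: w)) (v + t *: w).
    rewrite /b; congr frob_dot.
    rewrite mulmxDl wE -scalemxAl; move: (w *m A) => z.
    by apply/rowP => j; rewrite !mxE; ring.
  have e : frob_dot (w *m A) v = c + l * frob_dot w v.
    by rewrite frob_dot_mulmx symA wE frob_dotDr frob_dotZr.
  rewrite !frob_dotE e bv /b !frob_dotE -/c; ring.
have c0 : 0 <= c by exact: frob_dot_ge0.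
have bw : 0 <= b w by [].
apply/eqP; rewrite eq_le c0 andbT leNgt; apply/negP => cpos.
have := key (- (c / (b w + 1))).
have b1 : 0 < b w + 1 by lra.
have -> : 2 * - (c / (b w + 1)) * c + (- (c / (b w + 1))) ^+ 2 * b w =
   - (c ^+ 2 * (b w + 2) / (b w + 1) ^+ 2) by field; rewrite gt_eqF.
rewrite oppr_ge0 leNgt => /negP; apply.
by rewrite divr_gt0 ?mulr_gt0 ?exprn_gt0 //; lra.
Qed.

(** The Householder reflection that exchanges [v] and the first basis vector. *)
Lemma orthogonal_first_row {n : nat} (v : 'rV[R]_(1 + n)) : frob_dot v v = 1 ->
  exists H : 'M[R]_(1 + n), H *m H^T = 1%:M /\ row_mx 1%:M 0 *m H = v.
Proof.
move=> v1; set e : 'rV[R]_(1 + n) := row_mx 1%:M 0.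
have e1 : frob_dot e e = 1.
  by rewrite frob_dot_row_mx frob_dot0r addr0 frob_dot_mx trmx1 mulmx1 mxE.
have [->|ve] := eqVneq v e; first by exists 1%:M; rewrite trmx1 !mulmx1.
pose w := v - e.
have w0 : 0 < frob_dot w w by rewrite frob_dot_gt0 subr_eq0.
have ww : w *m w^T = (frob_dot w w)%:M.
  by apply/matrixP => i j; rewrite !ord1 -frob_dot_mx mxE eqxx.
pose a := 2 / frob_dot w w.
exists (1%:M - a *: (w^T *m w)); split.
  have -> : (1%:M - a *: (w^T *m w))^T = 1%:M - a *: (w^T *m w).
    apply/matrixP => i j; rewrite !mxE eq_sym; congr (_ - a * _).
    by apply: eq_bigr => k _; rewrite !mxE mulrC.
  set X := a *: _.
  have XX : X *m X = X + X.
    rewrite /X -scalemxAl -scalemxAr mulmxA -(mulmxA _ w) ww mul_mx_scalar.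
    rewrite -scalemxAl !scalerA -scalerDl; congr (_ *: _).
    by rewrite /a; field; rewrite gt_eqF.
  by rewrite mulmxBl mul1mx mulmxBr mulmx1 XX opprB addrK subrK.
rewrite mulmxBr mulmx1 -scalemxAr mulmxA.
have -> : e *m w^T = (frob_dot e w)%:M.
  by apply/matrixP => i j; rewrite !ord1 -frob_dot_mx mxE eqxx.
rewrite mul_scalar_mx scalerA.
have -> : a * frob_dot e w = -1.
  rewrite /a /w !frob_dotE v1 e1 (frob_dotC v e); field.
  move: w0; rewrite /w !frob_dotE v1 e1 (frob_dotC v e) => w0.
  by apply: lt0r_neq0; lra.
by rewrite scaleN1r opprK /w addrC subrK.
Qed.

(** An orthogonal change of basis moves an eigenvector to the first basis
    vector; symmetry then splits off a block of size one. *)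
Theorem real_spectral {n : nat} (A : 'M[R]_n) : A^T = A ->
  exists (P : 'M[R]_n) (d : 'rV[R]_n), P *m P^T = 1%:M /\ P *m A *m P^T = diag_mx d.
Proof.
elim: n A => [|n IH] A symA.
  by exists 1%:M, 0; split; apply/matrixP => -[].
have [v [l [v1 vA]]] := symmetric_eigenvector symA.
have [H [HH eH]] := @orthogonal_first_row n v v1.
set e : 'rV[R]_(1 + n) := row_mx 1%:M 0 in eH.
pose B : 'M[R]_(1 + n) := H *m A *m H^T.
have symB : B^T = B by rewrite /B !trmx_mul trmxK symA mulmxA.
have eB : e *m B = l *: e.
  by rewrite /B !mulmxA eH vA -scalemxAl -eH -mulmxA HH mulmx1.
have : row_mx (ulsubmx B) (ursubmx B) = row_mx l%:M 0.
  transitivity (e *m B).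
    by rewrite -{3}(submxK B) /e mul_row_block !mul1mx !mul0mx !addr0.
  by rewrite eB /e scale_row_mx scaler0 scale_scalar_mx mulr1.
move=> /eq_row_mx [ulB urB].
have dlB : dlsubmx B = 0.
  by rewrite -[B in LHS]symB -trmx_ursub urB trmx0.
have [|P [d [PP PB]]] := IH (drsubmx B); first by rewrite trmx_drsub symB.
pose P0 : 'M[R]_(1 + n) := block_mx 1%:M 0 0 P.
have P0P0 : P0 *m P0^T = 1%:M.
  rewrite /P0 tr_block_mx trmx1 !trmx0 mulmx_block !mulmx0 !mul0mx !addr0 !add0r.
  by rewrite mulmx1 PP -scalar_mx_block.
have P0B : P0 *m B *m P0^T = diag_mx (row_mx l%:M d).
  rewrite /P0 -(submxK B) ulB urB dlB tr_block_mx trmx1 !trmx0.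
  rewrite !mulmx_block !(mulmx0, mul0mx, addr0, add0r, mulmx1, mul1mx) PB.
  rewrite diag_mx_row; congr block_mx; apply/matrixP => i j.
  by rewrite !ord1 !mxE eqxx.
exists (P0 *m H), (row_mx l%:M d); split.
  by rewrite trmx_mul mulmxA -(mulmxA _ H) HH mulmx1.
by rewrite trmx_mul -P0B /B !mulmxA.
Qed.

Lemma char_poly_spectral {n : nat} (A P : 'M[R]_n) d :
  P *m P^T = 1%:M -> P *m A *m P^T = diag_mx d ->
  char_poly A = \prod_(i < n) ('X - (d 0 i)%:P).
Proof.
move=> PP PA.
have PtP : P^T *m P = 1%:M by exact: mulmx1C.
transitivity (char_poly (diag_mx d)); last first.
  rewrite (char_poly_trig (diag_mx_is_trig d)); apply: eq_bigr => i _.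
  by rewrite mxE eqxx.
rewrite -PA /char_poly /char_poly_mx.
have -> : 'X%:M - map_mx polyC (P *m A *m P^T) =
    map_mx polyC P *m ('X%:M - map_mx polyC A) *m map_mx polyC P^T.
  rewrite mulmxBr mulmxBl !map_mxM /=; congr (_ - _).
  by rewrite scalar_mxC -mulmxA -map_mxM PP map_mx1 mulmx1.
rewrite !det_mulmx mulrC mulrA -det_mulmx -map_mxM PtP map_mx1 det1 mul1r //.
Qed.

Lemma frob_dot_row_gram {q m p : nat} (P : 'M[R]_(q, m)) (A : 'M[R]_(m, p)) i :
  frob_dot (row i P *m A) (row i P *m A) = (P *m (A *m A^T) *m P^T) i i.
Proof.
rewrite frob_dot_mulmx -mulmxA frob_dotC frob_dot_mx [LHS]mxE [RHS]mxE.
by apply: eq_bigr => j _; rewrite -row_mul !mxE.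
Qed.

(** By the spectral theorem the characteristic polynomial of the Gram matrix
    splits, so that the sorted list of its roots behind [singval] exists; the
    entry with index [m.-1] of that list is its last and smallest one. *)
Lemma singval_spec {m p : nat} (A : 'M[R]_(m, p)) : (0 < m)%N ->
  exists (P : 'M[R]_m) (d : 'rV[R]_m) (a : 'I_m),
    [/\ P *m P^T = 1%:M, P *m (A *m A^T) *m P^T = diag_mx d,
        d 0 a = singval m A ^+ 2 & forall i, singval m A ^+ 2 <= d 0 i].
Proof.
move=> m0; have symG : (A *m A^T)^T = A *m A^T by rewrite trmx_mul trmxK.
have [P [d [PP PG]]] := real_spectral symG.
have cpE := char_poly_spectral PP PG.
have d0 i : 0 <= d 0 i.
  have -> : d 0 i = frob_dot (row i P *m A) (row i P *m A).
    by rewrite frob_dot_row_gram PG mxE eqxx.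
  exact: frob_dot_ge0.
pose ex_s := [set s | sorted >=%R s /\
   char_poly (A *m A^T) = \prod_(x <- s) ('X - x%:P)].
have : ex_s (gram_spectrum A).
  apply: (@xgetPex _ _ ex_s).
  pose s0 := [seq d 0 i | i <- enum 'I_m].
  exists (sort >=%R s0); split.
    by apply: sort_sorted => x y; exact: le_total.
  rewrite cpE (perm_big s0) /=; last by rewrite perm_sort.
  by rewrite /s0 big_map big_enum.
set s := gram_spectrum A => -[ssort sE].
have size_s : size s = m.
  have := congr1 (fun p : {poly R} => size p) sE.
  by rewrite /= size_char_poly size_prod_XsubC => -[].
have mem_s x : (x \in s) = [exists i, x == d 0 i].
  rewrite -root_prod_XsubC -sE cpE.
  have -> : \prod_(i < m) ('X - (d 0 i)%:P) =
      \prod_(x <- [seq d 0 i | i <- enum 'I_m]) ('X - x%:P).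
    by rewrite big_map big_enum.
  rewrite root_prod_XsubC; apply/mapP/existsP => [[i _ ->]|[i /eqP ->]].
    by exists i.
  by exists i => //; rewrite mem_enum.
have pm : (m.-1 < size s)%N by rewrite size_s prednK.
have := mem_nth 0 pm; rewrite mem_s => /existsP[a /eqP sa].
exists P, d, a; rewrite /singval -/s sa sqr_sqrtr //; split => // i.
have : d 0 i \in s by rewrite mem_s; apply/existsP; exists i.
move=> /(nthP 0) [j js <-]; rewrite -sa.
have ge_trans : transitive (>=%R : rel R) by move=> x y z yx xz; exact: le_trans xz yx.
have ge_refl : reflexive (>=%R : rel R) by exact: lexx.
apply: (sorted_leq_nth ge_trans ge_refl 0 ssort) => //.
by rewrite -ltnS prednK // -size_s.
Qed.

(** The squared Frobenius norm; written as a trace, it is invariant under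
    orthogonal factors by cyclicity. *)
Definition sqnorm {m p : nat} (A : 'M[R]_(m, p)) : R := \tr (A *m A^T).

Lemma sqnormE {m p : nat} (A : 'M[R]_(m, p)) : sqnorm A = \sum_i \sum_j A i j ^+ 2.
Proof.
by apply: eq_bigr => i _; rewrite mxE; apply: eq_bigr => j _; rewrite mxE expr2.
Qed.

Lemma sqnorm_ge0 {m p : nat} (A : 'M[R]_(m, p)) : 0 <= sqnorm A.
Proof. by rewrite sqnormE; apply: sumr_ge0 => i _; apply: sumr_ge0 => j _; exact: sqr_ge0. Qed.

Lemma sqnorm_eq0 {m p : nat} (A : 'M[R]_(m, p)) : sqnorm A = 0 -> A = 0.
Proof.
move/eqP; rewrite sqnormE psumr_eq0; last by move=> i _; apply: sumr_ge0 => j _; exact: sqr_ge0.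
move=> /allP A0; apply/matrixP => i j; rewrite mxE.
have := A0 i (mem_index_enum _); rewrite psumr_eq0; last by move=> k _; exact: sqr_ge0.
by move=> /allP /(_ j (mem_index_enum _)); rewrite sqrf_eq0 => /eqP.
Qed.

Lemma sqnorm_mulmx_orth {m p q : nat} (A : 'M[R]_(m, p)) (P : 'M[R]_(p, q)) :
  P *m P^T = 1%:M -> sqnorm (A *m P) = sqnorm A.
Proof. by move=> PP; rewrite /sqnorm trmx_mul mulmxA -(mulmxA A) PP mulmx1. Qed.

Lemma singval_lower_bound {m p q : nat} (A : 'M[R]_(m, p)) (B : 'M[R]_(q, m)) :
  (0 < m)%N -> singval m A ^+ 2 * sqnorm B <= sqnorm (B *m A).
Proof.
move=> m0; have [P [d [a [PP PG _ dmin]]]] := singval_spec A m0.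
have PtP : P^T *m P = 1%:M by exact: mulmx1C.
have GE : A *m A^T = P^T *m diag_mx d *m P.
  by rewrite -PG !mulmxA PtP mul1mx -!mulmxA PtP mulmx1.
rewrite -(@sqnorm_mulmx_orth _ _ _ B P^T) ?trmxK //.
have -> : sqnorm (B *m A) = \tr (B *m P^T *m diag_mx d *m (B *m P^T)^T).
  by rewrite /sqnorm !trmx_mul trmxK !mulmxA -(mulmxA B) GE !mulmxA.
rewrite sqnormE mulr_sumr; apply: ler_sum => i _.
rewrite mxE mulr_sumr; apply: ler_sum => j _.
rewrite mul_mx_diag [X in _ <= X * _]mxE [X in _ <= _ * X]mxE; set x := (B *m P^T) i j.
by rewrite [leRHS]mulrAC -expr2 [leLHS]mulrC ler_wpM2l ?sqr_ge0.
Qed.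

(** If the smallest eigenvalue of the Gram matrix vanishes, then [A] kills the
    corresponding eigenvector. *)
Lemma singval_gt0 {m p : nat} (A : 'M[R]_(m, p)) : (0 < m)%N ->
  \rank A = m -> 0 < singval m A.
Proof.
move=> m0 rA; have [P [d [a [PP PG da _]]]] := singval_spec A m0.
rewrite lt_def sqrtr_ge0 andbT; apply/negP => /eqP s0.
have PA0 : row a P *m A = 0.
  by apply/eqP; rewrite -frob_dot_eq0 frob_dot_row_gram PG mxE eqxx da s0 expr0n.
have P0 : row a P = 0.
  by apply/eqP; rewrite -(mulmx_free_eq0 _ (_ : row_free A)) ?PA0 // /row_free rA.
have := congr1 (fun M : 'M[R]_m => M a a) PP.
rewrite [in X in _ = X -> _]mxE eqxx => /eqP.
have -> : (P *m P^T) a a = (row a P *m P^T) 0 a by rewrite -row_mul [RHS]mxE.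
by rewrite P0 mul0mx mxE eq_sym oner_eq0.
Qed.

End Spectral.

(** * Multilinear algebra of Tucker products *)

Section TensorAlgebra.
Local Open Scope classical_set_scope.
Local Open Scope ring_scope.
Context {R : realType} {D : nat}.
Implicit Types m n k : 'I_D -> nat.
Local Notation factor := Defs.factor.

Lemma frob_dot_entry n (S T : tensor R n) :
  frob_dot S T = \sum_J entry S J * entry T J.
Proof.
by rewrite /frob_dot (reindex (@enum_rank _)) //; exact/onW_bij/enum_rank_bij.
Qed.

Lemma entryD n (S T : tensor R n) J : entry (S + T) J = entry S J + entry T J.
Proof. by rewrite /entry mxE. Qed.

Lemma entryZ n a (T : tensor R n) J : entry (a *: T) J = a * entry T J.
Proof. by rewrite /entry mxE. Qed.

Lemma entryN n (T : tensor R n) J : entry (- T) J = - entry T J.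
Proof. by rewrite /entry mxE. Qed.

Lemma entry_tucker n k (U : forall i, 'M[R]_(n i, k i)) (T : tensor R k) J :
  entry (tucker U T) J = \sum_(I : multi_index k) (\prod_i U i (J i) (I i)) * entry T I.
Proof. exact: entry_mk_tensor. Qed.

Lemma eq_tucker n k (U V : forall i, 'M[R]_(n i, k i)) (T : tensor R k) :
  (forall i, U i = V i) -> tucker U T = tucker V T.
Proof.
move=> UV; apply: tensorP => J; rewrite !entry_tucker; apply: eq_bigr => I _.
by congr (_ * _); apply: eq_bigr => i _; rewrite UV.
Qed.

Lemma tuckerD n k (U : forall i, 'M[R]_(n i, k i)) (S T : tensor R k) :
  tucker U (S + T) = tucker U S + tucker U T.
Proof.
apply: tensorP => J; rewrite entryD !entry_tucker -big_split /=; apply: eq_bigr => I _.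
by rewrite entryD mulrDr.
Qed.

Lemma tuckerZ n k (U : forall i, 'M[R]_(n i, k i)) a (T : tensor R k) :
  tucker U (a *: T) = a *: tucker U T.
Proof.
apply: tensorP => J; rewrite entryZ !entry_tucker mulr_sumr; apply: eq_bigr => I _.
by rewrite entryZ mulrCA.
Qed.

Lemma tuckerB n k (U : forall i, 'M[R]_(n i, k i)) (S T : tensor R k) :
  tucker U (S - T) = tucker U S - tucker U T.
Proof. by rewrite -scaleN1r tuckerD tuckerZ scaleN1r. Qed.

Lemma tucker_comp m n k (A : forall i, 'M[R]_(m i, n i))
    (B : forall i, 'M[R]_(n i, k i)) (T : tensor R k) :
  tucker A (tucker B T) = tucker (fun i => A i *m B i) T.
Proof.
apply: tensorP => J; rewrite !entry_tucker.
under eq_bigr do rewrite entry_tucker mulr_sumr.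
rewrite exchange_big /=; apply: eq_bigr => K _.
under [in RHS]eq_bigr do rewrite mxE.
rewrite prod_sum_multi_index mulr_suml; apply: eq_bigr => I _.
by rewrite big_split mulrA.
Qed.

Lemma prod_natr_bool (I : finType) (P : pred I) (b : I -> bool) :
  \prod_(i | P i) (b i)%:R = [forall i, P i ==> b i]%:R :> R.
Proof.
case: forallP => [Pb|]; first by apply: big1 => i Pi; have := Pb i; rewrite Pi => /= ->.
move=> /forallP; rewrite negb_forall => /existsP[i]; rewrite negb_imply => /andP[Pi /negPf bi].
by rewrite (bigD1 i) //= bi mul0r.
Qed.

Lemma tucker1 k (T : tensor R k) : tucker (fun i => 1%:M : 'M[R]_(k i)) T = T.
Proof.
apply: tensorP => J; rewrite entry_tucker (bigD1 J) //= [X in _ + X]big1 => [|I IJ].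
  by rewrite big1 ?mul1r ?addr0 // => i _; rewrite mxE eqxx.
have [i /negPf Ii] : exists i, I i != J i.
  apply/existsP; rewrite -negb_forall; apply/negP => /forallP IJi.
  by move/eqP: IJ; apply; apply/ffunP => i; apply/eqP/IJi.
by rewrite (bigD1 i) //= mxE eq_sym Ii !mul0r.
Qed.

Lemma frob_dot_tucker n k (A : forall i, 'M[R]_(n i, k i)) (S : tensor R k) (T : tensor R n) :
  frob_dot (tucker A S) T = frob_dot S (tucker (fun i => (A i)^T) T).
Proof.
rewrite !frob_dot_entry; under eq_bigr do rewrite entry_tucker mulr_suml.
rewrite exchange_big /=; apply: eq_bigr => I _.
rewrite entry_tucker mulr_sumr; apply: eq_bigr => J _.
rewrite [\prod_i A i _ _ * _]mulrC -mulrA; congr (_ * (_ * _)).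
by apply: eq_bigr => i _; rewrite mxE.
Qed.

Lemma tucker_eq0 n k (A : forall i, 'M[R]_(n i, k i)) i (T : tensor R k) :
  A i = 0 -> tucker A T = 0.
Proof.
move=> A0; apply: tensorP => J; rewrite entry_tucker big1 => [|I _].
  by rewrite /entry mxE.
by rewrite (bigD1 i) //= A0 mxE !mul0r.
Qed.

Lemma tucker_stiefel_dot n k (U : forall i, 'M[R]_(n i, k i)) (S T : tensor R k) :
  (forall i, stiefel (U i)) -> frob_dot (tucker U S) (tucker U T) = frob_dot S T.
Proof.
move=> US; rewrite frob_dot_tucker tucker_comp -[in RHS](tucker1 T).
by congr frob_dot; apply: eq_tucker => i; rewrite US.
Qed.

Lemma tucker_stiefel_norm n k (U : forall i, 'M[R]_(n i, k i)) (T : tensor R k) :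
  (forall i, stiefel (U i)) -> frob_norm (tucker U T) = frob_norm T.
Proof. by move=> US; rewrite /frob_norm tucker_stiefel_dot. Qed.

(** Both arguments are full families: overwriting a single member of a dependent
    family would need a cast along the equality of indices. *)
Definition mix n k i (W U : forall j, 'M[R]_(n j, k j)) j : 'M[R]_(n j, k j) :=
  if j == i then W j else U j.

Lemma mix_eq n k i (W U : forall j, 'M[R]_(n j, k j)) : mix i W U i = W i.
Proof. by rewrite /mix eqxx. Qed.

Lemma mix_neq n k i j (W U : forall j, 'M[R]_(n j, k j)) : j != i -> mix i W U j = U j.
Proof. by rewrite /mix => /negPf ->. Qed.

Lemma mix_mul m n k i (W U : forall j, 'M[R]_(m j, n j))
    (W' U' : forall j, 'M[R]_(n j, k j)) j :
  mix i W U j *m mix i W' U' j =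
  mix i (fun j => W j *m W' j) (fun j => U j *m U' j) j.
Proof. by rewrite /mix; case: eqP. Qed.

Lemma mix_tr n k i (W U : forall j, 'M[R]_(n j, k j)) j :
  (mix i W U j)^T = mix i (fun j => (W j)^T) (fun j => (U j)^T) j.
Proof. by rewrite /mix; case: eqP. Qed.

Lemma tucker_mixD n k i (W W' U : forall j, 'M[R]_(n j, k j)) (T : tensor R k) :
  tucker (mix i (fun j => W j + W' j) U) T = tucker (mix i W U) T + tucker (mix i W' U) T.
Proof.
apply: tensorP => J; rewrite entryD !entry_tucker -big_split /=; apply: eq_bigr => I _.
rewrite -mulrDl; congr (_ * _).
rewrite !(bigD1 i (P := xpredT)) //= !mix_eq mxE mulrDl.
by congr (_ * _ + _ * _); apply: eq_bigr => j ji; rewrite !mix_neq.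
Qed.

Lemma tucker_mixZ n k i a (W U : forall j, 'M[R]_(n j, k j)) (T : tensor R k) :
  tucker (mix i (fun j => a *: W j) U) T = a *: tucker (mix i W U) T.
Proof.
apply: tensorP => J; rewrite entryZ !entry_tucker mulr_sumr; apply: eq_bigr => I _.
rewrite mulrA; congr (_ * _).
rewrite !(bigD1 i (P := xpredT)) //= !mix_eq mxE mulrA.
by congr (_ * _ * _); apply: eq_bigr => j ji; rewrite !mix_neq.
Qed.

Lemma entry_flattening k i (T : tensor R k) a (c : co_index k i) :
  flattening i T a (enum_rank c) =
  \sum_(J : multi_index k) ((J i == a) && [forall j, J (val j) == c j])%:R * entry T J.
Proof.
rewrite mxE enum_rankK big_mkcond; apply: eq_bigr => J _.
by case: ifP; rewrite ?mul1r ?mul0r.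
Qed.

Lemma sum_indicator (I : finType) (x : I) (f : I -> R) :
  \sum_y (x == y)%:R * f y = f x.
Proof.
rewrite (bigD1 x) //= eqxx mul1r big1 ?addr0 // => y.
by rewrite eq_sym => /negPf ->; rewrite mul0r.
Qed.

(** Acting in mode [i] multiplies the [i]-th flattening from the left.  Stated
    for inner products, this involves only tensors of the same format. *)
Lemma frob_dot_mode k i (C : forall j, 'M[R]_(k j)) (S T : tensor R k) :
  frob_dot S (tucker (mix i C (fun j => 1%:M)) T) =
  \tr (C i *m flattening i T *m (flattening i S)^T).
Proof.
pose co (J : multi_index k) : co_index k i := [ffun j => J (val j)].
have coE (J : multi_index k) (c : co_index k i) : [forall j, J (val j) == c j] = (co J == c).
  apply/forallP/eqP => [H|<- j]; last by rewrite ffunE.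
  by apply/ffunP => j; rewrite ffunE; apply/eqP.
have flatE (X : tensor R k) a c : flattening i X a (enum_rank c) =
    \sum_(J : multi_index k) (J i == a)%:R * (co J == c)%:R * entry X J.
  rewrite entry_flattening; apply: eq_bigr => J _.
  by rewrite coE; case: (J i == a); case: (co J == c); rewrite /= ?mul1r ?mul0r.
have gramE a b : (flattening i T *m (flattening i S)^T) b a =
    \sum_(J : multi_index k) \sum_(I : multi_index k)
      (J i == b)%:R * ((I i == a)%:R * ((co J == co I)%:R * (entry T J * entry S I))).
  rewrite mxE (reindex (@enum_rank _)) /=; last exact/onW_bij/enum_rank_bij.
  under eq_bigr => c _ do rewrite [(flattening i S)^T _ _]mxE !flatE mulr_suml.
  rewrite exchange_big /=; apply: eq_bigr => J _.
  under eq_bigr do rewrite mulr_sumr.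
  rewrite exchange_big /=; apply: eq_bigr => I _.
  transitivity (\sum_(c : co_index k i) (co J == c)%:R *
    ((J i == b)%:R * ((I i == a)%:R * ((co I == c)%:R * (entry T J * entry S I))))).
    by apply: eq_bigr => c _; ring.
  by rewrite sum_indicator (eq_sym (co I)).
have -> : \tr (C i *m flattening i T *m (flattening i S)^T) =
   \sum_a \sum_b C i a b * (flattening i T *m (flattening i S)^T) b a.
  by apply: eq_bigr => a _; rewrite -mulmxA mxE.
transitivity (\sum_(I : multi_index k) \sum_(J : multi_index k)
    C i (I i) (J i) * (co J == co I)%:R * (entry T J * entry S I)).
  rewrite frob_dot_entry; apply: eq_bigr => I _.
  rewrite entry_tucker mulr_sumr; apply: eq_bigr => J _.
  rewrite (bigD1 i) //= mix_eq.
  have -> : \prod_(j < D | j != i) mix i C (fun j => 1%:M) j (I j) (J j) =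
      (co J == co I)%:R :> R.
    transitivity (\prod_(j < D | j != i) (I j == J j)%:R : R).
      by apply: eq_bigr => j ji; rewrite mix_neq // mxE.
    rewrite prod_natr_bool; congr (_%:R); congr nat_of_bool.
    apply/forallP/eqP => [H|/ffunP H j].
      by apply/ffunP => -[j ji]; rewrite !ffunE /=; have := H j; rewrite ji => /eqP.
    by apply/implyP => ji; have := H (exist _ j ji); rewrite !ffunE /= => ->.
  by ring.
under [RHS]eq_bigr => a _ do
  (under eq_bigr => b _ do rewrite gramE mulr_sumr; rewrite exchange_big /=;
   under eq_bigr => J _ do (under eq_bigr => b _ do rewrite mulr_sumr;
   rewrite exchange_big /=)).
transitivity (\sum_(J : multi_index k) \sum_(I : multi_index k) \sum_a (I i == a)%:R *
   \sum_b (J i == b)%:R * (C i a b * ((co J == co I)%:R * (entry T J * entry S I)))).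
  rewrite exchange_big /=; apply: eq_bigr => J _; apply: eq_bigr => I _.
  by rewrite !sum_indicator; ring.
rewrite [RHS]exchange_big /=; apply: eq_bigr => J _.
rewrite [RHS]exchange_big /=; apply: eq_bigr => I _.
apply: eq_bigr => a _; rewrite mulr_sumr; apply: eq_bigr => b _; ring.
Qed.

Lemma sqnorm_flattening k i (T : tensor R k) : sqnorm (flattening i T) = frob_dot T T.
Proof.
rewrite -[X in frob_dot _ X]tucker1.
rewrite -(@eq_tucker _ _ (mix i (fun j => 1%:M) (fun j => 1%:M))); last first.
  by move=> j; rewrite /mix; case: eqP.
by rewrite frob_dot_mode mul1mx.
Qed.

(** Frames in the other modes cancel against their transposes, which leaves an
    action in mode [i] alone. *)
Lemma frob_dot_mix n k i (W U : forall j, 'M[R]_(n j, k j)) (S T : tensor R k) :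
  (forall j, stiefel (U j)) ->
  frob_dot (tucker (mix i W U) S) (tucker (mix i W U) T) =
  \tr (W i *m flattening i T *m (W i *m flattening i S)^T).
Proof.
move=> US; rewrite frob_dot_tucker tucker_comp.
rewrite (@eq_tucker _ _ _ (mix i (fun j => (W j)^T *m W j) (fun j => 1%:M))); last first.
  by move=> j; rewrite mix_tr mix_mul /mix; case: eqP => // _; exact: US.
by rewrite frob_dot_mode trmx_mul -!mulmxA mxtrace_mulC !mulmxA.
Qed.

Lemma sqnorm_mix n k i (W U : forall j, 'M[R]_(n j, k j)) (T : tensor R k) :
  (forall j, stiefel (U j)) ->
  frob_norm (tucker (mix i W U) T) ^+ 2 = sqnorm (W i *m flattening i T).
Proof. by move=> US; rewrite frob_norm_sqr frob_dot_mix. Qed.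

Lemma sqnorm_mulmx_le {l p q : nat} (A : 'M[R]_(l, p)) (B : 'M[R]_(p, q)) :
  sqnorm (A *m B) <= sqnorm A * sqnorm B.
Proof.
rewrite (sqnormE (A *m B)).
have -> : sqnorm A * sqnorm B = \sum_i \sum_j frob_dot (row i A) (row i A) *
    frob_dot (col j B)^T (col j B)^T.
  under eq_bigr do rewrite -mulr_sumr.
  rewrite -mulr_suml !sqnormE; congr (_ * _).
    by apply: eq_bigr => i _; apply: eq_bigr => j _; rewrite mxE expr2.
  rewrite exchange_big; apply: eq_bigr => i _.
  by apply: eq_bigr => j _; rewrite !mxE expr2.
apply: ler_sum => i _; apply: ler_sum => j _.
have -> : (A *m B) i j = frob_dot (row i A) (col j B)^T.
  by rewrite mxE; apply: eq_bigr => h _; rewrite !mxE.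
exact: Cauchy_Schwarz_sqr.
Qed.

Lemma mode_upper_bound n k i (W U : forall j, 'M[R]_(n j, k j)) (T : tensor R k) :
  (forall j, stiefel (U j)) ->
  frob_norm (tucker (mix i W U) T) <= Num.sqrt (sqnorm (W i)) * frob_norm T.
Proof.
move=> US; rewrite -ler_sqr ?nnegrE ?mulr_ge0 ?frob_norm_ge0 ?sqrtr_ge0 //.
rewrite sqnorm_mix // exprMn frob_norm_sqr sqr_sqrtr ?sqnorm_ge0 //.
by rewrite -(sqnorm_flattening i) sqnorm_mulmx_le.
Qed.

Lemma mode_lower_bound n k i (W U : forall j, 'M[R]_(n j, k j)) (T : tensor R k) :
  (forall j, stiefel (U j)) -> (0 < k i)%N ->
  singval (k i) (flattening i T) * Num.sqrt (sqnorm (W i))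
    <= frob_norm (tucker (mix i W U) T).
Proof.
move=> US k0; rewrite -ler_sqr ?nnegrE ?mulr_ge0 ?frob_norm_ge0 ?sqrtr_ge0 //.
rewrite sqnorm_mix // exprMn (sqr_sqrtr (sqnorm_ge0 (W i))).
exact: singval_lower_bound.
Qed.

Lemma frob_dot_factors n k (u v : factors R n k) :
  frob_dot u v = \sum_i \sum_a \sum_b factor u i a b * factor v i a b.
Proof.
rewrite /frob_dot (reindex (@enum_rank (factor_index n k))) /=; last first.
  exact/onW_bij/enum_rank_bij.
under [RHS]eq_bigr do rewrite pair_bigA /=.
rewrite (sig_big_dep _ (fun i => xpredT)
  (fun i (p : 'I_(n i) * 'I_(k i)) => factor u i p.1 p.2 * factor v i p.1 p.2)) /=.
by apply: eq_bigr => -[i [a b]] _; rewrite !mxE.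
Qed.

Lemma frob_dot_factors_sqnorm n k (u : factors R n k) :
  frob_dot u u = \sum_i sqnorm (factor u i).
Proof.
rewrite frob_dot_factors; apply: eq_bigr => i _; rewrite sqnormE.
by apply: eq_bigr => a _; apply: eq_bigr => b _; rewrite expr2.
Qed.

End TensorAlgebra.

(** * Frames rotated along principal vectors *)

Section RotatingFrames.
Local Open Scope classical_set_scope.
Local Open Scope ring_scope.
Context {R : realType}.

Section Frame.
Context {n k : nat}.
Implicit Types (U W : 'M[R]_(n, k)) (P : 'M[R]_k) (th : 'I_k -> R).

(** The columns of [U P^T], the principal vectors, form an orthonormal basis of
    the range of [U]; the [a]-th one is to be rotated by the angle [th a] towards
    the [a]-th column of [W].  A column of [W] may vanish when its angle is zero. *)
Definition rotating U P W th : Prop :=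
  [/\ stiefel U, P *m P^T = 1%:M, W^T *m U = 0 &
      exists e : 'rV[R]_k, W^T *m W = diag_mx e /\ forall a, e 0 a = 1 \/ th a = 0].

(** Coordinates with respect to the principal vectors are taken by [P]. *)
Definition combine U P W (al be : 'rV[R]_k) : 'M[R]_(n, k) :=
  (U *m P^T *m diag_mx al + W *m diag_mx be) *m P.

Definition rotated U P W th : 'M[R]_(n, k) :=
  combine U P W (\row_a cos (th a)) (\row_a sin (th a)).

Lemma combineE U P W al be x y :
  combine U P W al be x y =
  \sum_a ((U *m P^T) x a * al 0 a + W x a * be 0 a) * P a y.
Proof. by rewrite /combine !mul_mx_diag mxE; apply: eq_bigr => a _; rewrite !mxE. Qed.

Lemma combine_gram U P W al be (e : 'rV[R]_k) : stiefel U -> P *m P^T = 1%:M ->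
  W^T *m U = 0 -> W^T *m W = diag_mx e ->
  (combine U P W al be)^T *m combine U P W al be =
  P^T *m diag_mx (\row_a (al 0 a ^+ 2 + be 0 a ^+ 2 * e 0 a)) *m P.
Proof.
move=> UU PP WU WW.
have UW : U^T *m W = 0 by rewrite -[LHS]trmxK trmx_mul trmxK WU trmx0.
rewrite /combine; set X := U *m P^T.
have XX : X^T *m X = 1%:M.
  by rewrite /X trmx_mul trmxK mulmxA -(mulmxA P) UU mulmx1.
have XW : X^T *m W = 0 by rewrite /X trmx_mul trmxK -mulmxA UW mulmx0.
have WX : W^T *m X = 0 by rewrite /X mulmxA WU mul0mx.
clearbody X; set G := X *m _ + _.
rewrite trmx_mul -!mulmxA; congr (_ *m _); rewrite mulmxA; congr (_ *m _).
have -> : G^T = diag_mx al *m X^T + diag_mx be *m W^T.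
  by rewrite /G [(_ + _)^T]linearD /= !trmx_mul !tr_diag_mx.
rewrite /G mulmxDl !mulmxDr.
rewrite !mulmxA -(mulmxA _ X^T X) XX mulmx1 -(mulmxA _ X^T W) XW mulmx0 mul0mx addr0.
rewrite -(mulmxA _ W^T X) WX mulmx0 mul0mx add0r -(mulmxA _ W^T W) WW.
rewrite !mulmx_diag -raddfD /=; congr diag_mx.
by apply/rowP => a; rewrite !mxE; ring.
Qed.

Lemma sqnorm_gram m p (A : 'M[R]_(m, p)) : sqnorm A = \tr (A^T *m A).
Proof. by rewrite /sqnorm mxtrace_mulC. Qed.

Lemma combine_sqnorm U P W al be (e : 'rV[R]_k) : stiefel U -> P *m P^T = 1%:M ->
  W^T *m U = 0 -> W^T *m W = diag_mx e ->
  sqnorm (combine U P W al be) = \sum_a (al 0 a ^+ 2 + be 0 a ^+ 2 * e 0 a).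
Proof.
move=> UU PP WU WW; rewrite sqnorm_gram (combine_gram _ _ UU PP WU WW).
rewrite mxtrace_mulC mulmxA PP mul1mx mxtrace_diag.
by apply: eq_bigr => a _; rewrite mxE.
Qed.

Lemma rotating_scale U P W th (s : R) : rotating U P W th ->
  rotating U P W (fun a => s * th a).
Proof.
move=> [UU PP WU [e [WW e1]]]; split=> //; exists e; split=> // a.
by case: (e1 a) => [->|->]; [left|right; rewrite mulr0].
Qed.

Lemma rotated_stiefel U P W th : rotating U P W th -> stiefel (rotated U P W th).
Proof.
move=> [UU PP WU [e [WW e1]]]; rewrite /stiefel /= (combine_gram _ _ UU PP WU WW).
have -> : \row_a ((\row_b cos (th b)) 0 a ^+ 2 + (\row_b sin (th b)) 0 a ^+ 2 * e 0 a)
    = const_mx 1 :> 'rV[R]_k.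
  apply/rowP => a; rewrite !mxE; case: (e1 a) => ->; first by rewrite mulr1 cos2Dsin2.
  by rewrite cos0 sin0 expr1n expr0n /= mul0r addr0.
by rewrite diag_const_mx mulmx1; exact: mulmx1C.
Qed.

Lemma rotated0 U P W : P *m P^T = 1%:M -> rotated U P W (fun=> 0) = U.
Proof.
move=> PP; rewrite /rotated /combine.
have -> : \row__ cos 0 = const_mx 1 :> 'rV[R]_k by apply/rowP => a; rewrite !mxE cos0.
have -> : \row__ sin 0 = 0 :> 'rV[R]_k by apply/rowP => a; rewrite !mxE sin0.
by rewrite diag_const_mx mulmx1 linear0 mulmx0 addr0 -mulmxA (mulmx1C PP) mulmx1.
Qed.

Definition rotation_speed U P W th (s : R) : 'M[R]_(n, k) :=
  combine U P W (\row_a (- th a * sin (s * th a))) (\row_a (th a * cos (s * th a))).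

Lemma rotation_speed_sqnorm U P W th s : rotating U P W th ->
  sqnorm (rotation_speed U P W th s) = \sum_a th a ^+ 2.
Proof.
move=> [UU PP WU [e [WW e1]]]; rewrite (combine_sqnorm _ _ UU PP WU WW).
apply: eq_bigr => a _; rewrite !mxE.
case: (e1 a) => ->; last by rewrite oppr0 !mul0r expr0n /= mul0r addr0.
rewrite mulr1 !exprMn sqrrN -mulrDr [_ ^+ 2 + _]addrC cos2Dsin2 mulr1 //.
Qed.

Lemma C1_rotated U P W th x y :
  C1_with (fun s => rotated U P W (fun a => s * th a) x y)
          (fun s => rotation_speed U P W th s x y).
Proof.
under eq_fun do rewrite combineE.
under [X in C1_with _ X]eq_fun do rewrite combineE.
apply: C1_sum => a.
pose p := (U *m P^T) x a; pose w := W x a; pose q := P a y.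
have C1 := C1_mul (C1_cst p) (C1_cos (th a)).
have C2 := C1_mul (C1_cst w) (C1_sin (th a)).
have := C1_mul (C1_add C1 C2) (C1_cst q).
by congr C1_with; apply/funext => s /=; rewrite -/p -/w -/q !mxE; ring.
Qed.

End Frame.

Lemma C1_line (V : normedModType R) (p v : V) :
  C1_with (fun s : R => p + s *: v) (cst v).
Proof.
have L : C1_with (fun s : R => s *: v) (cst v).
  have linL (a s t : R) : (a *: s + t) *: v = a *: (s *: v) + t *: v.
    by rewrite scalerDl scalerA.
  have := @C1_linear R R V (fun s : R => s *: v) id (cst 1) linL
    (@scalel_continuous _ _ _) C1_id.
  by congr C1_with; apply/funext => s /=; rewrite scale1r.
have := C1_add (C1_cst p) L; congr C1_with.
by apply/funext => s /=; rewrite add0r.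
Qed.

Lemma eq_mk_factors {D : nat} {n k : 'I_D -> nat} (U V : forall i, 'M[R]_(n i, k i)) :
  (forall i, U i = V i) -> mk_factors U = mk_factors V.
Proof. by move=> UV; apply/rowP => j; rewrite !mxE /= UV. Qed.

Section FrameCurve.
Context {D : nat} {n k : 'I_D -> nat}.
Variables (U W : forall i, 'M[R]_(n i, k i)) (P : forall i, 'M[R]_(k i)).
Variables (th : forall i, 'I_(k i) -> R) (S T : tensor R k).
Local Notation factor := Defs.factor.

Definition frame_curve (s : R) : factors R n k * tensor R k :=
  (mk_factors (fun i => rotated (U i) (P i) (W i) (fun a => s * th a)),
   S + s *: (T - S)).

Definition frame_speed (s : R) : factors R n k * tensor R k :=
  (mk_factors (fun i => rotation_speed (U i) (P i) (W i) (@th i) s), T - S).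

Lemma C1_frame_curve : C1_with frame_curve frame_speed.
Proof.
apply: C1_pair; last exact: C1_line.
apply: C1_rV => j; rewrite /mk_factors; under eq_fun do rewrite mxE.
under [X in C1_with _ X]eq_fun do rewrite mxE.
exact: C1_rotated.
Qed.

(** The factors rotate at constant speed, the square of which is the sum of
    the squared angles, while the core moves along a segment. *)
Lemma frame_geodist (g : tensor R k -> tensor R k -> tensor R k -> R)
    (M : set (factors R n k * tensor R k)) (K : R) :
  (forall i, rotating (U i) (P i) (W i) (@th i)) ->
  (forall s, s \in `[0, 1] -> M (frame_curve s)) ->
  0 <= K ->
  (forall s, s \in `[0, 1] ->
     \sum_i \sum_a @th i a ^+ 2 + g (S + s *: (T - S)) (T - S) (T - S) <= K ^+ 2) ->
  (geodist (prod_metric abs_metric g) M (mk_factors U, S)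
     (mk_factors (fun i => rotated (U i) (P i) (W i) (@th i)), T) <= K%:E)%E.
Proof.
move=> rot cM K0 gK.
have c0 : frame_curve 0 = (mk_factors U, S).
  rewrite /frame_curve scale0r addr0; congr pair.
  apply: eq_mk_factors => i; have [_ PP _ _] := rot i.
  rewrite -[RHS](rotated0 (U i) (W i) PP); congr rotated.
  by apply/funext => a; rewrite mul0r.
have c1 : frame_curve 1 =
    (mk_factors (fun i => rotated (U i) (P i) (W i) (@th i)), T).
  rewrite /frame_curve scale1r addrC subrK; congr pair.
  apply: eq_mk_factors => i; congr rotated.
  by apply/funext => a; rewrite mul1r.
rewrite -c0 -c1; apply: geodist_le (C1_curves_with C1_frame_curve cM) _.
apply: curve_length_le => s s01; rewrite (derive1_C1 C1_frame_curve).
rewrite -(ger0_norm K0) -sqrtr_sqr ler_sqrt ?sqr_ge0 //.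
apply: le_trans (gK s s01); rewrite /prod_metric /= lerD2r /abs_metric.
rewrite frob_dot_factors_sqnorm; apply: ler_sum => i _.
by rewrite mk_factorsK rotation_speed_sqnorm.
Qed.

End FrameCurve.
End RotatingFrames.

(** * Principal angles *)

Section PrincipalAngles.
Local Open Scope classical_set_scope.
Local Open Scope ring_scope.
Context {R : realType}.

Lemma mul_cos_le_sin (x : R) : 0 <= x < pi / 2 -> x * cos x <= sin x.
Proof.
move=> /andP[x0 xpi].
have [|c] := @MVT_segment R sin cos 0 x x0.
  by apply: continuous_subspaceT => t; exact: continuous_sin.
rewrite in_itv /= => /andP[c0 cx]; rewrite sin0 !subr0 => ->.
rewrite mulrC ler_wpM2r //; move: cx; rewrite le_eqVlt => /predU1P[->//|cx].
by rewrite ltW // ltr_cos ?in_itv /= ?c0 ?x0 //=; lra.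
Qed.

Context {n k : nat}.
Implicit Types (U V : 'M[R]_(n, k)).

Lemma projection_defect_gram U V : stiefel U -> stiefel V ->
  (U - V *m V^T *m U)^T *m (U - V *m V^T *m U) = 1%:M - U^T *m V *m V^T *m U.
Proof.
move=> UU VV; rewrite [(_ - _)^T]linearB /= !trmx_mul trmxK mulmxBl !mulmxBr.
rewrite !mulmxA UU -(mulmxA (U^T *m V) V^T V) VV mulmx1.
by rewrite subrr subr0.
Qed.

(** The quotient [s / s] is zero where [s] vanishes, and there the column of [Z]
    vanishes as well. *)
Lemma mulmx_diag_trP (Z : 'M[R]_(n, k)) (s : 'rV[R]_k) :
  Z^T *m Z = diag_mx (\row_a (s 0 a ^+ 2)) -> Z *m diag_mx (\row_a (s 0 a / s 0 a)) = Z.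
Proof.
move=> ZZ; apply/matrixP => x a; rewrite mul_mx_diag !mxE.
have [s0|s0] := eqVneq (s 0 a) 0; last by rewrite divff // mulr1.
rewrite s0 mul0r mulr0; apply/esym/eqP; rewrite -sqrf_eq0.
have := congr1 (fun M : 'M[R]_k => M a a) ZZ; rewrite !mxE eqxx s0 expr0n /=.
under eq_bigr do rewrite mxE -expr2.
move=> /eqP; rewrite psumr_eq0; last by move=> i _; exact: sqr_ge0.
by move=> /allP /(_ x (mem_index_enum _)).
Qed.

(** Principal angles between the ranges of two frames: the eigenvalues of
    [U^T V V^T U] are the squared cosines, and the polar factor of [V^T U] turns
    [V] into the frame that is reached by rotating the principal vectors of
    [U]. *)
Lemma principal_rotation U V : stiefel U -> stiefel V ->
  sqnorm (U - V *m V^T *m U) < 1 ->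
  exists P W th Q, [/\ rotating U P W th, Q *m Q^T = 1%:M,
    rotated U P W th = V *m Q, forall a, 0 <= th a < pi / 2 &
    U^T *m (V *m Q) = P^T *m diag_mx (\row_a cos (th a)) *m P /\
    \sum_a sin (th a) ^+ 2 = sqnorm (U - V *m V^T *m U)].
Proof.
move=> UU VV; set Y := U - _ => Y1.
pose A := U^T *m V *m V^T *m U.
have YY : Y^T *m Y = 1%:M - A by exact: projection_defect_gram.
have symA : A^T = A by rewrite /A !trmx_mul !trmxK !mulmxA.
have [P [mu [PP PA]]] := real_spectral symA.
have PtP : P^T *m P = 1%:M by exact: mulmx1C.
have mu1 a : 1 - mu 0 a = frob_dot (row a (Y *m P^T)^T) (row a (Y *m P^T)^T).
  have -> : 1 - mu 0 a = (P *m (Y^T *m Y) *m P^T) a a.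
    by rewrite YY mulmxBr mulmxBl mulmx1 PP PA !mxE eqxx.
  have -> : P *m (Y^T *m Y) *m P^T = (Y *m P^T)^T *m (Y *m P^T).
    by rewrite trmx_mul trmxK !mulmxA.
  by rewrite mxE; apply: eq_bigr => x _; rewrite !mxE.
have mule1 a : mu 0 a <= 1 by rewrite -subr_ge0 mu1 frob_dot_ge0.
have summu : \sum_a (1 - mu 0 a) = sqnorm Y.
  transitivity (\tr (P *m (1%:M - A) *m P^T)).
    rewrite mulmxBr mulmxBl mulmx1 PP PA.
    by apply: eq_bigr => a _; rewrite !mxE eqxx.
  by rewrite mxtrace_mulC mulmxA PtP mul1mx sqnorm_gram YY.
have mu0 a : 0 < mu 0 a.
  have : 1 - mu 0 a <= \sum_a (1 - mu 0 a).
    by rewrite (bigD1 a) //= lerDl; apply: sumr_ge0 => b _; rewrite subr_ge0.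
  by rewrite summu; lra.
pose c a := Num.sqrt (mu 0 a).
have c0 a : 0 < c a by rewrite sqrtr_gt0.
have c2 a : c a ^+ 2 = mu 0 a by rewrite sqr_sqrtr // ltW.
have c1 a : -1 <= c a <= 1.
  by have := c0 a; have := c2 a; have := mule1 a => ? ? ?; apply/andP; split; nra.
pose th a := acos (c a).
have cosE a : cos (th a) = c a by rewrite acosK // in_itv /= c1.
have sin2E a : sin (th a) ^+ 2 = 1 - mu 0 a by rewrite sin2cos2 cosE c2.
have th0 a : 0 <= th a < pi / 2.
  rewrite acos_ge0 ?c1 //= ltNge; apply/negP => le.
  have := c0 a; rewrite -cosE ltNge => /negP; apply.
  rewrite -(cos_pihalf R) le_eqVlt.
  move: le; rewrite le_eqVlt => /predU1P[->|lt]; first by rewrite eqxx.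
  have p0 := pi_gt0 R; have th1 := acos_lepi (c1 a); have th2 := acos_ge0 (c1 a).
  rewrite -/(th a) in th1 th2.
  by apply/orP; right; rewrite ltr_cos // in_itv /=; apply/andP; split; lra.
have sin_eq0 a : sin (th a) = 0 -> th a = 0.
  move=> s0; have := sin2E a; rewrite s0 expr0n /= => m1.
  have m1' : mu 0 a = 1 by lra.
  by rewrite /th /c m1' sqrtr1 acos1.
pose dc : 'rV[R]_k := \row_a c a; pose ds : 'rV[R]_k := \row_a sin (th a).
pose di : 'rV[R]_k := \row_a (c a)^-1.
have APt : A *m P^T = P^T *m diag_mx mu by rewrite -PA !mulmxA PtP mul1mx.
pose Q := V^T *m U *m P^T *m diag_mx di *m P.
have UVQ : U^T *m (V *m Q) = P^T *m diag_mx dc *m P.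
  rewrite /Q !mulmxA -/A APt -(mulmxA P^T) mulmx_diag; congr (_ *m diag_mx _ *m _).
  by apply/rowP => a; rewrite !mxE -c2; field; rewrite gt_eqF.
have QQ : Q^T *m Q = 1%:M.
  have -> : Q^T *m Q = P^T *m diag_mx di *m P *m (U^T *m (V *m Q)).
    by rewrite {1}/Q !trmx_mul !trmxK tr_diag_mx !mulmxA.
  rewrite UVQ !mulmxA -(mulmxA _ P P^T) PP mulmx1 -(mulmxA P^T) mulmx_diag.
  have -> : \row_a (di 0 a * dc 0 a) = const_mx 1 :> 'rV[R]_k.
    by apply/rowP => a; rewrite !mxE mulVf // gt_eqF.
  by rewrite diag_const_mx mulmx1.
have [U' U'E] : exists U', U' = V *m Q by eexists.
have U'U' : U'^T *m U' = 1%:M.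
  by rewrite U'E trmx_mul mulmxA -(mulmxA _ V^T) VV mulmx1 QQ.
have UU' : U^T *m U' = P^T *m diag_mx dc *m P by rewrite U'E.
have U'U : U'^T *m U = P^T *m diag_mx dc *m P.
  by have := congr1 trmx UU'; rewrite !trmx_mul !trmxK tr_diag_mx mulmxA.
have dcE : \row_a cos (th a) = dc by apply/rowP => a; rewrite !mxE cosE.
pose Z := U' *m P^T - U *m P^T *m diag_mx dc.
have ZT : Z^T = P *m U'^T - diag_mx dc *m P *m U^T.
  by rewrite /Z [(_ - _)^T]linearB /= !trmx_mul !trmxK tr_diag_mx mulmxA.
have ZU : Z^T *m U = 0.
  rewrite ZT mulmxBl -(mulmxA P U'^T U) U'U !mulmxA PP mul1mx -(mulmxA _ U^T) UU mulmx1.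
  by rewrite subrr.
have ZZ : Z^T *m Z = diag_mx (\row_a (ds 0 a ^+ 2)).
  rewrite {2}/Z mulmxBr !mulmxA ZU !mul0mx subr0 ZT mulmxBl -(mulmxA P) U'U' mulmx1.
  rewrite -(mulmxA _ U^T) UU' !mulmxA -(mulmxA (diag_mx dc) P P^T) PP mulmx1 mulmx_diag.
  rewrite mulmxBl PP -(mulmxA _ P P^T) PP mulmx1 -diag_const_mx -raddfB /=.
  by congr diag_mx; apply/rowP => a; rewrite !mxE sin2E -c2 expr2.
exists P, (Z *m diag_mx (\row_a (ds 0 a)^-1)), th, Q; split => //.
- split => //; first by rewrite trmx_mul tr_diag_mx -mulmxA ZU mulmx0.
  exists (\row_a ((ds 0 a)^-1 * ds 0 a ^+ 2 * (ds 0 a)^-1)); split.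
    rewrite trmx_mul tr_diag_mx !mulmxA -(mulmxA _ Z^T) ZZ !mulmx_diag.
    by congr diag_mx; apply/rowP => a; rewrite !mxE.
  move=> a; rewrite !mxE; have [/sin_eq0 ->|s0] := eqVneq (sin (th a)) 0.
    by right.
  by left; field.
- exact: mulmx1C.
- rewrite /rotated /combine dcE -(mulmxA Z) mulmx_diag.
  have -> : \row_a ((\row_b (ds 0 b)^-1) 0 a * (\row_b sin (th b)) 0 a) =
      \row_a (ds 0 a / ds 0 a) by apply/rowP => a; rewrite !mxE mulrC.
  by rewrite (mulmx_diag_trP ZZ) /Z addrC subrK -(mulmxA U') PtP mulmx1 -U'E.
- rewrite dcE; split => //; rewrite -summu; apply: eq_bigr => a _; exact: sin2E.
Qed.
End PrincipalAngles.

(** * Orthogonal components of a perturbed tensor *)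

Section UpperEstimate.
Local Open Scope classical_set_scope.
Local Open Scope ring_scope.
Context {R : realType} {D : nat}.
Implicit Types n k : 'I_D -> nat.

Lemma one_sub_prod_le (I : finType) (c : I -> R) : (forall i, 0 <= c i <= 1) ->
  0 <= 1 - \prod_i c i <= \sum_i (1 - c i).
Proof.
move=> c01; have H (r : seq I) : 0 <= \prod_(i <- r) c i <= 1 /\
    1 - \prod_(i <- r) c i <= \sum_(i <- r) (1 - c i).
  elim: r => [|i r [/andP[p0 p1] IH]]; rewrite ?big_nil ?big_cons.
    by rewrite subrr lexx ler01.
  have /andP[ci0 ci1] := c01 i.
  move: p0 p1 IH; set p := \prod_(j <- r) _; set s := \sum_(j <- r) _ => p0 p1 IH.
  by split; [apply/andP; split|]; nra.
by have [/andP[_ p1] pl] := H (index_enum I); rewrite subr_ge0 p1 pl.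
Qed.

Lemma entry_tucker_diag k (c : forall i, 'rV[R]_(k i)) (T : tensor R k) J :
  entry (tucker (fun i => diag_mx (c i)) T) J = (\prod_i c i 0 (J i)) * entry T J.
Proof.
rewrite entry_tucker (bigD1 J) //= [X in _ + X]big1 => [|I IJ].
  by rewrite addr0; congr (_ * _); apply: eq_bigr => i _; rewrite mxE eqxx.
have [i /negPf Ii] : exists i, I i != J i.
  apply/existsP; rewrite -negb_forall; apply/negP => /forallP IJi.
  by move/eqP: IJ; apply; apply/ffunP => i; apply/eqP/IJi.
by rewrite (bigD1 i) //= mxE eq_sym Ii !mul0r.
Qed.

(** Symmetric positive contractions that are diagonal in some orthonormal bases
    move a tensor by at most the sum of their eigenvalue defects. *)
Lemma tucker_near_identity k (P : forall i, 'M[R]_(k i)) (c : forall i, 'rV[R]_(k i))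
    (T : tensor R k) :
  (forall i, P i *m (P i)^T = 1%:M) -> (forall i a, 0 <= c i 0 a <= 1) ->
  frob_norm (T - tucker (fun i => (P i)^T *m diag_mx (c i) *m P i) T)
    <= (\sum_i \sum_a (1 - c i 0 a)) * frob_norm T.
Proof.
move=> PP c01; set K := \sum_i _.
have K0 : 0 <= K.
  apply: sumr_ge0 => i _; apply: sumr_ge0 => a _.
  by have /andP[_] := c01 i a; rewrite subr_ge0.
have Pst i : stiefel (P i) by rewrite /stiefel /=; exact: mulmx1C.
have Ptst i : stiefel (P i)^T by rewrite /stiefel /= trmxK.
pose T' := tucker P T.
have -> : T - tucker (fun i => (P i)^T *m diag_mx (c i) *m P i) T =
    tucker (fun i => (P i)^T) (T' - tucker (fun i => diag_mx (c i)) T').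
  rewrite /T' tuckerB !tucker_comp; congr (_ - _).
  by rewrite -[LHS]tucker1; apply: eq_tucker => i; rewrite Pst.
rewrite (tucker_stiefel_norm _ Ptst) -(tucker_stiefel_norm T Pst) -/T'.
rewrite -ler_sqr ?nnegrE ?mulr_ge0 ?frob_norm_ge0 // exprMn !frob_norm_sqr.
rewrite !frob_dot_entry mulr_sumr; apply: ler_sum => J _.
rewrite entryD entryN entry_tucker_diag.
have cJ i : 0 <= c i 0 (J i) <= 1 by exact: c01.
have /andP[p0 p1] := one_sub_prod_le cJ.
have pK : 1 - \prod_i c i 0 (J i) <= K.
  apply: le_trans p1 _; apply: ler_sum => i _; rewrite [leRHS](bigD1 (J i)) //= lerDl.
  by apply: sumr_ge0 => a _; have /andP[_] := c01 i a; rewrite subr_ge0.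
move: p0 pK; set p := \prod_i _; set x := entry _ _ => p0 pK.
have -> : (x - p * x) * (x - p * x) = (1 - p) ^+ 2 * (x * x) by ring.
by rewrite ler_wpM2r ?ler_sqr ?nnegrE // -expr2 sqr_ge0.
Qed.

Lemma frob_dot_suml N (I : finType) (u : I -> 'rV[R]_N) v :
  frob_dot (\sum_i u i) v = \sum_i frob_dot (u i) v.
Proof.
apply: (big_morph (fun x => frob_dot x v)); first by move=> x y; exact: frob_dotDl.
exact: frob_dot0l.
Qed.

Lemma bessel N (I : finType) (p : I -> 'rV[R]_N) (z : 'rV[R]_N) :
  (forall i j, i != j -> frob_dot (p i) (p j) = 0) ->
  (forall i, frob_dot (p i) z = frob_dot (p i) (p i)) ->
  \sum_i frob_norm (p i) ^+ 2 <= frob_norm z ^+ 2.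
Proof.
move=> orth pz; set q := \sum_i p i.
have qz : frob_dot q z = \sum_i frob_norm (p i) ^+ 2.
  by rewrite frob_dot_suml; apply: eq_bigr => i _; rewrite pz frob_norm_sqr.
have qq : frob_dot q q = \sum_i frob_norm (p i) ^+ 2.
  rewrite frob_dot_suml; apply: eq_bigr => i _; rewrite frob_dotC frob_dot_suml.
  rewrite (bigD1 i) //= big1 ?addr0 ?frob_norm_sqr // => j ji.
  exact: orth.
have := frob_dot_ge0 (z - q); rewrite !frob_dotE (frob_dotC z q) qz qq frob_norm_sqr.
lra.
Qed.

Section Projections.
Context {n k : 'I_D -> nat}.
Implicit Types (U V W : forall i, 'M[R]_(n i, k i)).

Definition range_proj U i : 'M[R]_(n i) := U i *m (U i)^T.
Definition range_compl U i : 'M[R]_(n i) := 1%:M - range_proj U i.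

Lemma range_proj_tr U i : (range_proj U i)^T = range_proj U i.
Proof. by rewrite /range_proj trmx_mul trmxK. Qed.

Lemma range_compl_tr U i : (range_compl U i)^T = range_compl U i.
Proof. by rewrite /range_compl [(_ - _)^T]linearB /= trmx1 range_proj_tr. Qed.

Lemma range_proj_idem U i : stiefel (U i) -> range_proj U i *m range_proj U i = range_proj U i.
Proof. by move=> UU; rewrite /range_proj mulmxA -(mulmxA (U i)) UU mulmx1. Qed.

Lemma range_compl_proj U i : stiefel (U i) -> range_compl U i *m range_proj U i = 0.
Proof. by move=> UU; rewrite mulmxBl mul1mx range_proj_idem // subrr. Qed.

Lemma range_proj_compl U i : stiefel (U i) -> range_proj U i *m range_compl U i = 0.
Proof. by move=> UU; rewrite mulmxBr mulmx1 range_proj_idem // subrr. Qed.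

Lemma range_compl_idem U i : stiefel (U i) ->
  range_compl U i *m range_compl U i = range_compl U i.
Proof. by move=> UU; rewrite {1}/range_compl mulmxBl mul1mx range_proj_compl // subr0. Qed.

Lemma range_complE U i : stiefel (U i) -> range_compl U i *m U i = 0.
Proof. by move=> UU; rewrite mulmxBl mul1mx -mulmxA UU mulmx1 subrr. Qed.

Lemma range_projE U i : stiefel (U i) -> range_proj U i *m U i = U i.
Proof. by move=> UU; rewrite -mulmxA UU mulmx1. Qed.

(** Projecting away the range of the [i]-th factor of the second tensor kills
    that tensor, and keeps only what the [i]-th factor of the first one has
    outside of this range. *)
Lemma projection_defect_le U V (S T : tensor R k) i : (0 < k i)%N ->
  (forall j, stiefel (U j)) -> (forall j, stiefel (V j)) ->
  singval (k i) (flattening i S) *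
    Num.sqrt (sqnorm (U i - V i *m (V i)^T *m U i)) <=
  frob_norm (tucker V T - tucker U S).
Proof.
move=> k0 US VS.
pose E := mix i (range_compl V) (fun j => 1%:M).
have Esym j : (E j)^T = E j.
  by rewrite /E mix_tr /mix; case: eqP => // _; rewrite ?range_compl_tr ?trmx1.
have Eidem j : E j *m E j = E j.
  rewrite /E mix_mul /mix; case: eqP => // _; rewrite ?mulmx1 //.
  exact: range_compl_idem.
have contr z : frob_norm (tucker E z) <= frob_norm z.
  have e : frob_dot (tucker E z) (tucker E z) = frob_dot z (tucker E z).
    rewrite frob_dot_tucker tucker_comp; congr frob_dot; apply: eq_tucker => j.
    by rewrite Esym Eidem.
  have := le_trans (ler_norm _) (Cauchy_Schwarz z (tucker E z)).
  rewrite -e -frob_norm_sqr; have := frob_norm_ge0 (tucker E z).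
  have := frob_norm_ge0 z.
  set x := frob_norm z; set y := frob_norm _ => x0 y0 H.
  have [->//|yn0] := eqVneq y 0.
  by rewrite -(ler_pM2r (_ : 0 < y)) -?expr2 // lt_def yn0.
apply: le_trans (mode_lower_bound (fun j => U j - V j *m (V j)^T *m U j) S US k0) _.
rewrite frob_norm_distC; apply: le_trans (contr _).
rewrite tuckerB [in leRHS]tucker_comp [X in _ - X]tucker_comp.
rewrite [X in _ - X](tucker_eq0 (i := i)) ?subr0; last by rewrite /E mix_eq range_complE.
rewrite le_eqVlt; apply/orP; left; apply/eqP; congr frob_norm; apply: eq_tucker => j.
rewrite /E /mix; case: eqP => _; last by rewrite mul1mx.
by rewrite /range_compl mulmxBl mul1mx.
Qed.

(** The difference of two tensors dominates its component in the product of the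
    ranges of the [U i] together with its components that leave exactly one of
    these ranges. *)
Lemma tucker_pythagoras U V (S T : tensor R k) :
  (forall j, stiefel (U j)) ->
  frob_norm (tucker (fun j => (U j)^T *m V j) T - S) ^+ 2 +
  \sum_i frob_norm (tucker (mix i (fun j => range_compl U j *m V j) U)
            (tucker (mix i (fun j => 1%:M) (fun j => (U j)^T *m V j)) T)) ^+ 2
  <= frob_norm (tucker V T - tucker U S) ^+ 2.
Proof.
move=> US; set z := tucker V T - tucker U S.
pose E (o : unit + 'I_D) : forall j, 'M[R]_(n j) :=
  if o is inr i then mix i (range_compl U) (range_proj U) else range_proj U.
have Esym o j : (E o j)^T = E o j.
  case: o => [_|i] /=; first by rewrite range_proj_tr.
  by rewrite mix_tr /mix; case: eqP; rewrite ?range_proj_tr ?range_compl_tr.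
have Eidem o j : E o j *m E o j = E o j.
  case: o => [_|i] /=; first by rewrite range_proj_idem.
  by rewrite mix_mul /mix; case: eqP; rewrite ?range_proj_idem ?range_compl_idem.
have Eorth o o' : o != o' -> exists j, E o j *m E o' j = 0.
  case: o o' => [[]|i] [[]|i'] oo'; first by rewrite eqxx in oo'.
  - by exists i'; rewrite /= mix_eq range_proj_compl.
  - by exists i; rewrite /= mix_eq range_compl_proj.
  - have ii' : i != i' by apply: contraNneq oo' => ->.
    by exists i; rewrite /= mix_eq mix_neq // range_compl_proj.
have orth o o' : o != o' -> frob_dot (tucker (E o) z) (tucker (E o') z) = 0.
  move=> /Eorth [j Ej]; rewrite frob_dot_tucker tucker_comp (tucker_eq0 (i := j)) ?frob_dot0r //.
  by rewrite Esym.
have pz o : frob_dot (tucker (E o) z) z = frob_dot (tucker (E o) z) (tucker (E o) z).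
  rewrite [RHS]frob_dot_tucker tucker_comp frob_dotC; congr frob_dot.
  by apply: eq_tucker => j; rewrite Esym Eidem.
have := bessel orth pz; rewrite big_sumType /= (big_pred1 tt) //; apply: le_trans.
rewrite le_eqVlt; apply/orP; left; apply/eqP; congr (_ + _).
  rewrite -(tucker_stiefel_norm _ US); congr (frob_norm _ ^+ 2).
  rewrite /z !tuckerB !tucker_comp; congr (_ - _); apply: eq_tucker => j.
    by rewrite mulmxA.
  by rewrite range_projE.
apply: eq_bigr => i _; congr (frob_norm _ ^+ 2).
rewrite /z tuckerB !tucker_comp [X in _ - X](tucker_eq0 (i := i)) ?subr0; last first.
  by rewrite mix_eq range_complE.
apply: eq_tucker => j; rewrite mix_mul /mix; case: eqP => _; first by rewrite mulmx1.
by rewrite mulmxA.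
Qed.

End Projections.
End UpperEstimate.

(** * A nearby decomposition of a perturbed tensor *)

Lemma dependent_choice_fun (I : Type) (T : I -> Type) (Q : forall i, T i -> Prop) :
  (forall i, exists x, Q i x) -> exists f : forall i, T i, forall i, Q i (f i).
Proof.
by move=> H; exists (fun i => sval (cid (H i))) => i; exact: (svalP (cid (H i))).
Qed.

Section UpperSection.
Local Open Scope classical_set_scope.
Local Open Scope ring_scope.
Context {R : realType} {D : nat}.
Implicit Types n k : 'I_D -> nat.

Lemma stiefel_square m p (V : 'M[R]_(m, p)) : stiefel V -> ~~ (p < m)%N ->
  V *m V^T = 1%:M.
Proof.
move=> VV; rewrite -leqNgt => mp.
have pm : (p <= m)%N.
  have : (\rank (V^T *m V) <= m)%N by rewrite (leq_trans (mxrankM_maxl _ _)) // rank_leq_col.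
  by rewrite VV mxrank1.
have e : m = p by apply/eqP; rewrite eqn_leq mp pm.
by subst m; exact: mulmx1C.
Qed.

(** Bookkeeping of the orders in [d], the distance to the perturbed tensor.  Here
    [w] and [th] are the sums of the squared sines and of the squares of the
    principal angles, [t] is the distance between the cores, [b] the distance
    from [S] to the projection of the perturbed tensor, [e] the distance between
    this projection and the new core, and [G] collects the squared components
    outside the ranges of the original factors. *)
Lemma upper_arith (dR N sg d w b e t th G C1 C2 rho ka : R) :
  0 <= dR -> 0 <= N -> 0 < sg -> 0 <= d -> d <= 1 -> 2 * d <= sg ->
  C1 = dR * (N + 1) / sg ^+ 2 -> C2 = 2 * C1 + 1 -> C2 * d <= sg ->
  0 <= w -> w <= dR * (d ^+ 2 / sg ^+ 2) -> 0 <= b -> 0 <= t ->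
  e <= w * (N + 1) -> t <= b + e ->
  b ^+ 2 + G <= d ^+ 2 -> (sg - C2 * d) ^+ 2 * w <= G ->
  th <= w * (1 + 2 * (d ^+ 2 / sg ^+ 2)) ->
  0 <= rho <= ka -> 1 / sg ^+ 2 <= ka ->
  th + rho * t ^+ 2 <= ka * d ^+ 2 +
    (1 + ka) * (2 * dR / sg ^+ 4 + (2 * C1 + C1 ^+ 2) + 2 * C2 * dR / sg) * d ^+ 3.
Proof.
move=> dR0 N0 sg0 d0 d1 dsg C1E C2E C2d w0 wle b0 t0 ele tle bG Gw thle /andP[rho0 rhoka] sgka.
have sg2 : 0 < sg ^+ 2 by exact: exprn_gt0.
have C10 : 0 <= C1 by rewrite C1E divr_ge0 ?mulr_ge0 //; lra.
have C20 : 0 <= C2 by lra.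
have ka0 : 0 <= ka by lra.
pose x := d ^+ 2 / sg ^+ 2; rewrite -/x in wle thle.
have x0 : 0 <= x by rewrite divr_ge0 ?sqr_ge0.
have xE : x * sg ^+ 2 = d ^+ 2 by rewrite /x; field; rewrite gt_eqF.
have e1 : e <= C1 * d ^+ 2.
  apply: le_trans ele _; rewrite C1E -xE.
  have -> : dR * (N + 1) / sg ^+ 2 * (x * sg ^+ 2) = dR * x * (N + 1).
    by field; rewrite gt_eqF.
  by rewrite ler_wpM2r //; lra.
have d2 : d ^+ 2 <= d by nra.
have d43 : d ^+ 4 <= d ^+ 3 by rewrite ler_wiXn2l.
have d30 : 0 <= d ^+ 3 by exact: exprn_ge0.
have bd : b <= d.
  rewrite -ler_sqr ?nnegrE //.
  have : 0 <= (sg - C2 * d) ^+ 2 * w by rewrite mulr_ge0 ?sqr_ge0.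
  by lra.
have t2 : t ^+ 2 <= b ^+ 2 + (2 * C1 + C1 ^+ 2) * d ^+ 3.
  have tb : t <= b + C1 * d ^+ 2 by lra.
  have p0 : 0 <= b + C1 * d ^+ 2 by rewrite addr_ge0 // mulr_ge0 ?sqr_ge0.
  apply: (@le_trans _ _ ((b + C1 * d ^+ 2) ^+ 2)); first by rewrite ler_sqr ?nnegrE.
  have -> : (b + C1 * d ^+ 2) ^+ 2 = b ^+ 2 + 2 * C1 * (b * d ^+ 2) + C1 ^+ 2 * d ^+ 4 by ring.
  have h1 : C1 ^+ 2 * d ^+ 4 <= C1 ^+ 2 * d ^+ 3 by rewrite ler_wpM2l ?sqr_ge0.
  have h2 : 2 * C1 * (b * d ^+ 2) <= 2 * C1 * d ^+ 3.
    rewrite ler_wpM2l //; first by lra.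
    by rewrite [d ^+ 3]exprS ler_wpM2r ?sqr_ge0.
  lra.
have main : sg ^+ 2 * w + b ^+ 2 <= d ^+ 2 + 2 * C2 * dR / sg * d ^+ 3.
  have h1 : 2 * sg * C2 * d * w <= 2 * C2 * dR / sg * d ^+ 3.
    have -> : 2 * C2 * dR / sg * d ^+ 3 = 2 * sg * C2 * d * (dR * x).
      by rewrite /x; field; rewrite gt_eqF.
    by rewrite ler_wpM2l // !mulr_ge0 //; lra.
  have h2 : 0 <= (C2 * d) ^+ 2 * w by rewrite mulr_ge0 ?sqr_ge0.
  have -> : sg ^+ 2 * w = (sg - C2 * d) ^+ 2 * w + 2 * sg * C2 * d * w - (C2 * d) ^+ 2 * w.
    by ring.
  lra.
have thw : th <= w + 2 * dR / sg ^+ 4 * d ^+ 3.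
  apply: le_trans thle _; rewrite mulrDr mulr1 lerD2l.
  apply: (@le_trans _ _ (dR * x * (2 * x))).
    by rewrite ler_wpM2r // mulr_ge0.
  have -> : dR * x * (2 * x) = 2 * dR / sg ^+ 4 * d ^+ 4.
    by rewrite /x; field; rewrite gt_eqF.
  by rewrite ler_wpM2l // divr_ge0 ?mulr_ge0 ?exprn_ge0 // ltW.
have wka : w + rho * b ^+ 2 <= ka * (sg ^+ 2 * w + b ^+ 2).
  have h1 : w <= ka * (sg ^+ 2 * w).
    have {1}-> : w = 1 / sg ^+ 2 * (sg ^+ 2 * w) by field; rewrite gt_eqF.
    by rewrite ler_wpM2r // mulr_ge0 // ltW.
  have h2 : rho * b ^+ 2 <= ka * b ^+ 2 by rewrite ler_wpM2r ?sqr_ge0.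
  lra.
have rt : rho * t ^+ 2 <= rho * b ^+ 2 + ka * ((2 * C1 + C1 ^+ 2) * d ^+ 3).
  have h1 : rho * t ^+ 2 <= rho * (b ^+ 2 + (2 * C1 + C1 ^+ 2) * d ^+ 3) by rewrite ler_wpM2l.
  have h2 : rho * ((2 * C1 + C1 ^+ 2) * d ^+ 3) <= ka * ((2 * C1 + C1 ^+ 2) * d ^+ 3).
    by rewrite ler_wpM2r // mulr_ge0 // addr_ge0 ?sqr_ge0 //; lra.
  lra.
have kmain : ka * (sg ^+ 2 * w + b ^+ 2) <= ka * (d ^+ 2 + 2 * C2 * dR / sg * d ^+ 3).
  by rewrite ler_wpM2l.
set A := 2 * dR / sg ^+ 4 in thw *; set B := 2 * C1 + C1 ^+ 2 in rt *.
set E := 2 * C2 * dR / sg in kmain *.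
have A0 : 0 <= A by rewrite divr_ge0 ?mulr_ge0 ?exprn_ge0 // ltW.
have B0 : 0 <= B by rewrite addr_ge0 ?sqr_ge0 //; lra.
have E0 : 0 <= E by rewrite divr_ge0 ?mulr_ge0 // ltW.
have hA : 0 <= ka * A * d ^+ 3 by rewrite mulr_ge0 // mulr_ge0.
have hB : 0 <= B * d ^+ 3 by exact: mulr_ge0.
have hE : 0 <= E * d ^+ 3 by exact: mulr_ge0.
have -> : (1 + ka) * (A + B + E) * d ^+ 3 = A * d ^+ 3 + B * d ^+ 3 + E * d ^+ 3 +
   ka * A * d ^+ 3 + ka * (B * d ^+ 3) + ka * (E * d ^+ 3) by ring.
move: wka; rewrite !mulrDr in kmain * => wka; lra.
Qed.

Lemma angle_sqr_le (x th : R) : 0 <= th < pi / 2 -> 0 <= x <= 1 / 4 ->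
  sin th ^+ 2 <= x -> th ^+ 2 <= sin th ^+ 2 * (1 + 2 * x).
Proof.
move=> th0 /andP[x0 x1] sx; have := mul_cos_le_sin th0.
move: th0 => /andP[th0 thpi] le.
have c0 : 0 <= cos th by rewrite ltW // cos_gt0_pihalf // thpi andbT; have := pi_gt0 R; lra.
have le2 : (th * cos th) ^+ 2 <= sin th ^+ 2.
  by rewrite ler_sqr ?nnegrE ?mulr_ge0 //; apply: le_trans le; rewrite mulr_ge0.
rewrite exprMn cos2sin2 in le2.
set s := sin th ^+ 2 in sx le2 *; have t20 := sqr_ge0 th.
have h1 : th ^+ 2 * (1 - x) <= s.
  by apply: le_trans le2; rewrite ler_wpM2l //; lra.
have h2 : th ^+ 2 * (1 - x) * (1 + 2 * x) <= s * (1 + 2 * x) by rewrite ler_wpM2r //; lra.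
apply: le_trans h2; rewrite -mulrA -[leLHS]mulr1 ler_wpM2l //; nra.
Qed.

Lemma cos_ge0_le1 (x : R) : 0 <= x < pi / 2 -> 0 <= cos x <= 1.
Proof.
move=> /andP[x0 xpi]; rewrite cos_le1 andbT ltW // cos_gt0_pihalf // xpi andbT.
by apply: lt_le_trans x0; rewrite oppr_lt0 divr_gt0 ?pi_gt0.
Qed.

Lemma one_sub_cos_le (x : R) : 0 <= x < pi / 2 -> 1 - cos x <= sin x ^+ 2.
Proof.
move=> /cos_ge0_le1 /andP[c0 c1]; rewrite sin2cos2 lerD2l lerN2 expr2.
by rewrite -[leRHS]mulr1 ler_wpM2l.
Qed.

Definition total_angle k (th : forall i : 'I_D, 'I_(k i) -> R) : R :=
  \sum_i \sum_a th i a ^+ 2.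

(** The nearby tensor is decomposed anew with the frames of its factors aligned
    to [U].  By [tucker_pythagoras] the squared distance [d ^+ 2] splits into the
    change of the core and, in each mode, the part leaving the range of [U i],
    which is at least [sg ^+ 2] times the sum of the squared sines.  Alignment
    makes all other contributions quadratic in [d], and the rotation of frames
    has length equal to the angles, which agree with the sines up to a relative
    error [O(d ^+ 2)]. *)
Lemma upper_section n k (U : forall i, 'M[R]_(n i, k i)) (S : tensor R k) (sg : R) :
  (forall i, 0 < k i)%N -> (forall i, stiefel (U i)) -> 0 < sg ->
  (forall i, (k i < n i)%N -> sg <= singval (k i) (flattening i S)) ->
  exists C d0 : R, [/\ 0 <= C, 0 < d0 &
  forall V (T0 : tensor R k), (forall i, stiefel (V i)) ->
  let d := frob_norm (tucker V T0 - tucker U S) in d < d0 ->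
  exists P W (th : forall i : 'I_D, 'I_(k i) -> R) T,
  [/\ forall i, rotating (U i) (P i) (W i) (th i),
      tucker (fun i => rotated (U i) (P i) (W i) (th i)) T = tucker V T0,
      total_angle th <= C * d ^+ 2, frob_norm (T - S) <= C * d &
      forall rho ka, 0 <= rho <= ka -> 1 / sg ^+ 2 <= ka ->
        total_angle th + rho * frob_norm (T - S) ^+ 2
          <= ka * d ^+ 2 + (1 + ka) * C * d ^+ 3]].
Proof.
move=> k0 US sg0 sgS.
pose dR : R := D%:R; pose N := frob_norm S.
pose C1 := dR * (N + 1) / sg ^+ 2; pose C2 := 2 * C1 + 1.
have dR0 : 0 <= dR by exact: ler0n.
have N0 : 0 <= N by exact: frob_norm_ge0.
have sg2 : 0 < sg ^+ 2 by exact: exprn_gt0.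
have C10 : 0 <= C1 by rewrite divr_ge0 ?mulr_ge0 //; lra.
have C20 : 0 < C2 by rewrite /C2; lra.
pose E0 := 2 * dR / sg ^+ 4 + (2 * C1 + C1 ^+ 2) + 2 * C2 * dR / sg.
have E00 : 0 <= E0.
  rewrite !addr_ge0 ?mulr_ge0 ?invr_ge0 ?sqr_ge0 ?exprn_ge0 //; lra.
have F0 : 0 <= 2 * dR / sg ^+ 2 by rewrite divr_ge0 ?mulr_ge0 // ltW.
exists (E0 + 2 * dR / sg ^+ 2 + (1 + C1)), (Num.min 1 (Num.min (sg / 2) (sg / C2))).
split; first by lra.
  by rewrite !lt_min ltr01 !divr_gt0 //; lra.
move=> V T0 VS d; rewrite !lt_min => /and3P[d1 dsg dC2].
have {}dsg : 2 * d <= sg by lra.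
have {}dC2 : C2 * d <= sg by rewrite mulrC -ler_pdivlMr // ltW.
have d0 : 0 <= d by exact: frob_norm_ge0.
pose x := d ^+ 2 / sg ^+ 2.
have x0 : 0 <= x by rewrite divr_ge0 ?sqr_ge0.
have x14 : x <= 1 / 4.
  by rewrite /x ler_pdivrMr //; have : (2 * d) ^+ 2 <= sg ^+ 2;
     [rewrite ler_sqr ?nnegrE //; lra | rewrite exprMn; lra].
pose q i := sqnorm (U i - V i *m (V i)^T *m U i).
have q0 i : 0 <= q i by exact: sqnorm_ge0.
have qfull i : ~~ (k i < n i)%N -> q i = 0.
  by move=> /(stiefel_square (VS i)) VV; rewrite /q VV mul1mx subrr /sqnorm mul0mx mxtrace0.
have qx i : q i <= x.
  have [kn|/qfull ->//] := boolP (k i < n i)%N.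
  have le : sg * Num.sqrt (q i) <= d.
    apply: le_trans (projection_defect_le S T0 (k0 i) US VS).
    by rewrite ler_wpM2r ?sqrtr_ge0 // sgS.
  rewrite /x ler_pdivlMr // mulrC -(sqr_sqrtr (q0 i)) -exprMn ler_sqr ?nnegrE //.
  by rewrite mulr_ge0 ?sqrtr_ge0 // ltW.
have q1 i : sqnorm (U i - V i *m (V i)^T *m U i) < 1.
  by apply: le_lt_trans (qx i) _; lra.
have pr i := principal_rotation (US i) (VS i) (q1 i).
have [P {}pr] := dependent_choice_fun pr.
have [W {}pr] := dependent_choice_fun pr.
have [th {}pr] := dependent_choice_fun pr.
have [Q {}pr] := dependent_choice_fun pr.
have rot i : rotating (U i) (P i) (W i) (th i) by case: (pr i).
have QQ i : Q i *m (Q i)^T = 1%:M by case: (pr i).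
have rotE i : rotated (U i) (P i) (W i) (th i) = V i *m Q i by case: (pr i).
have th0 i a : 0 <= th i a < pi / 2 by case: (pr i) => _ _ _ h _; exact: h.
have UVQ i : (U i)^T *m (V i *m Q i) = (P i)^T *m diag_mx (\row_a cos (th i a)) *m P i.
  by case: (pr i) => _ _ _ _ [].
have sumsin i : \sum_a sin (th i a) ^+ 2 = q i by case: (pr i) => _ _ _ _ [_ ->].
clear pr.
have PP i : P i *m (P i)^T = 1%:M by case: (rot i).
have QtQ i : (Q i)^T *m Q i = 1%:M by exact: mulmx1C.
pose V' i := V i *m Q i.
have V'S i : stiefel (V' i).
  by rewrite /stiefel /= /V' trmx_mul mulmxA -(mulmxA _ (V i)^T) VS mulmx1.
pose T := tucker (fun i => (Q i)^T) T0.
have VT : tucker V' T = tucker V T0.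
  rewrite /T tucker_comp; apply: eq_tucker => i.
  by rewrite /V' -mulmxA QQ mulmx1.
pose M i := (U i)^T *m V' i.
pose w := \sum_i q i.
have w0 : 0 <= w by exact: sumr_ge0.
have wx : w <= dR * x.
  apply: le_trans (_ : \sum_(i < D) x <= _); first exact: ler_sum.
  by rewrite sumr_const card_ord mulr_natl.
have cos01 i a : 0 <= cos (th i a) <= 1 by exact/cos_ge0_le1/th0.
have cosw : \sum_i \sum_a (1 - cos (th i a)) <= w.
  by apply: ler_sum => i _; rewrite -sumsin; apply: ler_sum => a _; exact/one_sub_cos_le/th0.
have TN : frob_norm T <= N + 1.
  rewrite -(tucker_stiefel_norm T V'S) VT.
  have -> : tucker V T0 = (tucker V T0 - tucker U S) + tucker U S by rewrite subrK.
  apply: le_trans (frob_norm_triangle _ _) _.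
  by rewrite (tucker_stiefel_norm _ US) -/d -/N addrC lerD2l ltW.
have near (c : forall i, 'rV[R]_(k i)) :
    (forall i a, cos (th i a) <= c i 0 a <= 1) ->
    frob_norm (T - tucker (fun i => (P i)^T *m diag_mx (c i) *m P i) T) <= w * (N + 1).
  move=> cc; apply: le_trans (tucker_near_identity T PP _) _.
    move=> i a; have /andP[h1 ->] := cc i a; rewrite andbT.
    by apply: le_trans h1; have /andP[] := cos01 i a.
  apply: ler_pM => //; last 1 first.
  - apply: le_trans cosw; apply: ler_sum => i _; apply: ler_sum => a _.
    by have /andP[h1 _] := cc i a; rewrite lerB.
  - apply: sumr_ge0 => i _; apply: sumr_ge0 => a _.
    by have /andP[_ h1] := cc i a; rewrite subr_ge0.
  - exact: frob_norm_ge0.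
pose e := frob_norm (T - tucker M T).
have ew : e <= w * (N + 1).
  rewrite /e (@eq_tucker _ _ _ _ M
    (fun i => (P i)^T *m diag_mx (\row_a cos (th i a)) *m P i)) //.
  by apply: near => i a; rewrite mxE lexx /=; case/andP: (cos01 i a).
(* the core seen by mode [i] once the other modes are projected to [U] *)
pose Tt i := tucker (mix i (fun j => 1%:M) M) T.
have Ttw i : frob_norm (T - Tt i) <= w * (N + 1).
  pose c j : 'rV[R]_(k j) := if j == i then const_mx 1 else \row_a cos (th j a).
  rewrite /Tt (@eq_tucker _ _ _ _ (mix i (fun j => 1%:M) M)
    (fun j => (P j)^T *m diag_mx (c j) *m P j)).
    apply: near => j a; rewrite /c; case: eqP => _; rewrite mxE ?lexx ?andbT /=.
      by case/andP: (cos01 j a).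
    by case/andP: (cos01 j a).
  move=> j; rewrite /mix /c; case: eqP => _; last exact: UVQ.
  by rewrite diag_const_mx mulmx1 (mulmx1C (PP j)).
pose b := frob_norm (tucker M T - S).
pose t := frob_norm (T - S).
have tbe : t <= b + e.
  rewrite /t /b /e [leRHS]addrC.
  have -> : T - S = (T - tucker M T) + (tucker M T - S) by rewrite addrA subrK.
  exact: frob_norm_triangle.
have b0 : 0 <= b by exact: frob_norm_ge0.
have t0 : 0 <= t by exact: frob_norm_ge0.
(* the part of the aligned frame outside the range of [U i] *)
pose Wt i := range_compl U i *m V' i.
have Wtq i : sqnorm (Wt i) = q i.
  have -> : Wt i = V' i - U i *m (U i)^T *m V' i.
    by rewrite /Wt /range_compl /range_proj mulmxBl mul1mx.
  rewrite sqnorm_gram projection_defect_gram // -sumsin -mulmxA [(U i)^T *m V' i]UVQ.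
  have -> : (V' i)^T *m U i = (P i)^T *m diag_mx (\row_a cos (th i a)) *m P i.
    have := congr1 trmx (UVQ i); rewrite -/(V' i) !trmx_mul !trmxK tr_diag_mx mulmxA.
    by [].
  rewrite -!mulmxA (mulmxA (P i) (P i)^T) PP mul1mx (mulmxA (diag_mx _)) mulmx_diag.
  rewrite linearB /= mxtrace1 mxtrace_mulC -mulmxA PP mulmx1 mxtrace_diag.
  have -> : (k i)%:R = \sum_(a < k i) (1 : R) by rewrite sumr_const card_ord.
  rewrite -sumrB; apply: eq_bigr => a _; rewrite !mxE sin2cos2; ring.
pose G := \sum_i frob_norm (tucker (mix i Wt U) (Tt i)) ^+ 2.
have bG : b ^+ 2 + G <= d ^+ 2.
  by have := tucker_pythagoras V' S T US; rewrite VT.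
have G0 : 0 <= G by apply: sumr_ge0 => i _; exact: sqr_ge0.
have bd : b <= d.
  by rewrite -ler_sqr ?nnegrE //; apply: le_trans bG; rewrite lerDl.
have d2 : d ^+ 2 <= d by rewrite expr2 -[leRHS]mulr1 ler_wpM2l // ltW.
have wC1 : w * (N + 1) <= C1 * d ^+ 2.
  have -> : C1 * d ^+ 2 = dR * x * (N + 1) by rewrite /C1 /x; field; rewrite gt_eqF.
  by rewrite ler_wpM2r // addr_ge0.
have C1d : C1 * d ^+ 2 <= C1 * d by rewrite ler_wpM2l.
have TtS i : frob_norm (S - Tt i) <= C2 * d.
  have -> : S - Tt i = (S - T) + (T - Tt i) by rewrite addrA subrK.
  apply: le_trans (frob_norm_triangle _ _) _; rewrite frob_norm_distC -/t /C2.
  have h := Ttw i; clear - h tbe ew wC1 C1d bd.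
  by lra.
have Glow : (sg - C2 * d) ^+ 2 * w <= G.
  rewrite mulr_sumr; apply: ler_sum => i _.
  have [kn|/qfull ->] := boolP (k i < n i)%N; last by rewrite mulr0 sqr_ge0.
  rewrite -(sqr_sqrtr (q0 i)) -exprMn ler_sqr ?nnegrE ?frob_norm_ge0 //; last first.
    by rewrite mulr_ge0 ?sqrtr_ge0 // subr_ge0.
  have -> : tucker (mix i Wt U) (Tt i) =
     tucker (mix i Wt U) S - tucker (mix i Wt U) (S - Tt i).
    by rewrite tuckerB opprB addrC subrK.
  apply: le_trans (frob_norm_reverse _ _).
  have h1 := mode_lower_bound Wt S US (k0 i); have h2 := mode_upper_bound i Wt (S - Tt i) US.
  rewrite Wtq in h1 h2; have s0 := sqrtr_ge0 (q i).
  have h3 : sg * Num.sqrt (q i) <= singval (k i) (flattening i S) * Num.sqrt (q i).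
    by rewrite ler_wpM2r // sgS.
  have h4 : Num.sqrt (q i) * frob_norm (S - Tt i) <= Num.sqrt (q i) * (C2 * d).
    by rewrite ler_wpM2l.
  rewrite mulrBl; clear - h1 h2 h3 h4; lra.
have thw : total_angle th <= w * (1 + 2 * x).
  rewrite /total_angle mulr_suml; apply: ler_sum => i _.
  rewrite -sumsin mulr_suml; apply: ler_sum => a _.
  apply: angle_sqr_le => //; first by rewrite x0.
  apply: le_trans (qx i); rewrite -sumsin [leRHS](bigD1 a) //= lerDl.
  by apply: sumr_ge0 => c _; exact: sqr_ge0.
have x2 : dR * x = dR / sg ^+ 2 * d ^+ 2 by rewrite /x; ring.
exists P, W, th, T; split => //.
- by rewrite (@eq_tucker _ _ _ _ _ V') // => i; rewrite rotE.
- apply: (@le_trans _ _ (2 * dR / sg ^+ 2 * d ^+ 2)); last first.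
    by rewrite ler_wpM2r ?sqr_ge0 //; clear - E00 C10; lra.
  have -> : 2 * dR / sg ^+ 2 * d ^+ 2 = dR * x * 2 by rewrite x2; ring.
  apply: le_trans thw _; apply: ler_pM => //; first by rewrite addr_ge0 // mulr_ge0.
  by clear - x14; lra.
- apply: (@le_trans _ _ ((1 + C1) * d)); last first.
    by rewrite ler_wpM2r //; clear - E00 F0; lra.
  by rewrite -/t mulrDl mul1r; clear - tbe ew wC1 C1d bd; lra.
move=> rho ka rhoka sgka; have ka0 : 0 <= ka by case/andP: rhoka; exact: le_trans.
have main : total_angle th + rho * t ^+ 2 <= ka * d ^+ 2 + (1 + ka) * E0 * d ^+ 3.
  by apply: (@upper_arith dR N sg d w b e t _ G C1 C2) => //; exact: ltW.
apply: le_trans main _; rewrite lerD2l ler_wpM2r ?exprn_ge0 // ler_wpM2l ?addr_ge0 //.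
by clear - F0 C10; lra.
Qed.

End UpperSection.

(** * Upper limits and neighbourhoods *)

Section LimsupBounds.
Local Open Scope classical_set_scope.
Local Open Scope ring_scope.
Context {R : realType}.

Lemma ediv_le (x y : \bar R) (a b : R) : (0 <= x)%E -> (x <= a%:E)%E ->
  0 < b -> (b%:E <= y)%E -> (x / y <= (a / b)%:E)%E.
Proof.
move=> x0 xa b0 yb; have -> : (a / b)%:E = (a%:E / b%:E)%E by rewrite inver gt_eqF.
have y0 : (0 <= y)%E by apply: le_trans yb; rewrite lee_fin ltW.
apply: lee_pmul => //; first by rewrite inve_ge0.
by rewrite lee_pV2 // inE // lee_fin ltW.
Qed.

Lemma ediv_ge (x y : \bar R) (a b : R) : 0 <= a -> (a%:E <= x)%E ->
  0 < b -> (0 <= y)%E -> (y <= b%:E)%E -> ((a / b)%:E <= x / y)%E.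
Proof.
move=> a0 xa b0 y0 yb; have -> : (a / b)%:E = (a%:E / b%:E)%E by rewrite inver gt_eqF.
apply: lee_pmul => //; first by rewrite inve_ge0 lee_fin ltW.
by rewrite lee_pV2 // inE // lee_fin ltW.
Qed.

Context {N : nat}.
Implicit Types (A : set 'rV[R]_N) (x : 'rV[R]_N).

Lemma frob_ball_nbhs x (r : R) : 0 < r -> nbhs x [set y | frob_norm (y - x) < r].
Proof.
move=> r0; apply/nbhs_ballP; exists (r / (N%:R + 1)) => /=.
  by rewrite divr_gt0 // ltr_wpDl // ler0n.
move=> y; rewrite -ball_normE /= => xy.
apply: le_lt_trans (frob_norm_le_mx _) _; rewrite -normrN opprB.
have n0 : 0 <= N%:R :> R by exact: ler0n.
rewrite ltr_pdivlMr in xy; last by lra.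
by apply: le_lt_trans xy; rewrite mulrC ler_wpM2l //; lra.
Qed.

Lemma nbhs_frob_ball x (O : set 'rV[R]_N) : nbhs x O ->
  exists2 r : R, 0 < r & forall y, frob_norm (y - x) < r -> O y.
Proof.
move=> /nbhs_ballP[r /= r0 rO]; exists r => // y yr; apply: rO.
rewrite -ball_normE /= -normrN opprB.
exact: le_lt_trans (mx_norm_le_frob _) yr.
Qed.

Lemma limf_esup_le (f : 'rV[R]_N -> \bar R) A x0 (v : R) :
  (forall e : R, 0 < e -> exists2 r : R, 0 < r & forall x, A x -> x != x0 ->
     frob_norm (x - x0) < r -> (f x <= (v + e)%:E)%E) ->
  (limf_esup f (within A x0^') <= v%:E)%E.
Proof.
move=> H; apply/lee_addgt0Pr => e e0; rewrite -EFinD.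
have [r r0 Hr] := H e e0.
pose B := [set x | A x /\ x != x0 /\ frob_norm (x - x0) < r].
apply: le_trans (_ : ereal_sup [set f x | x in B] <= _)%E.
  apply: ereal_inf_lbound; exists B => //.
  rewrite /within /= /dnbhs /within /=.
  apply: filterS (frob_ball_nbhs x0 r0) => y /= yr y0 Ay.
  by split.
by apply: ge_ereal_sup => _ [x [Ax [xn xr]] <-]; exact: Hr.
Qed.

Lemma le_limf_esup (f : 'rV[R]_N -> \bar R) A x0 (v : \bar R) :
  (forall r : R, 0 < r -> exists x, [/\ A x, x != x0, frob_norm (x - x0) < r &
      (v <= f x)%E]) ->
  (v <= limf_esup f (within A x0^'))%E.
Proof.
move=> H; apply: le_ereal_inf_tmp => _ [B FB <-].
have [r r0 rB] := nbhs_frob_ball FB.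
have [x [Ax xn xr vf]] := H r r0.
by apply: le_trans vf _; apply: ereal_sup_ubound; exists x => //; exact: rB.
Qed.

End LimsupBounds.

Section ProductNeighbourhood.
Local Open Scope classical_set_scope.
Local Open Scope ring_scope.
Context {R : realType}.

Lemma nbhs_frob_prod N M (x : 'rV[R]_N * 'rV[R]_M) (O : set ('rV[R]_N * 'rV[R]_M)) :
  nbhs x O -> exists2 r : R, 0 < r & forall y, frob_norm (y.1 - x.1) < r ->
    frob_norm (y.2 - x.2) < r -> O y.
Proof.
move=> /nbhs_ballP[r /= r0 rO]; exists r => // y y1 y2; apply: rO.
split; rewrite -ball_normE /= -normrN opprB.
  exact: le_lt_trans (mx_norm_le_frob _) y1.
exact: le_lt_trans (mx_norm_le_frob _) y2.
Qed.

End ProductNeighbourhood.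

Section Domain.
Local Open Scope classical_set_scope.
Local Open Scope ring_scope.
Context {R : realType} {D : nat} {n k : 'I_D -> nat}.
Local Notation factor := Defs.factor.

Lemma flattening_rows_mul m i (B : 'M[R]_(m, k i)) (T : tensor R k) :
  sqnorm (B *m flattening i T) <= sqnorm B * frob_norm T ^+ 2.
Proof. by rewrite frob_norm_sqr -(sqnorm_flattening i); exact: sqnorm_mulmx_le. Qed.

Lemma flatteningB i (S T : tensor R k) :
  flattening i (S - T) = flattening i S - flattening i T.
Proof.
apply/matrixP => a b; rewrite !mxE -sumrB; apply: eq_bigr => J _.
by rewrite entryD entryN.
Qed.

(** A row vector killed by the flattening of [T] is mapped by the flattening of
    [S] to its image under the flattening of [S - T], which is too short. *)
Lemma full_multilinear_rank_near (S T : tensor R k) :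
  (forall i, 0 < k i)%N ->
  (forall i, frob_norm (T - S) < singval (k i) (flattening i S)) ->
  full_multilinear_rank T.
Proof.
move=> k0 TS i; apply/eqP; rewrite -/(row_free _) -kermx_eq0.
apply/eqP; set K := kermx _.
have KT : K *m flattening i T = 0 by exact: mulmx_ker.
have le1 := singval_lower_bound (flattening i S) K (k0 i).
have le2 := flattening_rows_mul K (S - T).
rewrite flatteningB mulmxBr KT subr0 frob_norm_distC in le2.
apply: sqnorm_eq0; apply/eqP; rewrite eq_le sqnorm_ge0 andbT leNgt; apply/negP => Kpos.
have := le_trans le1 le2; rewrite mulrC ler_pM2l // leNgt => /negP; apply.
by rewrite ltr_sqr ?nnegrE ?frob_norm_ge0 ?sqrtr_ge0.
Qed.

(** The chord of the frame curve is at most its length. *)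
Lemma rotated_dist (U W : forall i, 'M[R]_(n i, k i)) (P : forall i, 'M[R]_(k i))
    (th : forall i : 'I_D, 'I_(k i) -> R) :
  (forall i, rotating (U i) (P i) (W i) (th i)) ->
  frob_norm (mk_factors (fun i => rotated (U i) (P i) (W i) (th i)) - mk_factors U)
    <= Num.sqrt (total_angle th).
Proof.
move=> rot; rewrite -lee_fin.
have t0 : 0 <= total_angle th.
  by apply: sumr_ge0 => i _; apply: sumr_ge0 => a _; exact: sqr_ge0.
have := @frame_geodist _ _ _ _ U W P th 0 0 abs_metric setT (Num.sqrt (total_angle th)) rot.
move=> /(_ (fun _ _ => I) (sqrtr_ge0 _)) H.
apply: le_trans (H _); last first.
  move=> s _; rewrite sqr_sqrtr // /abs_metric subr0 frob_dot0r addr0 //.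
apply: geodist_ge => c /C1_curvesP[C c0 c1 _].
have := length_ge_chord (g := prod_metric abs_metric abs_metric) (c := c) (C1_fst C).
rewrite c0 c1 /=; apply => s _; rewrite ler_sqrt; last first.
  by rewrite addr_ge0 ?frob_dot_ge0.
by rewrite lerDl frob_dot_ge0.
Qed.

End Domain.

(** * Rotating one principal direction *)

Section SphereBound.
Local Open Scope classical_set_scope.
Local Open Scope ring_scope.
Context {R : realType} {D : nat} {n k : 'I_D -> nat}.
Local Notation factor := Defs.factor.

Lemma sin_le_id (x : R) : 0 <= x -> sin x <= x.
Proof.
move=> x0; have [|c _] := @MVT_segment R sin cos 0 x x0.
  by apply: continuous_subspaceT => t; exact: continuous_sin.
by rewrite sin0 !subr0 => ->; rewrite -[leRHS]mul1r ler_wpM2r // cos_le1.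
Qed.

(** The defect that [projection_defect_le] bounds is zero here. *)
Lemma same_range (U V : forall i, 'M[R]_(n i, k i)) (S T : tensor R k) i :
  (0 < k i)%N -> (forall j, stiefel (U j)) -> (forall j, stiefel (V j)) ->
  0 < singval (k i) (flattening i S) -> tucker V T = tucker U S ->
  U i = V i *m (V i)^T *m U i.
Proof.
move=> k0 US VS s0 VU; have := projection_defect_le S T k0 US VS.
rewrite VU subrr frob_norm0 pmulr_rle0 // => le0.
apply/eqP; rewrite -subr_eq0; apply/eqP; apply: sqnorm_eq0.
by apply/eqP; rewrite eq_le sqnorm_ge0 andbT -sqrtr_eq0 eq_le sqrtr_ge0 le0.
Qed.

(** The image of [r] under the [i]-th factor moves on the unit sphere, no faster
    than the factor itself. *)
Lemma geodist_ge_angle (gS : tensor R k -> tensor R k -> tensor R k -> R)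
    (M : set (factors R n k * tensor R k)) y0 y1 i (w : 'rV[R]_(n i)) (r : 'cV[R]_(k i)) t :
  (forall p u, 0 <= gS p u u) -> (forall y, M y -> stiefel (factor y.1 i)) ->
  frob_dot w w = 1 -> r^T *m r = 1%:M -> w *m factor y0.1 i = 0 ->
  (w *m (factor y1.1 i *m r)) 0 0 = sin t -> 0 < t < pi / 2 ->
  (t%:E <= geodist (prod_metric abs_metric gS) M y0 y1)%E.
Proof.
move=> gS0 MS w1 rr wy0 wy1 t0; apply: geodist_ge => c /C1_curvesP[C c0 c1 cM].
pose p s : 'rV[R]_(n i) := (factor (c s).1 i *m r)^T.
pose dp s : 'rV[R]_(n i) := (factor (derive1 c s).1 i *m r)^T.
have P : C1_with p dp.
  apply: C1_rV => x; rewrite /p /dp; under eq_fun do rewrite !mxE.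
  under [X in C1_with _ X]eq_fun do rewrite !mxE.
  apply: C1_sum => b; under eq_fun do rewrite mxE.
  under [X in C1_with _ X]eq_fun do rewrite mxE.
  have := C1_mul (C1_coord (enum_rank (Tagged (fun i => ('I_(n i) * 'I_(k i))%type) (x, b)))
     (C1_fst C)) (C1_cst (r b 0)).
  by congr C1_with; apply/funext => s /=; rewrite mulr0 addr0.
have wp s : frob_dot w (p s) = (w *m (factor (c s).1 i *m r)) 0 0.
  by rewrite frob_dot_mx /p trmxK.
apply: (length_ge_sphere P _ w1 _ _ t0).
- move=> s s01; rewrite frob_dot_mx /p trmxK trmx_mul mulmxA -(mulmxA r^T).
  by rewrite (MS _ (cM s s01)) mulmx1 rr mxE.
- by rewrite wp c0 mulmxA wy0 mul0mx mxE.
- by rewrite wp c1.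
move=> s s01; rewrite /frob_norm ler_sqrt; last by rewrite addr_ge0 ?frob_dot_ge0.
apply: (@le_trans _ _ (frob_dot (derive1 c s).1 (derive1 c s).1)); last by rewrite lerDl.
rewrite frob_dot_factors_sqnorm (bigD1 i) //=.
have -> : frob_dot (dp s) (dp s) = sqnorm (factor (derive1 c s).1 i *m r).
  by rewrite frob_dot_mx /dp trmxK sqnorm_gram mxE /mxtrace big_ord1 mxE.
apply: (@le_trans _ _ (sqnorm (factor (derive1 c s).1 i))).
  apply: le_trans (sqnorm_mulmx_le _ _) _.
  by rewrite [sqnorm r]sqnorm_gram rr mxtrace1 mulr1.
by rewrite lerDl; apply: sumr_ge0 => j _; exact: sqnorm_ge0.
Qed.

Lemma orthogonal_unit m p (U : 'M[R]_(m, p)) : (p < m)%N ->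
  exists w : 'rV[R]_m, frob_dot w w = 1 /\ w *m U = 0.
Proof.
move=> pm; have : kermx U != 0.
  by rewrite kermx_eq0 /row_free neq_ltn (leq_ltn_trans (rank_leq_col U) pm).
case/rowV0Pn => v vU v0; have {}vU : v *m U = 0 by apply/sub_kermxP.
exists ((frob_norm v)^-1 *: v); split; last by rewrite -scalemxAl vU scaler0.
rewrite !frob_dotE -frob_norm_sqr; field.
by rewrite frob_norm_eq0.
Qed.

End SphereBound.

Section ReversedAngles.
Local Open Scope ring_scope.
Context {R : realType}.

Lemma C1_cos_rev (t : R) : C1_with (fun s => cos (t - s * t)) (fun s => t * sin (t - s * t)).
Proof.
have := C1_add (C1_mul (C1_cst (cos t)) (C1_cos t)) (C1_mul (C1_cst (sin t)) (C1_sin t)).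
by congr C1_with; apply/funext => s /=; rewrite ?cosB ?sinB; ring.
Qed.

Lemma C1_sin_rev (t : R) : C1_with (fun s => sin (t - s * t)) (fun s => - t * cos (t - s * t)).
Proof.
have := C1_add (C1_mul (C1_cst (sin t)) (C1_cos t)) (C1_mul (C1_cst (- cos t)) (C1_sin t)).
by congr C1_with; apply/funext => s /=; rewrite ?cosB ?sinB; ring.
Qed.

End ReversedAngles.

Section Combine.
Local Open Scope ring_scope.
Context {R : realType} {n k : nat}.
Implicit Types (U W : 'M[R]_(n, k)) (P : 'M[R]_k).

Lemma combineD U P W al be al' be' :
  combine U P W (al + al') (be + be') = combine U P W al be + combine U P W al' be'.
Proof.
apply/matrixP => x y; rewrite [RHS]mxE !combineE -big_split /=.
by apply: eq_bigr => a _; rewrite !mxE; ring.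
Qed.

Lemma combineZ U P W c al be :
  combine U P W (c *: al) (c *: be) = c *: combine U P W al be.
Proof.
apply/matrixP => x y; rewrite [RHS]mxE !combineE mulr_sumr.
by apply: eq_bigr => a _; rewrite !mxE; ring.
Qed.

Lemma combine_cst U P W : P *m P^T = 1%:M -> combine U P W (const_mx 1) 0 = U.
Proof.
move=> PP; rewrite /combine diag_const_mx linear0 mulmx0 addr0 mulmx1 -mulmxA.
by rewrite (mulmx1C PP) mulmx1.
Qed.

End Combine.

Section Rotation.
Local Open Scope classical_set_scope.
Local Open Scope ring_scope.
Context {R : realType} {D : nat} {n k : 'I_D -> nat}.
Variables (U : forall i, 'M[R]_(n i, k i)) (S : tensor R k).
Hypotheses (k0 : forall i, (0 < k i)%N) (US : forall i, stiefel (U i)).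

(** A family of decompositions whose [i]-th factor turns the principal direction
    of the smallest singular value of the [i]-th flattening out of the range
    of [U i]. *)
Lemma rotation_family i : (k i < n i)%N ->
  exists (P : forall j, 'M[R]_(k j)) (W : forall j, 'M[R]_(n j, k j))
    (th : R -> forall j : 'I_D, 'I_(k j) -> R) (B C : tensor R n)
    (w : 'rV[R]_(n i)) (p : 'cV[R]_(k i)),
  [/\ forall t j, rotating (U j) (P j) (W j) (th t j),
      forall t, total_angle (th t) = t ^+ 2,
      (forall t, tucker (fun j => rotated (U j) (P j) (W j) (th t j)) S =
        tucker U S - B + cos t *: B + sin t *: C) /\
      (forall u v, frob_dot (u *: B + v *: C) (u *: B + v *: C) =
        (u ^+ 2 + v ^+ 2) * singval (k i) (flattening i S) ^+ 2),
      frob_dot w w = 1 /\ w *m U i = 0 &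
      p^T *m p = 1%:M /\ forall t,
        (w *m (rotated (U i) (P i) (W i) (th t i) *m p)) 0 0 = sin t].
Proof.
move=> kn; set sg := singval _ _.
have pr j := singval_spec (flattening j S) (k0 j).
have [P {}pr] := dependent_choice_fun pr.
have [d {}pr] := dependent_choice_fun pr.
have [a {}pr] := dependent_choice_fun pr.
have PP j : P j *m (P j)^T = 1%:M by case: (pr j).
have Pd : P i *m (flattening i S *m (flattening i S)^T) *m (P i)^T = diag_mx (d i).
  by case: (pr i).
have da : d i 0 (a i) = sg ^+ 2 by case: (pr i).
clear pr.
have wex j : exists w : 'rV[R]_(n j), (k j < n j)%N -> frob_dot w w = 1 /\ w *m U j = 0.
  have [/(orthogonal_unit (U j))[w wP]|_] := boolP (k j < n j)%N; first by exists w.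
  by exists 0.
have [w wP] := dependent_choice_fun wex.
have [w1 wU] := wP i kn.
(* the coordinate of the smallest eigenvalue *)
pose dl j : 'rV[R]_(k j) := delta_mx 0 (a j).
pose W j : 'M[R]_(n j, k j) := if j == i then (w j)^T *m dl j else 0.
pose th (t : R) j (b : 'I_(k j)) : R := if (j == i) && (b == a j) then t else 0.
have Wi : W i = (w i)^T *m dl i by rewrite /W eqxx.
have ww : w i *m (w i)^T = 1%:M by apply/matrixP => x y; rewrite !ord1 -frob_dot_mx w1 mxE.
have dlT : (dl i)^T *m dl i = diag_mx (dl i).
  rewrite /dl trmx_delta mul_delta_mx; apply/matrixP => x y; rewrite !mxE eqxx /=.
  have [<-|xy] := eqVneq x y; first by rewrite andbb.
  rewrite mulr0n; case: (eqVneq x (a i)) => [xa|//]; case: (eqVneq y (a i)) => [ya|//].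
  by rewrite xa ya eqxx in xy.
have WW : (W i)^T *m W i = diag_mx (dl i).
  by rewrite Wi trmx_mul trmxK mulmxA -(mulmxA _ (w i)) ww mulmx1 dlT.
have WU : (W i)^T *m U i = 0 by rewrite Wi trmx_mul trmxK -mulmxA wU mulmx0.
have rot t j : rotating (U j) (P j) (W j) (th t j).
  have [->|ji] := eqVneq j i.
    split => //; exists (dl i); split => // b; rewrite /th eqxx /= mxE eqxx /=.
    by case: eqP; [left|right].
  rewrite /W (negPf ji); split; rewrite ?trmx0 ?mul0mx //.
  exists 0; split; first by rewrite linear0.
  by move=> b; right; rewrite /th (negPf ji).
have tot t : total_angle (th t) = t ^+ 2.
  rewrite /total_angle (bigD1 i) //= [X in _ + X]big1 ?addr0; last first.
    by move=> j ji; rewrite big1 // => b _; rewrite /th (negPf ji) expr0n.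
  rewrite (bigD1 (a i)) //= /th !eqxx /= big1 ?addr0 // => b /negPf ->.
  by rewrite expr0n.
pose Z u v := tucker (mix i (fun j => combine (U j) (P j) (W j) (u *: dl j) (v *: dl j)) U) S.
have ZE u v : Z u v = u *: Z 1 0 + v *: Z 0 1.
  rewrite /Z -!tucker_mixZ -tucker_mixD; apply: eq_tucker => j.
  rewrite /mix; case: eqP => // _; rewrite -!combineZ -combineD.
  by congr combine; rewrite !scalerA -scalerDl ?mulr1 ?mulr0 ?addr0 ?add0r.
have Znorm u v : frob_dot (Z u v) (Z u v) = (u ^+ 2 + v ^+ 2) * sg ^+ 2.
  rewrite -frob_norm_sqr sqnorm_mix // sqnorm_gram trmx_mul mulmxA.
  rewrite -(mulmxA (flattening i S)^T).
  rewrite (combine_gram _ _ (US i) (PP i) WU WW).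
  have -> : \row_b ((u *: dl i) 0 b ^+ 2 + (v *: dl i) 0 b ^+ 2 * dl i 0 b) =
      (u ^+ 2 + v ^+ 2) *: dl i.
    by apply/rowP => b; rewrite !mxE eqxx /=; case: (b == a i); rewrite /=; ring.
  rewrite mxtrace_mulC !mulmxA mxtrace_mulC !mulmxA -(mulmxA (P i)) Pd.
  rewrite mulmx_diag mxtrace_diag (bigD1 (a i)) //= big1 => [|b ba]; last first.
    by rewrite !mxE (negPf ba) andbF !mulr0.
  by rewrite !mxE !eqxx addr0 da /=; ring.
exists P, W, th, (Z 1 0), (Z 0 1), (w i), (row (a i) (P i))^T; split => //.
- split=> [t|u v]; last by rewrite -ZE Znorm.
  have -> : tucker (fun j => rotated (U j) (P j) (W j) (th t j)) S =
      tucker U S + Z (cos t - 1) (sin t).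
    have -> : tucker U S = tucker (mix i U U) S.
      by apply: eq_tucker => j; rewrite /mix; case: eqP.
    rewrite /Z -tucker_mixD; apply: eq_tucker => j; rewrite /mix.
    have [->|ji] := eqVneq j i; last first.
      rewrite -[RHS](rotated0 _ (W j) (PP j)); congr rotated.
      by apply/funext => b; rewrite /th (negPf ji).
    rewrite -{2}(combine_cst (U i) (W i) (PP i)) -combineD /rotated.
    congr combine; apply/rowP => b; rewrite !mxE /th !eqxx /=.
      by case: (b == a i); rewrite /= ?cos0; ring.
    by case: (b == a i); rewrite /= ?sin0; ring.
  by rewrite ZE scalerBl scale1r !addrA; congr (_ + _); rewrite addrAC.
- split; first by apply/matrixP => x y; rewrite !ord1 trmxK -frob_dot_mx
    -[row _ _]mulmx1 frob_dot_row_gram trmx1 !mulmx1 PP !mxE !eqxx.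
  move=> t; rewrite /rotated /combine -mulmxA.
  have -> : P i *m (row (a i) (P i))^T = (dl i)^T.
    by rewrite -[LHS]trmxK trmx_mul trmxK -row_mul PP rowE mulmx1.
  rewrite mulmxA mulmxDr mulmxDl !mulmxA wU !mul0mx add0r Wi mulmxA ww mul1mx.
  rewrite mul_mx_diag mxE (bigD1 (a i)) //= big1 ?addr0 => [|b ba].
    by rewrite !mxE /th !eqxx /= mul1r mulr1.
  by rewrite !mxE (negPf ba) mul0r mul0r.
Qed.

End Rotation.

(** * Bounds on the latent condition number *)

Section GeneralMetrics.
Local Open Scope classical_set_scope.
Local Open Scope ring_scope.
Context {R : realType} {D : nat} {n k : 'I_D -> nat}.
Variables (gX : tensor R n -> tensor R n -> tensor R n -> R)
          (gS : tensor R k -> tensor R k -> tensor R k -> R).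
Variables (U : forall i, 'M[R]_(n i, k i)) (S : tensor R k).
Hypotheses (k0 : forall i, (0 < k i)%N) (US : forall i, stiefel (U i))
           (Sfull : full_multilinear_rank S).
Variable O : set (factors R n k * tensor R k).
Hypotheses (Oopen : open O) (Oy0 : O (mk_factors U, S)).
Hypothesis gS_ge0 : forall p u, 0 <= gS p u u.
Hypothesis gS0 : forall p, gS p 0 0 = 0.
Local Notation factor := Defs.factor.
Local Notation y0 := (mk_factors U, S).
Local Notation x0 := (tucker U S).
Local Notation gY := (prod_metric abs_metric gS).
Local Notation Yhat := (tucker_domain R n k `&` O).
Local Notation G := (@tucker_map R D n k).
Local Notation A := (G @` Yhat).
Local Notation F := (fun (x : tensor R n) (y : factors R n k * tensor R k) => G y - x).

Hypothesis separated : forall y, Yhat y -> G y = x0 -> geodist gY Yhat y0 y = 0%E -> y = y0.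

Lemma tucker_map_mk_factors (V : forall i, 'M[R]_(n i, k i)) (T : tensor R k) :
  G (mk_factors V, T) = tucker V T.
Proof. by apply: eq_tucker => i; rewrite /= mk_factorsK. Qed.

Lemma Yhat_y0 : Yhat y0.
Proof. by split => //; split => // i; rewrite /= mk_factorsK. Qed.

Lemma domain_near : exists2 r : R, 0 < r &
  forall V T, (forall i, stiefel (V i)) ->
    frob_norm (mk_factors V - mk_factors U) < r -> frob_norm (T - S) < r ->
    Yhat (mk_factors V, T).
Proof.
have [r r0 rO] := nbhs_frob_prod (open_nbhs_nbhs (conj Oopen Oy0)).
have s0 i : 0 < singval (k i) (flattening i S) by exact: singval_gt0.
exists (\big[Num.min/r]_i singval (k i) (flattening i S)).
  by elim/big_ind: _ => // a b a0 b0; rewrite lt_min a0.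
move=> V T VS Vr Tr; split; last first.
  apply: rO; [apply: lt_le_trans Vr _|apply: lt_le_trans Tr _];
    exact: bigmin_le_id.
split=> [i|]; first by rewrite /= mk_factorsK.
apply: (full_multilinear_rank_near k0) => i; apply: lt_le_trans Tr _.
exact: bigmin_le.
Qed.

Lemma geodist_y0 : geodist gY Yhat y0 y0 = 0%E.
Proof.
apply/eqP; rewrite eq_le geodist_ge0 andbT.
pose c : R -> factors R n k * tensor R k := cst y0.
have C : C1_with c (cst 0) by exact: C1_cst.
apply: geodist_le (C1_curves_with C (fun _ _ => Yhat_y0)) _.
apply: curve_length_le => t _; rewrite (derive1_C1 C) /prod_metric /=.
by rewrite gS0 addr0 /abs_metric frob_dot0r sqrtr0.
Qed.

Lemma nearest_x0 : nearest_solution gY Yhat F 0%R y0 x0 = y0.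
Proof.
have y0s : nearest_solutions gY Yhat F 0%R y0 x0 y0.
  split; [exact: Yhat_y0|by rewrite tucker_map_mk_factors subrr|move=> y' _ _].
  by rewrite geodist_y0 geodist_ge0.
have := xgetI y0 y0s; rewrite -/(nearest_solution _ _ _ _ _ _).
set y := nearest_solution _ _ _ _ _ _ => -[Yy Fy ymin].
apply: separated => //; first by apply/eqP; rewrite -subr_eq0 Fy.
apply/eqP; rewrite eq_le geodist_ge0 andbT -geodist_y0.
by apply: ymin; [exact: Yhat_y0|rewrite tucker_map_mk_factors subrr].
Qed.

(** Without a minimiser [nearest_solution] is [y0], at distance zero, so the
    bound does not depend on the existence of minimisers. *)
Lemma nearest_le x y K : Yhat y -> G y = x -> (0 <= K)%E ->
  (geodist gY Yhat y0 y <= K)%E ->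
  (geodist gY Yhat y0 (nearest_solution gY Yhat F 0%R y0 x) <= K)%E.
Proof.
move=> Yy Gy K0 yK; rewrite /nearest_solution.
case: xgetP => [z _ [_ _ zmin]|_]; last by rewrite geodist_y0.
by apply: le_trans yK; apply: zmin => //; rewrite Gy subrr.
Qed.

(** A solution that attains a lower bound for all solutions is a minimiser, so
    [nearest_solution] is a solution. *)
Lemma nearest_ge x y K : Yhat y -> G y = x ->
  (geodist gY Yhat y0 y <= K)%E ->
  (forall z, Yhat z -> G z = x -> (K <= geodist gY Yhat y0 z)%E) ->
  (K <= geodist gY Yhat y0 (nearest_solution gY Yhat F 0%R y0 x))%E.
Proof.
move=> Yy Gy yK zK.
have ys : nearest_solutions gY Yhat F 0%R y0 x y.
  split => //; first by rewrite Gy subrr.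
  move=> z Yz Fz; apply: le_trans yK _; apply: zK => //.
  by apply/eqP; rewrite -subr_eq0 Fz.
have [Yz Fz _] := xgetI y0 ys.
by apply: zK => //; apply/eqP; rewrite -subr_eq0 Fz.
Qed.

(** The decomposition of [upper_section] bounds the numerator from above, and the
    assumption on [gX] bounds the denominator from below. *)
Lemma latent_cond_le (rho ka m sg : R) :
  0 <= rho <= ka -> 0 < m -> 0 < sg -> 1 / sg ^+ 2 <= ka ->
  (forall i, (k i < n i)%N -> sg <= singval (k i) (flattening i S)) ->
  (forall e : R, 0 < e -> exists2 r : R, 0 < r & forall p u,
     frob_norm (p - S) < r -> gS p u u <= (rho + e) * frob_norm u ^+ 2) ->
  (forall a : R, 0 <= a < m -> exists2 r : R, 0 < r & forall x, A x ->
     frob_norm (x - x0) < r -> ((a * frob_norm (x - x0))%:E <= geodist gX A x x0)%E) ->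
  (latent_cond gX gY A Yhat F 0%R x0 y0 <= (Num.sqrt ka / m)%:E)%E.
Proof.
move=> rhoka m0 sg0 sgka sgS gSnear gXnear.
have ka0 : 0 <= ka by case/andP: rhoka; exact: le_trans.
have [C [d0 [C0 d00 up]]] := upper_section k0 US sg0 sgS.
have [r r0 rdom] := domain_near.
apply: limf_esup_le => e e0; rewrite nearest_x0.
set v := Num.sqrt ka / m.
have v0 : 0 <= v by rewrite divr_ge0 ?sqrtr_ge0 // ltW.
have ve : 0 < v + e by rewrite ltr_wpDl.
(* chosen such that [K ^+ 2 > ka], [a < m] and [K / a = v + e] *)
pose K := m * (v + e / 2); pose a := K / (v + e).
have K0 : 0 < K by rewrite mulr_gt0 // ltr_wpDl // divr_gt0.
have a0 : 0 < a by exact: divr_gt0.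
have am : a < m by rewrite /a /K ltr_pdivrMr // ltr_pM2l // ltrD2l; lra.
have Kka : ka < K ^+ 2.
  rewrite -(sqr_sqrtr ka0) ltr_sqr ?nnegrE ?sqrtr_ge0 ?ltW //.
  rewrite /K mulrDr; have -> : m * v = Num.sqrt ka by rewrite /v mulrCA divff ?mulr1 ?gt_eqF.
  by rewrite ltrDl mulr_gt0 // divr_gt0.
pose ga := K ^+ 2 - ka.
have ga0 : 0 < ga by rewrite subr_gt0.
have C1 : 0 < C + 1 by rewrite ltr_wpDl.
have CC1 : C <= C + 1 by rewrite lerDl.
have kC0 : 0 <= (1 + ka) * C by rewrite mulr_ge0 // addr_ge0.
have kC1 : 0 < (1 + ka) * C + 1 by rewrite ltr_wpDl.
pose e' := ga / (2 * (C + 1) ^+ 2).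
have e'0 : 0 < e' by rewrite divr_gt0 // mulr_gt0 // exprn_gt0.
have [r1 r10 gSr] := gSnear e' e'0.
have am' : 0 <= a < m by rewrite ltW.
have [r2 r20 gXr] := gXnear a am'.
pose rr := Num.min r r1.
have rr0 : 0 < rr by rewrite lt_min r0.
pose d1 := rr / (C + 1); pose d2 := ga / (2 * ((1 + ka) * C + 1)).
have D0 : 0 < 2 * ((1 + ka) * C + 1) by rewrite mulr_gt0.
exists (Num.min (Num.min d0 r2) (Num.min d1 d2)).
  by rewrite !lt_min d00 r20 /= !divr_gt0.
move=> x [y [[yst yfull] yO] Gyx] xn; rewrite !lt_min => /andP[/andP[xd0 xr2] /andP[xd1 xd2]].
have Ax : A x by exists y.
set d := frob_norm (x - x0) in xd0 xr2 xd1 xd2.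
have dpos : 0 < d by rewrite frob_norm_gt0 subr_eq0.
have dge0 : 0 <= d by exact: ltW.
have Gy : tucker (factor y.1) y.2 = x by rewrite -Gyx.
have := up (factor y.1) y.2 yst; rewrite Gy -/d => /(_ xd0).
move=> [P [W [th [T [rot TE thC TC ineq]]]]].
have d1C : (C + 1) * d < rr by rewrite mulrC -ltr_pdivlMr.
have Cd0 : 0 <= (C + 1) * d by rewrite mulr_ge0 // ltW.
have th0 : 0 <= total_angle th.
  by apply: sumr_ge0 => i _; apply: sumr_ge0 => b _; exact: sqr_ge0.
have sqC : Num.sqrt (total_angle th) < rr.
  apply: le_lt_trans d1C; rewrite -(ger0_norm Cd0) -sqrtr_sqr ler_sqrt ?sqr_ge0 //.
  apply: le_trans thC _; rewrite exprMn ler_wpM2r ?sqr_ge0 //.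
  apply: le_trans CC1 _; rewrite expr2 -[leLHS]mul1r ler_wpM2r ?(ltW C1) //.
  by rewrite lerDr.
have TSr : frob_norm (T - S) < rr.
  by apply: le_lt_trans d1C; apply: le_trans TC _; rewrite ler_wpM2r.
have near_curve s : s \in `[0, 1] -> Yhat (frame_curve U W P th S T s).
  rewrite in_itv /= => /andP[s0 s1].
  have rots i := rotating_scale s (rot i).
  apply: rdom; first by move=> i; exact: rotated_stiefel.
    apply: le_lt_trans (rotated_dist rots) _.
    apply: le_lt_trans (_ : Num.sqrt (total_angle th) < _); last first.
      by apply: lt_le_trans sqC _; rewrite ge_min lexx.
    rewrite ler_sqrt //; apply: ler_sum => i _; apply: ler_sum => b _.
    by rewrite exprMn -[leRHS]mul1r ler_wpM2r ?sqr_ge0 // expr_le1.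
  rewrite addrC addKr frob_normZ ger0_norm //.
  apply: le_lt_trans (_ : frob_norm (T - S) < _).
    by rewrite -[leRHS]mul1r ler_wpM2r ?frob_norm_ge0.
  by apply: lt_le_trans TSr _; rewrite ge_min lexx.
set y1 := (mk_factors (fun i => rotated (U i) (P i) (W i) (th i)), T).
have Yy1 : Yhat y1.
  have <- : frame_curve U W P th S T 1 = y1.
    rewrite /frame_curve scale1r addrC subrK; congr pair.
    by apply: eq_mk_factors => i; congr rotated; apply/funext => b; rewrite mul1r.
  by apply: near_curve; rewrite in_itv /= lexx ler01.
have Gy1 : G y1 = x by rewrite tucker_map_mk_factors.
have dist1 : (geodist gY Yhat y0 y1 <= (K * d)%:E)%E.
  apply: (frame_geodist rot near_curve).
    by rewrite mulr_ge0 // ltW.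
  move=> s; rewrite in_itv /= => /andP[s0 s1].
  have gle : gS (S + s *: (T - S)) (T - S) (T - S) <= (rho + e') * frob_norm (T - S) ^+ 2.
    apply: gSr; rewrite addrC addKr frob_normZ ger0_norm //.
    apply: le_lt_trans (_ : frob_norm (T - S) < _).
      by rewrite -[leRHS]mul1r ler_wpM2r ?frob_norm_ge0.
    by apply: lt_le_trans TSr _; rewrite ge_min lexx orbT.
  have h1 := ineq rho ka rhoka sgka.
  have h2 : (1 + ka) * C * d ^+ 3 <= ga / 2 * d ^+ 2.
    rewrite exprS mulrA ler_wpM2r ?sqr_ge0 //.
    apply: (@le_trans _ _ (((1 + ka) * C + 1) * d)); first by rewrite ler_wpM2r // lerDl.
    have -> : ga / 2 = ((1 + ka) * C + 1) * d2 by rewrite /d2; field; rewrite gt_eqF.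
    by apply: ler_wpM2l; exact: ltW.
  have h3 : e' * frob_norm (T - S) ^+ 2 <= ga / 2 * d ^+ 2.
    have -> : ga / 2 * d ^+ 2 = e' * ((C + 1) * d) ^+ 2.
      by rewrite /e'; field; rewrite gt_eqF.
    apply: ler_wpM2l; first exact: ltW.
    rewrite ler_sqr ?nnegrE ?frob_norm_ge0 //.
    by apply: le_trans TC _; rewrite ler_wpM2r.
  have -> : (K * d) ^+ 2 = ka * d ^+ 2 + ga / 2 * d ^+ 2 + ga / 2 * d ^+ 2.
    by rewrite exprMn /ga; field.
  rewrite -/(total_angle th).
  apply: le_trans (_ : total_angle th + (rho + e') * frob_norm (T - S) ^+ 2 <= _).
    by rewrite lerD2l.
  by rewrite mulrDl addrA; apply: lerD h3; apply: le_trans h1 _; rewrite lerD2l.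
have Kd0 : (0 <= (K * d)%:E)%E by rewrite lee_fin mulr_ge0 // ltW.
have := nearest_le Yy1 Gy1 Kd0 dist1 => dB.
have dA := gXr x Ax xr2.
have -> : v + e = K * d / (a * d) by rewrite /a; field; rewrite !gt_eqF.
apply: ediv_le => //; [exact: geodist_ge0|exact: mulr_gt0].
Qed.

(** Along a rotation of a principal direction of the smallest singular value the
    tensor moves at speed [sg], whereas every decomposition of the rotated tensor
    is at least as far as the angle. *)
Lemma latent_cond_ge_rotation i (m : R) : (k i < n i)%N -> 0 < m ->
  (forall p u, frob_norm p = frob_norm S -> gX p u u = m ^+ 2 * frob_norm u ^+ 2) ->
  ((1 / (m * singval (k i) (flattening i S)))%:E
    <= latent_cond gX gY A Yhat F 0%R x0 y0)%E.
Proof.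
move=> kn m0 gXm; set sg := singval _ _.
have sg0 : 0 < sg by exact: singval_gt0.
have [P [W [th [B [C [w [p [rot tot [xE BC] [w1 wU] [pp wp]]]]]]]]] :=
  rotation_family S k0 US kn.
have [r r0 rdom] := domain_near.
have inY t : `|t| < r ->
    Yhat (mk_factors (fun j => rotated (U j) (P j) (W j) (th t j)), S).
  move=> tr; apply: rdom => [j||]; first exact: rotated_stiefel.
    by apply: le_lt_trans (rotated_dist (rot t)) _; rewrite tot sqrtr_sqr.
  by rewrite subrr frob_norm0.
apply: le_limf_esup => r' r'0.
pose t := Num.min (Num.min (r / 2) (1 / 2)) (r' / (2 * (sg + 1))).
have t0 : 0 < t by rewrite !lt_min !divr_gt0 //; lra.
have [tr t12 tr'] : [/\ t < r, t <= 1 / 2 & t * (2 * (sg + 1)) <= r'].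
  split; [|by rewrite /t !ge_min lexx orbT|].
    have : t <= r / 2 by rewrite /t !ge_min lexx.
    by lra.
  rewrite -ler_pdivlMr; last by lra.
  by rewrite /t ge_min lexx orbT.
have tpi : 0 < t < pi / 2.
  by rewrite t0 /=; apply: le_lt_trans t12 _; have := pi_ge2 R; lra.
have abst s : s \in `[0, 1] -> `|t - s * t| < r.
  rewrite in_itv /= => /andP[s0 s1]; apply: le_lt_trans tr.
  rewrite ger0_norm; last by rewrite subr_ge0 -[leRHS]mul1r ler_wpM2r // ltW.
  by rewrite gerBl mulr_ge0 // ltW.
pose x s := tucker (fun j => rotated (U j) (P j) (W j) (th s j)) S.
pose y s : factors R n k * tensor R k :=
  (mk_factors (fun j => rotated (U j) (P j) (W j) (th s j)), S).
have Gy s : G (y s) = x s by exact: tucker_map_mk_factors.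
have x00 : x 0 = x0 by rewrite /x xE cos0 sin0 scale1r scale0r addr0 subrK.
have sint : 0 < sin t by exact: sin_gt0_pihalf.
have xdiff : frob_norm (x t - x0) ^+ 2 = ((cos t - 1) ^+ 2 + sin t ^+ 2) * sg ^+ 2.
  rewrite -BC /x xE frob_norm_sqr.
  have -> : x0 - B + cos t *: B + sin t *: C - x0 = (cos t - 1) *: B + sin t *: C.
    rewrite scalerBl scale1r; apply/rowP => j; rewrite !mxE; ring.
  by [].
have tball : `|t| < r by rewrite ger0_norm // ltW.
exists (x t); split.
- by exists (y t); [exact: inY|exact: Gy].
- rewrite -subr_eq0 -frob_norm_eq0 -sqrf_eq0 xdiff gt_eqF // mulr_gt0 ?exprn_gt0 //.
  by rewrite ltr_wpDl ?sqr_ge0 ?exprn_gt0.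
- have c0 : 0 <= cos t <= 1.
    rewrite cos_le1 andbT ltW // cos_gt0_pihalf //.
    by case/andP: tpi => h1 ->; rewrite andbT; have := pi_gt0 R; lra.
  have st := sin_le_id (ltW t0).
  have key : (cos t - 1) ^+ 2 + sin t ^+ 2 <= (2 * t) ^+ 2.
    have e := cos2Dsin2 t; case/andP: c0 => h1 h2; nra.
  have h : frob_norm (x t - x0) <= 2 * t * sg.
    rewrite -ler_sqr ?nnegrE ?frob_norm_ge0 ?mulr_ge0 ?(ltW t0) ?(ltW sg0) //.
    by rewrite xdiff [leRHS]exprMn ler_wpM2r ?sqr_ge0.
  apply: le_lt_trans h _; apply: lt_le_trans tr'; nra.
rewrite nearest_x0.
have -> : 1 / (m * sg) = t / (m * (t * sg)) by field; rewrite !gt_eqF.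
apply: ediv_ge; [exact: ltW| |by rewrite !mulr_gt0|exact: geodist_ge0|]; last first.
- (* the curve in the image, run from the perturbed tensor back to [x0] *)
  pose c s := (x0 - B) + (cos (t - s * t) *: B + sin (t - s * t) *: C).
  pose dc s := (0 : tensor R n) + ((t * sin (t - s * t)) *: B + (- t * cos (t - s * t)) *: C).
  have Cc : C1_with c dc.
    have h1 := C1_scale (C1_cos_rev t) (C1_cst B).
    have h2 := C1_scale (C1_sin_rev t) (C1_cst C).
    have := C1_add (C1_cst (x0 - B)) (C1_add h1 h2); congr C1_with.
    by apply/funext => s /=; rewrite !scaler0 !addr0.
  have cE s : c s = x (t - s * t) by rewrite /c addrA -xE.
  have c0 : c 0 = x t by rewrite cE mul0r subr0.
  have c1 : c 1 = x0 by rewrite cE mul1r subrr.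
  rewrite -c0 -[X in geodist _ _ _ X]c1.
  apply: geodist_le (C1_curves_with Cc _) _.
    by move=> s s01; exists (y (t - s * t)); [apply/inY/abst|rewrite Gy cE].
  apply: curve_length_le => s s01; rewrite (derive1_C1 Cc) gXm; last first.
    rewrite cE /x tucker_stiefel_norm // => j; exact: rotated_stiefel.
  rewrite frob_norm_sqr /dc add0r BC.
  have -> : m ^+ 2 * (((t * sin (t - s * t)) ^+ 2 + (- t * cos (t - s * t)) ^+ 2) * sg ^+ 2)
     = (m * (t * sg)) ^+ 2 * (cos (t - s * t) ^+ 2 + sin (t - s * t) ^+ 2) by ring.
  by rewrite cos2Dsin2 mulr1 sqrtr_sqr ger0_norm // !mulr_ge0 // ltW.
- apply: (@nearest_ge _ (y t)); [exact: inY|exact: Gy| |].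
    have th1 s : s \in `[0, 1] -> Yhat (frame_curve U W P (th t) S S s).
      move=> s01; rewrite /frame_curve subrr scaler0 addr0.
      have rots j := rotating_scale s (rot t j).
      apply: rdom => [j||]; first exact: rotated_stiefel.
        apply: le_lt_trans (rotated_dist rots) _.
        apply: le_lt_trans (_ : Num.sqrt (total_angle (th t)) < _); last first.
          by rewrite tot sqrtr_sqr.
        move: s01; rewrite in_itv /= => /andP[s0 s1].
        rewrite ler_sqrt; last by rewrite tot sqr_ge0.
        apply: ler_sum => j _; apply: ler_sum => b _.
        by rewrite exprMn -[leRHS]mul1r ler_wpM2r ?sqr_ge0 // expr_le1.
      by rewrite subrr frob_norm0.
    apply: (frame_geodist (rot t) th1 (ltW t0)) => s _.
    by rewrite subrr gS0 addr0 -/(total_angle (th t)) tot.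
  move=> z [[zst zfull] zO] Gz.
  have Vz : tucker (factor z.1) z.2 = x t by exact: Gz.
  have range := same_range (k0 i) (fun j => rotated_stiefel (rot t j)) zst sg0 Vz.
  have [q zq] : exists q, factor z.1 i *m q = rotated (U i) (P i) (W i) (th t i) *m p.
    exists ((factor z.1 i)^T *m (rotated (U i) (P i) (W i) (th t i) *m p)).
    by rewrite [LHS]mulmxA [LHS]mulmxA -range.
  apply: (@geodist_ge_angle _ _ _ _ gS Yhat y0 z i w q t) => //.
  + by move=> y' [[y'st _] _]; exact: y'st.
  + have -> : q^T *m q = (factor z.1 i *m q)^T *m (factor z.1 i *m q).
      by rewrite trmx_mul [RHS]mulmxA -(mulmxA q^T) zst mulmx1.
    rewrite zq trmx_mul [LHS]mulmxA -(mulmxA p^T) (rotated_stiefel (rot t i)) mulmx1 //.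
  + by rewrite /= mk_factorsK.
  + by rewrite zq wp.
Qed.

(** Scaling the tensor: the norm of the core is determined by the tensor, so
    the core has to move as much as the tensor. *)
Lemma latent_cond_ge_scaling :
  S != 0 -> (forall p u, gX p u u = frob_norm u ^+ 2) ->
  (forall p u, gS p u u = frob_norm u ^+ 2) ->
  (1%:E <= latent_cond gX gY A Yhat F 0%R x0 y0)%E.
Proof.
move=> Sn0 gXE gSE; have N0 : 0 < frob_norm S by rewrite frob_norm_gt0.
set N := frob_norm S in N0.
have [r r0 rdom] := domain_near.
have inY (t : R) : `|t| * N < r -> Yhat (mk_factors U, (1 + t) *: S).
  move=> tr; apply: rdom => //; first by rewrite subrr frob_norm0.
  by rewrite scalerDl scale1r addrC addKr frob_normZ.
have GU t : G (mk_factors U, t *: S) = t *: x0.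
  by rewrite tucker_map_mk_factors tuckerZ.
apply: le_limf_esup => r' r'0.
pose t := Num.min r r' / (2 * N).
have mr : 0 < Num.min r r' by rewrite lt_min r0.
have t0 : 0 < t by rewrite divr_gt0 // mulr_gt0.
have tN : t * N = Num.min r r' / 2 by rewrite /t; field; rewrite gt_eqF.
have [tr tr'] : t * N < r /\ t * N < r'.
  have h1 : Num.min r r' <= r by rewrite ge_min lexx.
  have h2 : Num.min r r' <= r' by rewrite ge_min lexx orbT.
  by rewrite tN; lra.
have xN : frob_norm (((1 + t) *: x0 : tensor R n) - x0) = t * N.
  by rewrite scalerDl scale1r addrC addKr frob_normZ (tucker_stiefel_norm _ US) gtr0_norm.
have inYs s : s \in `[0, 1] -> `|t - s * t| * N < r.
  rewrite in_itv /= => /andP[s0 s1]; apply: le_lt_trans tr.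
  rewrite ler_wpM2r ?(ltW N0) // ger0_norm.
    by rewrite gerBl mulr_ge0 // ltW.
  by rewrite subr_ge0 -[leRHS]mul1r ler_wpM2r // ltW.
exists ((1 + t) *: x0 : tensor R n); split.
- by exists (mk_factors U, (1 + t) *: S); [apply: inY; rewrite gtr0_norm|exact: GU].
- by rewrite -subr_eq0 -frob_norm_eq0 xN gt_eqF // mulr_gt0.
- by rewrite xN.
rewrite nearest_x0.
rewrite [X in (X%:E <= _)%E](_ : 1 = t * N / (t * N)); last first.
  by rewrite divff // gt_eqF // mulr_gt0.
apply: ediv_ge; [exact/ltW/mulr_gt0| |exact: mulr_gt0|exact: geodist_ge0|]; last first.
- have Cc := C1_line ((1 + t) *: x0 : tensor R n) (- t *: x0 : tensor R n).
  set c := fun s => _ in Cc.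
  have cE s : c s = (1 + (t - s * t)) *: x0.
    by rewrite /c scalerA -scalerDl; congr (_ *: _); ring.
  have c0 : c 0 = (1 + t) *: x0 by rewrite cE mul0r subr0.
  have c1 : c 1 = x0 by rewrite cE mul1r subrr addr0 scale1r.
  rewrite -c0 -[X in geodist _ _ _ X]c1.
  apply: geodist_le (C1_curves_with Cc _) _.
    move=> s s01; exists (mk_factors U, (1 + (t - s * t)) *: S); last by rewrite GU cE.
    exact/inY/inYs.
  apply: curve_length_le => s s01; rewrite (derive1_C1 Cc) gXE sqrtr_sqr.
  rewrite /cst frob_normZ (tucker_stiefel_norm _ US) normrN (gtr0_norm t0) -/N.
  by rewrite ger0_norm // mulr_ge0 // ltW.
- apply: (@nearest_ge _ (mk_factors U, (1 + t) *: S)).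
  + by apply: inY; rewrite gtr0_norm.
  + exact: GU.
  + have Cc := C1_pair (C1_cst (mk_factors U)) (C1_line S (t *: S)).
    set c := fun s => _ in Cc.
    have cE s : c s = (mk_factors U, (1 + s * t) *: S).
      by rewrite /c /= scalerA scalerDl scale1r.
    have c0 : c 0 = y0 by rewrite cE mul0r addr0 scale1r.
    have c1 : c 1 = (mk_factors U, (1 + t) *: S) by rewrite cE mul1r.
    rewrite -c0 -c1; apply: geodist_le (C1_curves_with Cc _) _.
      move=> s; rewrite in_itv /= => /andP[s0 s1]; rewrite cE; apply: inY.
      apply: le_lt_trans tr; rewrite ler_wpM2r ?(ltW N0) //.
      have st : 0 <= s * t by rewrite mulr_ge0 // ltW.
      by rewrite ger0_norm // ler_piMl // ltW.
    apply: curve_length_le => s s01; rewrite (derive1_C1 Cc) /prod_metric /= gSE.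
    rewrite /abs_metric frob_dot0r add0r sqrtr_sqr frob_normZ (gtr0_norm t0) -/N.
    by rewrite ger0_norm // mulr_ge0 // ltW.
  + move=> z [[zst _] _] Gz; apply: geodist_ge => c /C1_curvesP[C c0 c1 _].
    have := length_ge_chord (g := gY) (c := c) (C1_snd C).
    rewrite c0 c1 /= => chord; apply: le_trans (chord _); last first.
      move=> s _; rewrite -[leLHS]ger0_norm ?frob_norm_ge0 // -sqrtr_sqr.
      rewrite ler_sqrt; last by rewrite addr_ge0 ?frob_dot_ge0.
      by rewrite /prod_metric gSE lerDr frob_dot_ge0.
    rewrite lee_fin; apply: le_trans (frob_norm_reverse _ _).
    have -> : frob_norm z.2 = (1 + t) * N.
      rewrite -(tucker_stiefel_norm z.2 zst).
      have -> : tucker (factor z.1) z.2 = (1 + t) *: x0 by exact: Gz.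
      rewrite frob_normZ (tucker_stiefel_norm _ US) gtr0_norm //; lra.
    by rewrite -/N; lra.
Qed.

End GeneralMetrics.

(** * The absolute and the relative metric *)

Section MetricFacts.
Local Open Scope classical_set_scope.
Local Open Scope ring_scope.
Context {R : realType} {D : nat} {n k : 'I_D -> nat}.
Local Notation factor := Defs.factor.

Lemma tucker_sigma_attained (S : tensor R k) : (exists i, (k i < n i)%N) ->
  exists i, [/\ (k i < n i)%N, tucker_sigma n S = singval (k i) (flattening i S) &
    forall j, (k j < n j)%N -> tucker_sigma n S <= singval (k j) (flattening j S)].
Proof.
move=> [i0 i0n]; pose f i := singval (k i) (flattening i S).
have [i /= iP imin] := @arg_minP _ R _ i0 (fun i => (k i < n i)%N) f i0n.
pose E := [set singval (k i) (flattening i S) | i in [set i | (k i < n i)%N]].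
have Elb : lbound E (f i) by move=> _ [j jn <-]; exact: imin.
have EE : tucker_sigma n S = f i.
  apply/eqP; rewrite eq_le; apply/andP; split.
    by apply: ge_inf; [exists (f i)|exists i].
  by apply: lb_le_inf => //; exists (f i), i.
by exists i; split => // j jn; rewrite EE; exact: imin.
Qed.

Lemma singval_le_norm (S : tensor R k) i : (0 < k i)%N ->
  singval (k i) (flattening i S) <= frob_norm S.
Proof.
move=> k0; pose e : 'rV[R]_(k i) := delta_mx 0 (Ordinal k0).
have e1 : sqnorm e = 1.
  by rewrite /sqnorm trmx_delta mul_delta_mx /mxtrace big_ord1 mxE !eqxx.
have := le_trans (singval_lower_bound (flattening i S) e k0) (flattening_rows_mul e S).
by rewrite e1 mulr1 mul1r ler_sqr ?nnegrE ?frob_norm_ge0 ?sqrtr_ge0.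
Qed.

Lemma full_rank_neq0 (S : tensor R k) i : (0 < k i)%N ->
  full_multilinear_rank S -> S != 0.
Proof.
move=> k0 Sf; rewrite -frob_norm_gt0; apply: lt_le_trans (singval_le_norm S k0).
exact: singval_gt0.
Qed.

Lemma geodist_ge_factors (gS : tensor R k -> tensor R k -> tensor R k -> R)
    (M : set (factors R n k * tensor R k)) y0 y :
  (forall p u, 0 <= gS p u u) ->
  ((frob_norm (y.1 - y0.1))%:E <= geodist (prod_metric abs_metric gS) M y0 y)%E.
Proof.
move=> gS0; apply: geodist_ge => c /C1_curvesP[C c0 c1 _].
have := length_ge_chord (g := prod_metric abs_metric gS) (c := c) (C1_fst C).
rewrite c0 c1; apply => s _; rewrite ler_sqrt ?lerDl //.
by rewrite addr_ge0 ?frob_dot_ge0.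
Qed.

Lemma rel_metricE m (p u : 'rV[R]_m) : rel_metric p u u = (frob_norm u / frob_norm p) ^+ 2.
Proof. by rewrite /rel_metric expr_div_n !frob_norm_sqr. Qed.

Lemma rel_metric_ge0 m (p u : 'rV[R]_m) : 0 <= rel_metric p u u.
Proof. by rewrite rel_metricE sqr_ge0. Qed.

Lemma abs_metricE m (p u : 'rV[R]_m) : abs_metric p u u = frob_norm u ^+ 2.
Proof. by rewrite frob_norm_sqr. Qed.

Lemma geodist_abs_ge m (M : set 'rV[R]_m) p q :
  ((frob_norm (q - p))%:E <= geodist abs_metric M p q)%E.
Proof.
apply: geodist_ge => c /C1_curvesP[C c0 c1 _].
have := length_ge_chord (g := abs_metric) (c := c) C.
by rewrite c0 c1; apply => s _; rewrite abs_metricE sqrtr_sqr ger0_norm ?frob_norm_ge0.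
Qed.

Lemma geodist_rel_ge m (M : set 'rV[R]_m) p q : (forall x, M x -> x != 0) ->
  ((Num.sqrt 2 * frob_norm (q - p) / Num.sqrt (frob_dot q q + frob_dot p p))%:E
    <= geodist rel_metric M p q)%E.
Proof.
move=> M0; apply: geodist_ge => c /C1_curvesP[C c0 c1 cM].
have := length_ge_relative (g := rel_metric) (c := c) C.
rewrite c0 c1; apply => s s01; first exact/M0/cM.
by rewrite rel_metricE sqrtr_sqr ger0_norm // divr_ge0 ?frob_norm_ge0.
Qed.

(** In [geodist_rel_ge] the chord is divided by the quadratic mean of the norms of
    the end points, which tends to the norm of [p]. *)
Lemma geodist_rel_near m (M : set 'rV[R]_m) p (a : R) : (forall x, M x -> x != 0) ->
  p != 0 -> 0 <= a < 1 / frob_norm p ->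
  exists2 r : R, 0 < r & forall x, M x -> frob_norm (x - p) < r ->
    ((a * frob_norm (x - p))%:E <= geodist rel_metric M x p)%E.
Proof.
move=> M0 p0 /andP[a0]; set N := frob_norm p.
have N0 : 0 < N by rewrite frob_norm_gt0.
rewrite ltr_pdivlMr // => aN; have a1 : 0 < a + 1 by rewrite ltr_wpDl.
exists ((1 - a * N) / (a + 1)) => [|x Mx xr]; first by rewrite divr_gt0 // subr_gt0.
apply: le_trans (geodist_rel_ge x p M0); rewrite lee_fin frob_norm_distC mulrAC.
apply: ler_wpM2r; first exact: frob_norm_ge0.
have xN : frob_norm x <= N + (1 - a * N) / (a + 1).
  have -> : x = (x - p) + p by rewrite subrK.
  apply: le_trans (frob_norm_triangle _ _) _; rewrite addrC lerD2l; exact: ltW.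
have ax : a * frob_norm x <= 1.
  apply: le_trans (ler_wpM2l a0 xN) _; rewrite mulrDr.
  have : a * ((1 - a * N) / (a + 1)) <= 1 - a * N.
    rewrite mulrCA -[leRHS]mulr1 ler_wpM2l ?subr_ge0 ?(ltW aN) //.
    by rewrite ler_pdivrMr // mul1r lerDl.
  lra.
rewrite -!frob_norm_sqr -/N.
have s0 : 0 < N ^+ 2 + frob_norm x ^+ 2 by rewrite ltr_wpDr ?sqr_ge0 ?exprn_gt0.
rewrite -[a]ger0_norm // -sqrtr_sqr -sqrtrV ?(ltW s0) // -sqrtrM // ler_sqrt; last first.
  by rewrite mulr_ge0 // invr_ge0 ltW.
rewrite ler_pdivlMr // mulrDr -!exprMn.
have h1 : (a * N) ^+ 2 <= 1 by rewrite expr_le1 ?mulr_ge0 ?(ltW N0) ?(ltW aN).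
have h2 : (a * frob_norm x) ^+ 2 <= 1 by rewrite expr_le1 ?mulr_ge0 ?frob_norm_ge0.
by lra.
Qed.

Lemma rel_metric_near m (p : 'rV[R]_m) (e : R) : p != 0 -> 0 < e ->
  exists2 r : R, 0 < r & forall q u, frob_norm (q - p) < r ->
    rel_metric q u u <= (1 / frob_norm p ^+ 2 + e) * frob_norm u ^+ 2.
Proof.
move=> p0 e0; set N := frob_norm p; have N0 : 0 < N by rewrite frob_norm_gt0.
set E := 1 / N ^+ 2 + e.
have E0 : 0 < E by rewrite ltr_wpDl // divr_ge0 ?sqr_ge0.
have sE : 0 < Num.sqrt E by rewrite sqrtr_gt0.
have sN : 1 / Num.sqrt E < N.
  rewrite ltr_pdivrMr // -ltr_sqr ?nnegrE ?mulr_ge0 ?(ltW N0) ?(ltW sE) //.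
  rewrite expr1n exprMn (sqr_sqrtr (ltW E0)) /E mulrDr mulrC divfK ?gt_eqF ?exprn_gt0 //.
  by rewrite ltrDl mulr_gt0 // exprn_gt0.
exists (N - 1 / Num.sqrt E) => [|q u qr]; first by rewrite subr_gt0.
have qN : 1 / Num.sqrt E < frob_norm q.
  have := frob_norm_reverse p q; rewrite frob_norm_distC -/N; lra.
have q0 : 0 < frob_norm q by apply: lt_trans qN; rewrite divr_gt0.
rewrite rel_metricE expr_div_n mulrC; apply: ler_wpM2r; first exact: sqr_ge0.
rewrite -[leRHS](sqr_sqrtr (ltW E0)) -exprVn ler_sqr ?nnegrE ?invr_ge0 ?(ltW q0) ?(ltW sE) //.
by rewrite -[leLHS]mul1r ler_pdivrMr // mulrC -ler_pdivrMr // ltW.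
Qed.

Lemma geodist_rel_ge_core (M : set (factors R n k * tensor R k)) y0 y :
  (forall z, M z -> z.2 != 0) ->
  ((Num.sqrt 2 * frob_norm (y.2 - y0.2) / Num.sqrt (frob_dot y.2 y.2 + frob_dot y0.2 y0.2))%:E
    <= geodist (prod_metric abs_metric rel_metric) M y0 y)%E.
Proof.
move=> M0; apply: geodist_ge => c /C1_curvesP[C c0 c1 cM].
have := length_ge_relative (g := prod_metric abs_metric rel_metric) (c := c) (C1_snd C).
rewrite c0 c1; apply => s s01; first exact/M0/cM.
rewrite -[leLHS]ger0_norm ?divr_ge0 ?frob_norm_ge0 // -sqrtr_sqr ler_sqrt; last first.
  by rewrite addr_ge0 ?frob_dot_ge0 ?rel_metric_ge0.
by rewrite -rel_metricE lerDr frob_dot_ge0.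
Qed.

Lemma geodist_abs_ge_core (M : set (factors R n k * tensor R k)) y0 y :
  ((frob_norm (y.2 - y0.2))%:E <= geodist (prod_metric abs_metric abs_metric) M y0 y)%E.
Proof.
apply: geodist_ge => c /C1_curvesP[C c0 c1 _].
have := length_ge_chord (g := prod_metric abs_metric abs_metric) (c := c) (C1_snd C).
rewrite c0 c1; apply => s _; rewrite ler_sqrt ?lerDr ?frob_dot_ge0 //.
by rewrite addr_ge0 ?frob_dot_ge0.
Qed.

Lemma geodist_abs_separated (M : set (factors R n k * tensor R k)) y0 y :
  geodist (prod_metric abs_metric abs_metric) M y0 y = 0%E -> y = y0.
Proof.
move=> d0; have h1 := geodist_ge_factors M y0 y (fun p u => frob_dot_ge0 u : 0 <= abs_metric p u u).
have h2 := geodist_abs_ge_core M y0 y; move: h1 h2; rewrite d0 !lee_fin => h1 h2.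
have {}h1 : y.1 = y0.1.
  by apply/eqP; rewrite -subr_eq0 -frob_norm_eq0 eq_le h1 frob_norm_ge0.
have {}h2 : y.2 = y0.2.
  by apply/eqP; rewrite -subr_eq0 -frob_norm_eq0 eq_le h2 frob_norm_ge0.
by rewrite [y]surjective_pairing [y0]surjective_pairing h1 h2.
Qed.

Lemma geodist_rel_separated (M : set (factors R n k * tensor R k)) y0 y :
  (forall z, M z -> z.2 != 0) -> y0.2 != 0 ->
  geodist (prod_metric abs_metric rel_metric) M y0 y = 0%E -> y = y0.
Proof.
move=> M0 y00 d0; have h1 := geodist_ge_factors M y0 y (@rel_metric_ge0 _).
have h2 := geodist_rel_ge_core y0 y M0; move: h1 h2; rewrite d0 !lee_fin => h1 h2.
have {}h1 : y.1 = y0.1.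
  by apply/eqP; rewrite -subr_eq0 -frob_norm_eq0 eq_le h1 frob_norm_ge0.
have {}h2 : y.2 = y0.2.
  apply/eqP; rewrite -subr_eq0 -frob_norm_eq0 eq_le frob_norm_ge0 andbT.
  have n0 : 0 < Num.sqrt (frob_dot y.2 y.2 + frob_dot y0.2 y0.2).
    by rewrite sqrtr_gt0 ltr_wpDl ?frob_dot_ge0 ?frob_dot_gt0.
  by move: h2; rewrite ler_pdivrMr // mul0r pmulr_rle0 // sqrtr_gt0.
by rewrite [y]surjective_pairing [y0]surjective_pairing h1 h2.
Qed.

End MetricFacts.

(** * The latent condition number of the Tucker decomposition *)

Theorem proposition6p2 (R : realType) (D : nat) (n k : 'I_D -> nat)
    (X : tensor R n) (U : forall i : 'I_D, 'M[R]_(n i, k i)) (S : tensor R k)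
    (k_gt0 : forall i : 'I_D, (0 < k i)%N)
    (XE : X = tucker U S)
    (U_stiefel : forall i : 'I_D, stiefel (U i))
    (S_full : full_multilinear_rank S)
    (k_lt_n : exists i : 'I_D, (k i < n i)%N) :
  let sigma := tucker_sigma n S in
  is_latent_cond_inv
    abs_metric (prod_metric abs_metric abs_metric)
    (tucker_domain R n k) (@tucker_map R D n k) (mk_factors U, S)
    (Num.max (1 / sigma) 1)%:E
  /\
  is_latent_cond_inv
    rel_metric (prod_metric abs_metric rel_metric)
    (tucker_domain R n k) (@tucker_map R D n k) (mk_factors U, S)
    (frob_norm X / sigma)%:E.
Proof.
move=> sigma; have [i0 [i0n sE smin]] := tucker_sigma_attained S k_lt_n.
rewrite -/sigma in sE smin.
have s0 : 0 < sigma by rewrite sE; exact: singval_gt0.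
have S0 : S != 0 by exact: (full_rank_neq0 (k_gt0 i0)).
have N0 : 0 < frob_norm S by rewrite frob_norm_gt0.
have sN : sigma <= frob_norm S by rewrite sE; exact: singval_le_norm.
have s20 : 0 < sigma ^+ 2 by exact: exprn_gt0.
have core0 (z : factors R n k * tensor R k) : tucker_domain R n k z -> z.2 != 0.
  by move=> [_ zf]; exact: (full_rank_neq0 (k_gt0 i0)).
have Gy0 : tucker_map (mk_factors U, S) = tucker U S :> tensor R n.
  exact: tucker_map_mk_factors.
split=> O Oopen Oy0 Yhat; rewrite Gy0 /Yhat; apply/eqP; rewrite eq_le; apply/andP; split.
(* absolute metric: [ka] has to dominate [1 / sigma ^+ 2] and the weight one of
   the core *)
- pose ka := Num.max (1 / sigma) 1 ^+ 2.
  have max1 : 1 <= Num.max (1 / sigma) 1 by rewrite le_max lexx orbT.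
  have maxs : 1 / sigma <= Num.max (1 / sigma) 1 by rewrite le_max lexx.
  have max0 : 0 <= Num.max (1 / sigma) 1 by exact: le_trans max1.
  have {1}-> : Num.max (1 / sigma) 1 = Num.sqrt ka / 1.
    by rewrite divr1 /ka sqrtr_sqr ger0_norm.
  apply: (@latent_cond_le _ _ _ _ _ _ _ _ k_gt0 U_stiefel S_full _ Oopen Oy0 _ _
    1 ka 1 sigma) => //.
  + by move=> p; rewrite abs_metricE frob_norm0 expr0n.
  + by move=> y _ _; exact: geodist_abs_separated.
  + by rewrite ler01 /ka exprn_ege1.
  + have -> : 1 / sigma ^+ 2 = (1 / sigma) ^+ 2 by rewrite expr_div_n expr1n.
    by rewrite ler_sqr ?nnegrE ?divr_ge0 ?(ltW s0).
  + move=> e e0; exists 1 => // p u _; rewrite abs_metricE ler_peMl ?sqr_ge0 //.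
    by rewrite lerDl ltW.
  + move=> a /andP[a0 a1]; exists 1 => // x _ _; apply: le_trans (geodist_abs_ge _ _ _).
    by rewrite lee_fin frob_norm_distC ler_piMl ?frob_norm_ge0 // ltW.
- have zero (p : tensor R k) : abs_metric p 0 0 = 0 by rewrite abs_metricE frob_norm0 expr0n.
  rewrite EFin_max ge_max; apply/andP; split.
    rewrite sE -[singval _ _]mul1r.
    apply: (latent_cond_ge_rotation k_gt0 U_stiefel S_full Oopen Oy0 _ zero _ i0n ltr01) => //.
    + by move=> p u; exact: frob_dot_ge0.
    + by move=> y _ _; exact: geodist_abs_separated.
    + by move=> p u _; rewrite abs_metricE expr1n mul1r.
  apply: (latent_cond_ge_scaling k_gt0 U_stiefel S_full Oopen Oy0 _ zero) => //.
  + by move=> p u; exact: frob_dot_ge0.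
  + by move=> y _ _; exact: geodist_abs_separated.
  + by move=> p u; exact: abs_metricE.
  + by move=> p u; exact: abs_metricE.
(* relative metric: near [S] the core has weight [1 / frob_norm S ^+ 2], which
   [1 / sigma ^+ 2] dominates *)
- have XN : frob_norm X = frob_norm S by rewrite XE tucker_stiefel_norm.
  have vE : frob_norm X / sigma = Num.sqrt (1 / sigma ^+ 2) / (1 / frob_norm S).
    rewrite XN -[1 in X in Num.sqrt (X / _)](expr1n _ 2) -expr_div_n sqrtr_sqr.
    by rewrite ger0_norm ?divr_ge0 ?(ltW s0) //; field; rewrite !gt_eqF.
  rewrite vE; apply: (@latent_cond_le _ _ _ _ _ _ _ _ k_gt0 U_stiefel S_full _ Oopen Oy0
    _ _ (1 / frob_norm S ^+ 2) (1 / sigma ^+ 2) (1 / frob_norm S) sigma) => //.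
  + by move=> p; rewrite rel_metricE frob_norm0 mul0r expr0n.
  + by move=> y _ _; apply: geodist_rel_separated => // z [/core0].
  + rewrite divr_ge0 ?sqr_ge0 //= ler_pM2l // lef_pV2 ?posrE ?exprn_gt0 //.
    by rewrite ler_sqr ?nnegrE ?(ltW s0) ?(ltW N0).
  + by rewrite divr_gt0.
  + by move=> e e0; exact: rel_metric_near.
  + move=> a; rewrite -(tucker_stiefel_norm S U_stiefel) => aN.
    apply: geodist_rel_near => //.
      move=> x [y [[yst yf] _] <-]; rewrite -frob_norm_gt0 /tucker_map tucker_stiefel_norm //.
      by rewrite frob_norm_gt0; apply: core0.
    by rewrite -frob_norm_gt0 tucker_stiefel_norm.
- have zero (p : tensor R k) : rel_metric p 0 0 = 0 by rewrite rel_metricE frob_norm0 mul0r expr0n.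
  have -> : frob_norm X / sigma =
      1 / (1 / frob_norm S * singval (k i0) (flattening i0 S)).
    by rewrite XE tucker_stiefel_norm // -sE; field; rewrite !gt_eqF.
  apply: (latent_cond_ge_rotation k_gt0 U_stiefel S_full Oopen Oy0 _ zero _ i0n) => //.
  + by move=> p u; exact: rel_metric_ge0.
  + by move=> y _ _; apply: geodist_rel_separated => // z [/core0].
  + by rewrite divr_gt0.
  + move=> p u pS; rewrite rel_metricE pS; ring.
Qed.
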